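(* Let $\lambda>0$ and let $S:\mathbb{Z}^3\to\mathbb{C}$ be a kernel satisfying: (i) $S(k,m,n)=0$ if $kmn=0$; (ii) $S(k,m,n)=S^\ast(-k,-m,-n)$; (iii) $S(k,m,n)=S(k,n,m)$; (iv) $S(k,m,n)=S(m,n,k)$; (v) $S(\eta k,\eta m,\eta n)=\eta^{-\lambda}S(k,m,n)$ for $\eta>0$; (vi) for some constant $C$ and all $k,m,n\in\mathbb{Z}$ with $kmn\neq0$, $$|S(k,m,n)|\le\frac{C}{\min\{|k|^\lambda,|m|^\lambda,|n|^\lambda\}}.$$ Let the bilinear form $a$ be defined by $$\widehat{a(u,v)}(k)=\sum_{n=-\infty}^{\infty}S(-k,k-n,n)\,\widehat{u}(k-n)\,\widehat{v}(n),\qquad k\in\mathbb{Z},$$ and suppose that $$s>\max\left\{\frac32-\lambda,\frac12\right\}.$$ Then, for any $f\in\dot H^s(\mathbb{T})$, the initial value problem $$u_t+a(u,u)_x=0,\qquad u(x,0)=f(x),$$ has a unique local solution $$u\in C\left(I;\dot H^s(\mathbb{T})\right)\cap C^1\left(I;\dot H^{s-1}(\mathbb{T})\right)$$ defined on the time interval $I=(-t_\ast,t_\ast)$, where $$t_\ast=\frac{1}{K_{s,\lambda}\|f\|_s},\qquad K_{s,\lambda}=C\,C_{s,\lambda}\,M_{s+\lambda-1}.$$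
   Context: $\mathbb{T}$ is the circle of length $2\pi$. Fourier coefficients are $\widehat f(k)=\frac{1}{2\pi}\int_{\mathbb{T}}f(x)e^{-ikx}\,dx$, so $f(x)=\sum_{k\in\mathbb{Z}}\widehat f(k)e^{ikx}$; for functions $u(x,t)$, the transform is taken in $x$ at each fixed $t$. A star denotes complex conjugation. $\dot H^r(\mathbb{T})$ is the Hilbert space of real-valued periodic functions $f$ (real periodic distributions when $r<0$) with $\widehat f(0)=0$ and $\|f\|_r=\left(\sum_{k\in\mathbb{Z},\,k\ne0}|k|^{2r}|\widehat f(k)|^2\right)^{1/2}<\infty$. The homogeneity condition (v) is required whenever both $(k,m,n)$ and $(\eta k,\eta m,\eta n)$ lie in $\mathbb{Z}^3$. Constants: $C$ is the constant in (vi). $C_{s,\lambda}$ is a constant, depending only on $s$ and $\lambda$, such that $$\frac{\left|k|k|^{2s}+m|m|^{2s}+n|n|^{2s}\right|}{\min\{|k|^\lambda,|m|^\lambda,|n|^\lambda\}}\le C_{s,\lambda}\left\{|k|^s|m|^s|n|^{1-\lambda}+|n|^s|k|^s|m|^{1-\lambda}+|m|^s|n|^s|k|^{1-\lambda}\right\}$$ for all nonzero $k,m,n\in\mathbb{R}$ with $k+m+n=0$ (such a constant exists for all $s>0$, $\lambda\ge0$). For $r>1/2$, $M_r=\left(2\sum_{n=1}^\infty n^{-2r}\right)^{1/2}$. If $K_{s,\lambda}\|f\|_s=0$, then $t_\ast$ is understood as $+\infty$. *)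

(* Defs.v *)
From HB Require Import structures.
From mathcomp Require Import all_boot all_order all_algebra.
From mathcomp Require Import all_classical all_reals all_analysis.
From mathcomp Require Import complex.

Set Implicit Arguments.
Unset Strict Implicit.
Unset Printing Implicit Defensive.

Import Order.TTheory GRing.Theory Num.Theory.
Import numFieldNormedType.Exports.

Local Open Scope classical_set_scope.
Local Open Scope ring_scope.

Section Periodic.
Variable R : realType.
Implicit Types (r : R) (T U V A : (R -> R) -> R) (g phi : R -> R) (k : int).

Definition testfun phi : Prop :=
  periodic phi (2 * pi) /\ forall n x, derivable (phi^`(n))%classic x 1.

(* Real periodic distributions: real linear functionals on the real test
   functions, continuous for the seminorms sup |phi^(j)|.  A functional T is a
   total function on R -> R, but only its values on test functions matter. *)
Definition is_distr T : Prop :=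
  (forall a phi psi, testfun phi -> testfun psi ->
     T (fun x => a * phi x + psi x) = a * T phi + T psi) /\
  exists (N : nat) (c : R), forall phi M, testfun phi ->
    (forall j x, (j <= N)%N -> `|(phi^`(j))%classic x| <= M) -> `|T phi| <= c * M.

Definition eq_distr T U : Prop := forall phi, testfun phi -> T phi = U phi.

Definition ddx T : (R -> R) -> R := fun phi => - T (phi^`())%classic.

(* Integrable functions on the circle of length 2 pi, as periodic functions on
   the line; two of them are the same element when they agree a.e. *)
Definition circle_fun g : Prop :=
  periodic g (2 * pi) /\
  (@lebesgue_measure R).-integrable `[0, 2 * pi] (EFin \o g).

Definition distr_of g : (R -> R) -> R := fun phi =>
  \int[@lebesgue_measure R]_(x in `[0, 2 * pi]) (g x * phi x).

(* (2 pi)^-1 <T, e^(-ikx)>; for T = distr_of g this is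
   (2 pi)^-1 \int_0^(2 pi) g(x) e^(-ikx) dx. *)
Definition fourier T k : R[i] :=
  (((2 * pi)^-1 * T (fun x => cos (k%:~R * x))) -i*
   ((2 * pi)^-1 * T (fun x => sin (k%:~R * x))))%C.

(* The norm of \dot H^r, equal to +oo when the series diverges. *)
Definition Hnorm r T : \bar R :=
  sqrte (\esum_(k in [set k : int | k != 0])
    (`|k%:~R| `^ (2 * r) * Normc.normc (fourier T k) ^+ 2)%:E).

Definition Hdot r T : Prop :=
  [/\ is_distr T,
      (0 <= r -> exists2 g, circle_fun g & eq_distr T (distr_of g)),
      fourier T 0 = 0
    & (Hnorm r T < +oo)%E].

(* W in C(I; \dot H^r), for an open set I of times. *)
Definition CH (I : set R) r (W : R -> (R -> R) -> R) : Prop :=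
  (forall t, I t -> Hdot r (W t)) /\
  (forall t0, I t0 -> Hnorm r (W t \- W t0) @[t --> t0] --> 0%E).

(* U in C^1(I; \dot H^r), with derivative W. *)
Definition C1H (I : set R) r (U W : R -> (R -> R) -> R) : Prop :=
  [/\ CH I r U, CH I r W &
    forall t, I t ->
      Hnorm r (fun phi => h^-1 * (U (t + h) phi - U t phi) - W t phi)
        @[h --> 0^'] --> 0%E].

(* Sums over all integers, as limits of the sums over [-N, N]; they are only
   used for absolutely convergent families. *)
Definition sumZ (a : int -> R) : R :=
  limn (fun N => \sum_(0 <= i < N.*2.+1) a (i%:Z - N%:Z)).

Definition sumZC (a : int -> R[i]) : R[i] :=
  (sumZ (fun n => complex.Re (a n)) +i* sumZ (fun n => complex.Im (a n)))%C.

(* A is the distribution a(U, V). *)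
Definition is_bilin (S : int -> int -> int -> R[i]) U V A : Prop :=
  is_distr A /\
  forall k, fourier A k =
    sumZC (fun n => S (- k) (k - n) n * fourier U (k - n) * fourier V n).

(* u in C(I; \dot H^s) `&` C^1(I; \dot H^(s-1)) solves u_t + a(u, u)_x = 0 on I,
   u(x, 0) = f(x), the equation being one between distributions in x for each
   t; u t x is the value at time t and position x. *)
Definition is_solution (S : int -> int -> int -> R[i]) (s : R) (f : R -> R)
    (I : set R) (u : R -> R -> R) : Prop :=
  [/\ forall t, I t -> circle_fun (u t),
      CH I s (fun t => distr_of (u t)),
      exists2 ut, C1H I (s - 1) (fun t => distr_of (u t)) ut &
        forall t, I t -> exists2 A,
          is_bilin S (distr_of (u t)) (distr_of (u t)) A &
          forall phi, testfun phi -> ut t phi + ddx A phi = 0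
    & {ae @lebesgue_measure R, forall x, u 0 x = f x}].

Definition Mconst r : R :=
  Num.sqrt (2 * limn (series (fun n => n.+1%:R `^ (- (2 * r))))).

(* The defining property of the constants C_{s,lambda}. *)
Definition is_Cslambda (s lambda c : R) : Prop :=
  forall k m n : R, k != 0 -> m != 0 -> n != 0 -> k + m + n = 0 ->
  `|k * `|k| `^ (2 * s) + m * `|m| `^ (2 * s) + n * `|n| `^ (2 * s)| /
    Num.min (`|k| `^ lambda) (Num.min (`|m| `^ lambda) (`|n| `^ lambda)) <=
  c * (`|k| `^ s * `|m| `^ s * `|n| `^ (1 - lambda)
     + `|n| `^ s * `|k| `^ s * `|m| `^ (1 - lambda)
     + `|m| `^ s * `|n| `^ s * `|k| `^ (1 - lambda)).

(* 1 / x, understood as +oo when x = 0. *)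
Definition tstar (x : R) : \bar R := if x == 0 then +oo%E else (x^-1)%:E.

End Periodic.

(* Main.v *)
Require Import Defs.
From mathcomp Require Import all_boot all_order all_algebra.
From mathcomp Require Import all_classical all_reals all_analysis.
From mathcomp Require Import complex measurable_realfun.
From mathcomp Require Import ring lra zify.

(** Work with the Fourier coefficients [c_k] of [u]: the equation becomes the
    infinite system [c_k' = - i k Q_k(c)], where [Q_k(c)] is a quadratic
    convolution with the kernel [S], and the permutation symmetry of [S] makes
    every energy identity a sum over triads [k + m + n = 0] that can be
    symmetrized.

    Three cancellations result. With no weight the symmetrized factor is
    [k + m + n = 0], so the L^2 norm is conserved ([momentum_T3]). With the weight
    [|k|^(2s)] it is the numerator in the definition of [C_{s,lambda}], whence
    [|d/dt ||u||_s^2| <= 2 K ||u||_s^3] ([sobolev_T3]); comparison with the equation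
    [y' = K y^2] bounds the norm by [F / (1 - K F |t|)], [F] being the norm of [f], on
    exactly the interval of the theorem ([riccati], [galerkin_growth]). For the
    difference [w] of two solutions, weighted by [|k|^-1], symmetrizing in the two
    indices carried by [w] gives [sg k + sg m], which kills the triads in which the
    third frequency is not dominant; the remaining ones satisfy a Gronwall estimate
    in [H^(-1/2)] under the sole assumption that the two solutions are bounded in
    [H^s] ([stability_T3], [stability]).

    Truncating to [|k| <= N] keeps all three. The truncated systems are globally
    solvable because of the conservation law ([galerkin]). Stability makes them a
    Cauchy sequence, coefficient by coefficient; the limit solves the system
    ([seq_exists]), and the same estimate gives uniqueness ([seq_unique]).
    The a priori bound only yields a weakly continuous solution; restarting at each
    time shows that the norm cannot jump up, which makes the continuity strong
    ([norm_usc], [strong_cont]). As [H^s] is an algebra for [s > 1/2], [Q] is locally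
    Lipschitz there, and the solution is C^1 in [H^(s-1)] ([quotient_cont]).

    It remains to pass between coefficients and functions. Coefficients in [H^s] are
    summable, so their series is a continuous function ([fourier_synth]); those of
    the time derivative, when [s >= 1], are those of an integrable function
    ([riesz_fischer]). Conversely an integrable function is determined by its
    coefficients ([fourier_inj]), because trigonometric polynomials of the form
    [1 - (1 - z^n)^(2^n)] approximate indicators of arcs boundedly. Hence the
    solution starts at [f] almost everywhere, and any other solution, whose
    coefficients solve the same system with a bounded norm on compact time intervals
    ([solution_ode], [solution_bound]), agrees with it almost everywhere. *)
Set Implicit Arguments.
Unset Strict Implicit.
Unset Printing Implicit Defensive.
Import Order.TTheory GRing.Theory Num.Theory.
Import numFieldNormedType.Exports.
Local Open Scope classical_set_scope.
Local Open Scope ring_scope.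
Local Notation nc := (@Normc.normc _).
Local Notation Re := complex.Re.
Local Notation Im := complex.Im.
Local Notation ab k := (`|k%:~R|).

(** * Finite sums over the integers *)

Section Windows.
Variable R : realType.
Implicit Types (g a b : int -> R) (r : seq int) (A B : R).

Definition Zr (N : nat) : seq int := [seq i%:Z - N%:Z | i <- iota 0 N.*2.+1].
Arguments Zr : simpl never.

Lemma uniq_Zr N : uniq (Zr N).
Proof. by rewrite map_inj_uniq ?iota_uniq // => i j /addIr [] ->. Qed.

Lemma mem_Zr N k : (k \in Zr N) = (`|k| <= N)%N.
Proof.
apply/mapP/idP => [[j]|kN]; first by rewrite mem_iota add0n; lia.
by exists (absz (k + N%:Z)%R); [rewrite mem_iota add0n; lia|lia].
Qed.

Lemma sub_Zr r : exists N, {subset r <= Zr N}.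
Proof.
elim: r => [|x r [N HN]]; first by exists 0%N.
exists (maxn N `|x|) => y; rewrite inE mem_Zr => /orP[/eqP ->|/HN].
  exact: leq_maxr.
by rewrite mem_Zr => h; exact: leq_trans h (leq_maxl _ _).
Qed.

Lemma ler_sum_sub g r1 r2 : (forall k, 0 <= g k) -> uniq r1 ->
  {subset r1 <= r2} -> \sum_(k <- r1) g k <= \sum_(k <- r2) g k.
Proof.
move=> g0; elim: r1 r2 => [|x r1 IH] r2 /=.
  by move=> _ _; rewrite big_nil sumr_ge0.
move=> /andP[xr1 ur1] sub; rewrite big_cons [leRHS](big_rem x) ?sub ?mem_head //=.
rewrite lerD2l; apply: IH => // y yr1.
have: y \in r2 by rewrite sub // inE yr1 orbT.
rewrite (perm_mem (perm_to_rem (sub _ (mem_head x r1)))) inE => /orP[/eqP yx|//].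
by rewrite -yx yr1 in xr1.
Qed.

Lemma sum_Zr_opp (V : zmodType) (g : int -> V) N :
  \sum_(k <- Zr N) g (- k) = \sum_(k <- Zr N) g k.
Proof.
rewrite -(big_map -%R xpredT g); apply: perm_big; apply: uniq_perm.
- by rewrite map_inj_uniq ?uniq_Zr //; exact: oppr_inj.
- exact: uniq_Zr.
move=> k; apply/mapP/idP => [[j + ->]|kN]; first by rewrite !mem_Zr abszN.
by exists (- k); rewrite ?opprK // mem_Zr abszN -mem_Zr.
Qed.

Lemma sum_CS (T : eqType) (r : seq T) (a b : T -> R) A B : 0 <= A -> 0 <= B ->
  \sum_(k <- r) a k ^+ 2 <= A ^+ 2 -> \sum_(k <- r) b k ^+ 2 <= B ^+ 2 ->
  \sum_(k <- r) a k * b k <= A * B.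
Proof.
have vanish (c : T -> R) : \sum_(k <- r) c k ^+ 2 <= 0 -> {in r, forall k, c k = 0}.
  move=> h k kr; apply/eqP; rewrite -sqrf_eq0; apply/eqP/le_anti; rewrite sqr_ge0 andbT.
  by apply: le_trans h; rewrite (big_rem k) //= lerDl sumr_ge0 // => *; exact: sqr_ge0.
rewrite le_eqVlt => /predU1P[<-|A0] B0'.
  rewrite expr0n => /vanish h _; rewrite mul0r big_seq big1 // => k kr.
  by rewrite h // mul0r.
move: B0'; rewrite le_eqVlt => /predU1P[<-|B0] hA.
  rewrite expr0n => /vanish h; rewrite mulr0 big_seq big1 // => k kr.
  by rewrite h // mulr0.
move=> hB.
(* Young's inequality with weights that balance the two factors *)
have step k : a k * b k <= (2 * A)^-1 * B * a k ^+ 2 + (2 * B)^-1 * A * b k ^+ 2.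
  rewrite -subr_ge0.
  have -> : (2 * A)^-1 * B * a k ^+ 2 + (2 * B)^-1 * A * b k ^+ 2 - a k * b k
    = (2 * A * B)^-1 * (B * a k - A * b k) ^+ 2 by field; rewrite !gt_eqF.
  by rewrite mulr_ge0 ?sqr_ge0 // invr_ge0 !mulr_ge0 // ltW.
apply: le_trans (ler_sum _ (fun k _ => step k)) _.
rewrite big_split /= -!mulr_sumr.
have -> : A * B = (2 * A)^-1 * B * A ^+ 2 + (2 * B)^-1 * A * B ^+ 2.
  by field; rewrite !gt_eqF.
by apply: lerD; apply: ler_wpM2l => //; rewrite mulr_ge0 ?invr_ge0 ?mulr_ge0 // ltW.
Qed.

(** Every finite partial sum is at most [A]: for a nonnegative family this says
    that the sum over all integers is at most [A], in a form which is invariant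
    under injective reindexing. *)
Definition sumle g A := forall r, uniq r -> \sum_(k <- r) g k <= A.

Lemma sumle_win g A : (forall k, 0 <= g k) ->
  (forall N, \sum_(k <- Zr N) g k <= A) -> sumle g A.
Proof.
move=> g0 h r ur; have [N sN] := sub_Zr r.
by apply: le_trans (h N); exact: ler_sum_sub.
Qed.

Lemma sumle_ge0 g A : sumle g A -> 0 <= A.
Proof. by move=> /(_ [::] isT); rewrite big_nil. Qed.

Lemma sumle_term g A k : sumle g A -> g k <= A.
Proof. by move=> /(_ [:: k] isT); rewrite big_seq1. Qed.

Lemma sumle_le g A B : sumle g A -> A <= B -> sumle g B.
Proof. by move=> h AB r ur; exact: le_trans (h r ur) AB. Qed.

Lemma sumle_mono a b A : (forall k, a k <= b k) -> sumle b A -> sumle a A.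
Proof. by move=> ab h r ur; apply: le_trans (h r ur); exact: ler_sum. Qed.

Lemma sumle_inj g A (h : int -> int) : injective h -> sumle g A ->
  sumle (g \o h) A.
Proof.
by move=> hi gA r ur; rewrite -(big_map h xpredT g); apply: gA; rewrite map_inj_uniq.
Qed.

Lemma sumleZ g A (x : R) : 0 <= x -> sumle g A -> sumle (fun k => x * g k) (x * A).
Proof. by move=> x0 h r ur; rewrite -mulr_sumr ler_wpM2l ?h. Qed.

Lemma sumle_CS a b A B : 0 <= A -> 0 <= B ->
  sumle (fun k => a k ^+ 2) (A ^+ 2) -> sumle (fun k => b k ^+ 2) (B ^+ 2) ->
  sumle (fun k => a k * b k) (A * B).
Proof. by move=> A0 B0 ha hb r ur; apply: sum_CS; [| |exact: ha|exact: hb]. Qed.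

(** The least bound, i.e. the sum of the family. *)
Lemma sumle_sup g A : (forall k, 0 <= g k) -> sumle g A ->
  exists B, [/\ sumle g B, B <= A &
    forall e, 0 < e -> exists N, forall M, (N <= M)%N -> B - e < \sum_(k <- Zr M) g k].
Proof.
move=> g0 hA; pose E := [set \sum_(k <- r) g k | r in [set r : seq int | uniq r]].
have supE : has_sup E.
  split; first by exists 0; exists [::] => //=; rewrite big_nil.
  by exists A => _ [r ur <-]; exact: hA.
exists (sup E); split.
- by move=> r ur; apply: sup_upper_bound => //; exists r.
- by apply: ge_sup; [case: supE|move=> _ [r ur <-]; exact: hA].
move=> e e0; have [_ [r ur <-] hr] := sup_adherent e0 supE.
have [N sN] := sub_Zr r; exists N => M NM; apply: lt_le_trans hr _.
apply: ler_sum_sub => // k /sN; rewrite !mem_Zr => h; exact: leq_trans h NM.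
Qed.

Lemma sumle_tail g A : (forall k, 0 <= g k) -> sumle g A ->
  forall e, 0 < e -> exists N, forall r, uniq r ->
    (forall k, k \in r -> (N < `|k|)%N) -> \sum_(k <- r) g k <= e.
Proof.
move=> g0 hA e e0; have [B [hB _ hN]] := sumle_sup g0 hA.
have [N /(_ N (leqnn _)) HN] := hN e e0; exists N => r ur hr.
have : \sum_(k <- Zr N ++ r) g k <= B.
  apply: hB; rewrite cat_uniq uniq_Zr ur andbT /=.
  by apply/hasPn => k /hr; rewrite mem_Zr -ltnNge.
by rewrite big_cat /= => h; lra.
Qed.

End Windows.
Arguments Zr : simpl never.

(** * Complex numbers *)

Section ComplexNorm.
Variable R : realType.
Implicit Types (z w : R[i]) (x y : R).

Lemma ncE z : nc z ^+ 2 = Re z ^+ 2 + Im z ^+ 2.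
Proof. by case: z => a b /=; rewrite sqr_sqrtr // addr_ge0 ?sqr_ge0. Qed.

Lemma nc_ge0 z : 0 <= nc z.
Proof. by case: z => a b /=; exact: sqrtr_ge0. Qed.

Lemma Re_le_nc z : `|Re z| <= nc z.
Proof.
by rewrite -ler_sqr ?nnegrE ?nc_ge0 // ncE -normrX ger0_norm ?sqr_ge0 // lerDl sqr_ge0.
Qed.

Lemma Im_le_nc z : `|Im z| <= nc z.
Proof.
by rewrite -ler_sqr ?nnegrE ?nc_ge0 // ncE -normrX ger0_norm ?sqr_ge0 // lerDr sqr_ge0.
Qed.

Lemma nc_le_ReIm z : nc z <= `|Re z| + `|Im z|.
Proof.
rewrite -ler_sqr ?nnegrE ?addr_ge0 ?nc_ge0 // ncE sqrrD !real_normK ?num_real //.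
by rewrite -addrA lerD2l lerDr mulrn_wge0 // mulr_ge0.
Qed.

Lemma ncJ z : nc (z^*)%C = nc z.
Proof. by case: z => a b /=; rewrite sqrrN. Qed.

Lemma ncD z w : nc (z + w) <= nc z + nc w.
Proof. exact: le_normcD. Qed.

Lemma ncB z w : nc (z - w) <= nc z + nc w.
Proof. by rewrite -(normcN w); exact: ncD. Qed.

Lemma nc_sum (T : Type) (r : seq T) (P : pred T) (F : T -> R[i]) :
  nc (\sum_(k <- r | P k) F k) <= \sum_(k <- r | P k) nc (F k).
Proof.
elim/big_rec2: _ => [|k x z _ h]; first by rewrite Normc.normc0.
by apply: le_trans (ncD _ _) _; rewrite lerD2l.
Qed.

Lemma Re_add z w : Re (z + w) = Re z + Re w. Proof. by case: z; case: w. Qed.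
Lemma Im_add z w : Im (z + w) = Im z + Im w. Proof. by case: z; case: w. Qed.
Lemma Re_opp z : Re (- z) = - Re z. Proof. by case: z. Qed.
Lemma Im_opp z : Im (- z) = - Im z. Proof. by case: z. Qed.
Lemma Re_mul z w : Re (z * w) = Re z * Re w - Im z * Im w.
Proof. by case: z; case: w. Qed.
Lemma Im_mul z w : Im (z * w) = Re z * Im w + Im z * Re w.
Proof. by case: z; case: w. Qed.
Lemma Re_conj z : Re (z^*)%C = Re z. Proof. by case: z. Qed.
Lemma Im_conj z : Im (z^*)%C = - Im z. Proof. by case: z. Qed.
Lemma Re_sum (T : Type) (r : seq T) (P : pred T) (F : T -> R[i]) :
  Re (\sum_(k <- r | P k) F k) = \sum_(k <- r | P k) Re (F k).
Proof. by elim/big_rec2: _ => // k x z _ <-; rewrite Re_add. Qed.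
Lemma Im_sum (T : Type) (r : seq T) (P : pred T) (F : T -> R[i]) :
  Im (\sum_(k <- r | P k) F k) = \sum_(k <- r | P k) Im (F k).
Proof. by elim/big_rec2: _ => // k x z _ <-; rewrite Im_add. Qed.

Lemma complex_ext z w : Re z = Re w -> Im z = Im w -> z = w.
Proof. by case: z; case: w => /= ? ? ? ? -> ->. Qed.

End ComplexNorm.

Definition ReImE := (Re_add, Im_add, Re_opp, Im_opp, Re_mul, Im_mul, Re_conj, Im_conj).

(** * Series over the integers *)

Section SeriesZ.
Variable R : realType.
Implicit Types (g : int -> R) (z : R[i]) (a : int -> R[i]).

Lemma sum_Zr_rec (V : zmodType) (g : int -> V) N :
  \sum_(k <- Zr N.+1) g k = g N.+1%:Z + g (- N.+1%:Z) + \sum_(k <- Zr N) g k.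
Proof.
transitivity (\sum_(k <- [:: N.+1%:Z, - N.+1%:Z & Zr N]) g k); last first.
  by rewrite !big_cons addrA.
apply: perm_big; apply: uniq_perm.
- exact: uniq_Zr.
- by rewrite cons_uniq in_cons mem_Zr cons_uniq mem_Zr uniq_Zr; lia.
by move=> k; rewrite mem_Zr in_cons in_cons mem_Zr; lia.
Qed.

Lemma sum_Zr_series (V : zmodType) (g : int -> V) N :
  \sum_(k <- Zr N) g k =
  g 0 + \sum_(0 <= i < N) (g i.+1%:Z + g (- i.+1%:Z)).
Proof.
elim: N => [|N IH]; first by rewrite /Zr [iota _ _]/= big_seq1 subrr big_geq // addr0.
rewrite sum_Zr_rec IH big_nat_recr // [LHS]addrC -addrA; done.
Qed.

Lemma sumZE g : sumZ g = limn (fun N => \sum_(k <- Zr N) g k).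
Proof.
by rewrite /sumZ; congr (limn _); apply/funext => N; rewrite big_map /index_iota subn0.
Qed.

Lemma sumZ_cvg g A : sumle (fun k => `|g k|) A ->
  (fun N => \sum_(k <- Zr N) g k) @ \oo --> sumZ g.
Proof.
move=> gA; rewrite sumZE; apply/cvg_ex.
pose u i := g i.+1%:Z + g (- i.+1%:Z).
have cu : cvgn (series u).
  apply: normed_cvg; apply: nondecreasing_is_cvgn.
    by apply: nondecreasing_series => n _ _; exact: normr_ge0.
  exists A => _ [n _ <-] /=; rewrite /series /=.
  apply: le_trans (gA _ (uniq_Zr n)); rewrite sum_Zr_series.
  by rewrite ler_wpDl // ler_sum // => i _; exact: ler_normD.
exists (g 0 + limn (series u)).
under eq_fun do rewrite sum_Zr_series.
by apply: cvgD => //; exact: cvg_cst.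
Qed.

Lemma sumZC_near a A l e (N : nat) : sumle (fun k => nc (a k)) A ->
  (forall M, (N <= M)%N -> nc (\sum_(k <- Zr M) a k - l) <= e) ->
  nc (sumZC a - l) <= e.
Proof.
move=> aA h.
have e0 : 0 <= e by apply: le_trans (h N (leqnn N)); exact: nc_ge0.
have cR : (fun N => \sum_(k <- Zr N) Re (a k)) @ \oo --> sumZ (fun k => Re (a k)).
  by apply: (sumZ_cvg (A := A)); apply: sumle_mono aA => k; exact: Re_le_nc.
have cI : (fun N => \sum_(k <- Zr N) Im (a k)) @ \oo --> sumZ (fun k => Im (a k)).
  by apply: (sumZ_cvg (A := A)); apply: sumle_mono aA => k; exact: Im_le_nc.
rewrite -ler_sqr ?nnegrE ?nc_ge0 // ncE.
have c2 : (fun N => (\sum_(k <- Zr N) Re (a k) - Re l) ^+ 2 +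
    (\sum_(k <- Zr N) Im (a k) - Im l) ^+ 2) @ \oo -->
    Re (sumZC a - l) ^+ 2 + Im (sumZC a - l) ^+ 2.
  rewrite !ReImE /=; apply: cvgD; apply: cvgM; apply: cvgB => //; exact: cvg_cst.
rewrite -(cvg_lim (@Rhausdorff R) c2); apply: limr_le.
  by apply/cvg_ex; eexists; exact: c2.
exists N => // M /= NM; have := h M NM.
by rewrite -ler_sqr ?nnegrE ?nc_ge0 // ncE !ReImE Re_sum Im_sum.
Qed.

Lemma sumZC_le a A : sumle (fun k => nc (a k)) A -> nc (sumZC a) <= A.
Proof.
move=> aA; rewrite -[sumZC a]subr0; apply: (sumZC_near (N := 0) aA) => M _.
by rewrite subr0; apply: le_trans (nc_sum _ _ _) _; exact: aA (uniq_Zr M).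
Qed.

End SeriesZ.

(** * Powers and the constant of the Sobolev embedding *)

Section Powers.
Variable R : realType.
Implicit Types (k m n : int) (r s p : R).

Lemma ab_gt0 k : k != 0 -> 0 < ab k :> R.
Proof. by move=> k0; rewrite normr_gt0 intr_eq0. Qed.

Lemma ab_ge1 k : k != 0 -> 1 <= ab k :> R.
Proof. by move=> k0; rewrite -intr_norm ler1z; lia. Qed.

Lemma abN k : ab (- k) = ab k :> R.
Proof. by rewrite rmorphN normrN. Qed.

Lemma abzE k : ab k = (absz k)%:R :> R.
Proof. by rewrite -intr_norm -abszE. Qed.

Lemma powR_ge1 (x r : R) : 1 <= x -> 0 <= r -> 1 <= x `^ r.
Proof. by move=> x1 r0; rewrite -(powRr0 x) ler_powR. Qed.

Lemma ler_powR_base (x y r : R) : 0 <= r -> 0 <= x -> x <= y -> x `^ r <= y `^ r.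
Proof.
by move=> r0 x0 xy; apply: ge0_ler_powR => //; rewrite nnegrE //; exact: le_trans x0 xy.
Qed.

Lemma ler_powR_baseN (x y r : R) : r <= 0 -> 0 < x -> x <= y -> y `^ r <= x `^ r.
Proof.
move=> r0 x0 xy; have y0 : 0 < y by exact: lt_le_trans xy.
rewrite -[r]opprK (powRN x (- r)) (powRN y (- r)) lef_pV2 ?posrE ?powR_gt0 //.
by apply: ge0_ler_powR; rewrite ?nnegrE ?oppr_ge0 // ltW.
Qed.

Lemma powRsq (x r : R) : 0 <= x -> (x `^ r) ^+ 2 = x `^ (2 * r).
Proof. by move=> x0; rewrite mulrC powRrM powR_mulrn // powR_ge0. Qed.

Lemma powR_mul (x r s : R) : 0 < x -> x `^ r * x `^ s = x `^ (r + s).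
Proof. by move=> x0; rewrite powRD // (gt_eqF x0) implybT. Qed.

(** Comparison with the telescoping sum of the antiderivative [x `^ (1 - p)]. *)
Lemma pseries_bound p (n : nat) : 1 < p ->
  \sum_(0 <= i < n) i.+1%:R `^ (- p) <= 1 + (p - 1)^-1 :> R.
Proof.
move=> p1; have pm : 0 < p - 1 by rewrite subr_gt0.
suff H : \sum_(0 <= i < n.+1) i.+1%:R `^ (- p) <=
    1 + (p - 1)^-1 * (1 - n.+1%:R `^ (1 - p)) :> R.
  apply: (@le_trans _ _ (\sum_(0 <= i < n.+1) i.+1%:R `^ (- p))).
    by rewrite [leRHS]big_nat_recr //= lerDl powR_ge0.
  apply: le_trans H _; rewrite lerD2l ler_piMr ?invr_ge0 ?(ltW pm) //.
elim: n => [|n IH].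
  by rewrite big_nat1 !powR1 subrr mulr0 addr0.
rewrite big_nat_recr //=; apply: le_trans (lerD IH (lexx _)) _.
rewrite -addrA lerD2l.
set a : R := n.+1%:R; have a0 : 0 < a by rewrite ltr0n.
have Ea : n.+2%:R = a + 1 :> R by rewrite -natr1.
rewrite Ea.
have dp x : x \in `]a, a + 1[ -> is_derive x 1 (@powR R ^~ (1 - p)) ((1 - p) * x `^ (- p)).
  rewrite in_itv /= => /andP[ax _]; have := is_derive1_powR (1 - p) (lt_trans a0 ax).
  by rewrite addrAC subrr add0r.
have [c] : exists2 c, c \in `]a, a + 1[ &
   (a + 1) `^ (1 - p) - a `^ (1 - p) = ((1 - p) * c `^ (- p)) * ((a + 1) - a).
  apply: MVT => //; first by rewrite ltrDl.
  apply: derivable_within_continuous => x; rewrite in_itv /= => /andP[ax _].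
  by have [] := is_derive1_powR (1 - p) (lt_le_trans a0 ax).
rewrite in_itv /= => /andP[ac ca] E.
have : (a + 1) `^ (- p) <= c `^ (- p).
  apply: ler_powR_baseN; [lra|exact: lt_trans ac|exact: ltW].
have -> : c `^ (- p) = (p - 1)^-1 * (a `^ (1 - p) - (a + 1) `^ (1 - p)).
  by rewrite -[a `^ _ - _]opprB E; field; rewrite gt_eqF.
rewrite !mulrBr mulr1; lra.
Qed.

(** [Mconst r] is the l^2 norm of the weight [|k| `^ - r]. *)
Lemma Mconst_sumle r : 1 / 2 < r ->
  sumle (fun k => if k == 0 then 0 else ab k `^ (- (2 * r))) (Mconst r ^+ 2).
Proof.
move=> r1; pose u (n : nat) : R := n.+1%:R `^ (- (2 * r)).
have ndu : {homo series u : n m / (n <= m)%N >-> n <= m}.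
  by apply: nondecreasing_series => n _ _; exact: powR_ge0.
have cu : cvgn (series u).
  apply: nondecreasing_is_cvgn => //.
  exists (1 + (2 * r - 1)^-1) => _ [n _ <-].
  by apply: pseries_bound; lra.
have l0 : 0 <= limn (series u).
  by apply: le_trans (nondecreasing_cvgn_le ndu cu 0); rewrite /series /= big_geq.
rewrite /Mconst sqr_sqrtr; last by rewrite mulr_ge0.
apply: sumle_win => [k|N]; first by case: ifP => // _; exact: powR_ge0.
rewrite sum_Zr_series eqxx add0r.
apply: (@le_trans _ _ (2 * series u N)); last first.
  by rewrite ler_wpM2l //; exact: nondecreasing_cvgn_le.
rewrite /series /= mulr_sumr; apply: ler_sum => i _.
by rewrite abN abzE /u; lra.
Qed.

End Powers.

(** * Trilinear sums over triads *)

Section Triads.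
Variable R : realType.
Implicit Types (k m n : int) (N : nat).

(** Sum over the triads [k + m + n = 0] with entries in [[-N, N]]. *)
Definition T3 (V : zmodType) N (G : int -> int -> int -> V) : V :=
  \sum_(k <- Zr N) \sum_(m <- Zr N) \sum_(n <- Zr N | k + m + n == 0) G k m n.

Lemma eq_T3 (V : zmodType) N (G H : int -> int -> int -> V) :
  (forall k m n, k + m + n = 0 -> G k m n = H k m n) -> T3 N G = T3 N H.
Proof.
move=> GH; apply: eq_bigr => k _; apply: eq_bigr => m _.
by apply: eq_bigr => n /eqP; exact: GH.
Qed.

Lemma T3_swap12 (V : zmodType) N (G : int -> int -> int -> V) :
  T3 N G = T3 N (fun k m n => G m k n).
Proof.
rewrite /T3 exchange_big /=; apply: eq_bigr => k _; apply: eq_bigr => m _.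
by apply: eq_bigl => n; rewrite (addrC k m).
Qed.

Lemma T3_swap23 (V : zmodType) N (G : int -> int -> int -> V) :
  T3 N G = T3 N (fun k m n => G k n m).
Proof.
rewrite /T3; apply: eq_bigr => k _.
under eq_bigr do rewrite big_mkcond; rewrite exchange_big /=.
apply: eq_bigr => m _; rewrite [RHS]big_mkcond /=; apply: eq_bigr => n _.
by rewrite addrAC.
Qed.

Lemma T3D (V : zmodType) N (G H : int -> int -> int -> V) :
  T3 N (fun k m n => G k m n + H k m n) = T3 N G + T3 N H.
Proof.
rewrite /T3 -big_split; apply: eq_bigr => k _; rewrite -big_split.
by apply: eq_bigr => m _; rewrite -big_split.
Qed.

Lemma T3Z N (x : R) (G : int -> int -> int -> R) :
  T3 N (fun k m n => x * G k m n) = x * T3 N G.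
Proof.
rewrite /T3 mulr_sumr; apply: eq_bigr => k _; rewrite mulr_sumr.
by apply: eq_bigr => m _; rewrite mulr_sumr.
Qed.

Lemma ler_T3 N (G H : int -> int -> int -> R) :
  (forall k m n, k + m + n = 0 -> G k m n <= H k m n) -> T3 N G <= T3 N H.
Proof.
move=> GH; apply: ler_sum => k _; apply: ler_sum => m _.
by apply: ler_sum => n /eqP; exact: GH.
Qed.

Lemma norm_T3 N (G : int -> int -> int -> R) :
  `|T3 N G| <= T3 N (fun k m n => `|G k m n|).
Proof.
apply: le_trans (ler_norm_sum _ _ _) _; apply: ler_sum => k _.
apply: le_trans (ler_norm_sum _ _ _) _; apply: ler_sum => m _.
exact: ler_norm_sum.
Qed.

(** By relabelling the triad, a weight can be averaged over the indices in which
    the summand is symmetric; the cancellations of the energy estimates come from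
    these averages. *)
Lemma T3_sym2 N (al : int -> R) (P : int -> int -> int -> R) :
  (forall k m n, P k m n = P m k n) ->
  T3 N (fun k m n => al k * P k m n) =
  T3 N (fun k m n => (al k + al m) / 2 * P k m n).
Proof.
move=> P12; pose X := T3 N (fun k m n => al k * P k m n).
have E2 : X = T3 N (fun k m n => al m * P k m n).
  by rewrite /X T3_swap12; apply: eq_T3 => k m n _; rewrite P12.
have -> : T3 N (fun k m n => (al k + al m) / 2 * P k m n) = 2^-1 * (X + X).
  rewrite {2}E2 /X -T3D -T3Z; apply: eq_T3 => k m n _; ring.
by rewrite /X; field.
Qed.

Lemma T3_sym3 N (al : int -> R) (P : int -> int -> int -> R) :
  (forall k m n, P k m n = P m k n) -> (forall k m n, P k m n = P k n m) ->
  T3 N (fun k m n => al k * P k m n) =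
  T3 N (fun k m n => (al k + al m + al n) / 3 * P k m n).
Proof.
move=> P12 P23; pose X := T3 N (fun k m n => al k * P k m n).
have E2 : X = T3 N (fun k m n => al m * P k m n).
  by rewrite /X T3_swap12; apply: eq_T3 => k m n _; rewrite P12.
have E3 : X = T3 N (fun k m n => al n * P k m n).
  by rewrite E2 T3_swap23; apply: eq_T3 => k m n _; rewrite P23.
have -> : T3 N (fun k m n => (al k + al m + al n) / 3 * P k m n) = 3^-1 * (X + X + X).
  rewrite {3}E3 {2}E2 /X -!T3D -T3Z; apply: eq_T3 => k m n _; ring.
by rewrite /X; field.
Qed.

Lemma triad_collapse (V : zmodType) N k n (b : int -> V) :
  \sum_(m <- Zr N | k + m + n == 0) b m =
  if - k - n \in Zr N then b (- k - n) else 0.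
Proof.
have E m : (k + m + n == 0) = (m == - k - n) by apply/eqP/eqP; lia.
rewrite (eq_bigl _ _ E); case: ifP => h.
  by rewrite -big_filter filter_pred1_uniq ?uniq_Zr // big_seq1.
by rewrite big_seq_cond big1 // => m /andP[mr /eqP mE]; rewrite mE h in mr.
Qed.

(** Two factors are summed by the Cauchy-Schwarz inequality along the shift by
    the third index. *)
Lemma T3_CS N (a b g : int -> R) (A B D : R) :
  0 <= A -> 0 <= B -> (forall k, 0 <= a k) -> (forall k, 0 <= b k) ->
  (forall k, 0 <= g k) ->
  sumle (fun k => a k ^+ 2) (A ^+ 2) -> sumle (fun k => b k ^+ 2) (B ^+ 2) ->
  sumle g D -> T3 N (fun k m n => a k * b m * g n) <= A * B * D.
Proof.
move=> A0 B0 a0 b0 g0 hA hB hD.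
rewrite T3_swap23 T3_swap12 /T3.
apply: (@le_trans _ _ (\sum_(n <- Zr N) g n * (A * B))); last first.
  by rewrite -mulr_suml mulrC ler_wpM2l ?mulr_ge0 //; apply: hD; exact: uniq_Zr.
apply: ler_sum => n _.
apply: (@le_trans _ _ (g n * \sum_(k <- Zr N) a k * b (- k - n))).
  rewrite mulr_sumr; apply: ler_sum => k _.
  have -> : \sum_(m <- Zr N | n + k + m == 0) a k * b m * g n =
      g n * (a k * \sum_(m <- Zr N | k + m + n == 0) b m).
    rewrite !mulr_sumr; apply: eq_big => m; first by rewrite -addrA addrC.
    by move=> _; ring.
  rewrite triad_collapse; apply: ler_wpM2l => //; apply: ler_wpM2l => //.
  by case: ifP.
apply: ler_wpM2l => //; apply: sum_CS => //; first by apply: hA; exact: uniq_Zr.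
apply: (sumle_inj (h := fun k => - k - n) _ hB); last exact: uniq_Zr.
by move=> x y /addIr /oppr_inj.
Qed.

End Triads.

(** * The quadratic nonlinearity on Fourier coefficients *)

Section Hermitian.
Variable R : realType.
Implicit Types (c u v : int -> R[i]) (s B : R).

(** Fourier coefficients of real functions of mean zero. *)
Definition hermitian c := c 0 = 0 /\ forall k, c (- k) = ((c k)^*)%C.

(** The [H^s] norm is at most [B], without forming the sum of the series. *)
Definition hbd s c B := sumle (fun k => (ab k `^ s * nc (c k)) ^+ 2) (B ^+ 2).

Lemma hermitianD u v : hermitian u -> hermitian v -> hermitian (fun k => u k + v k).
Proof.
by move=> [u0 hu] [v0 hv]; split=> [|k]; rewrite ?u0 ?v0 ?addr0 // hu hv rmorphD.
Qed.

Lemma hermitianB u v : hermitian u -> hermitian v -> hermitian (fun k => u k - v k).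
Proof.
by move=> [u0 hu] [v0 hv]; split=> [|k]; rewrite ?u0 ?v0 ?subr0 // hu hv rmorphB.
Qed.

(** Cauchy-Schwarz against the square summable weight [|k| `^ - r]. *)
Lemma sobolev r (y : int -> R) B : 1 / 2 < r -> 0 <= B ->
  sumle (fun k => y k ^+ 2) (B ^+ 2) ->
  sumle (fun k => (if k == 0 then 0 else ab k `^ (- r)) * y k) (Mconst r * B).
Proof.
move=> r1 B0 hy; apply: sumle_CS => //; first exact: sqrtr_ge0.
apply: sumle_mono (Mconst_sumle r1) => k.
by case: ifP => _; rewrite ?expr0n // powRsq // mulrN.
Qed.

Lemma Mconst_ge0 (r : R) : 0 <= Mconst r.
Proof. exact: sqrtr_ge0. Qed.

Lemma hbd_l1 s c B : 1 / 2 < s -> 0 <= B -> c 0 = 0 -> hbd s c B ->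
  sumle (fun k => nc (c k)) (Mconst s * B).
Proof.
move=> s1 B0 c0 hc; apply: sumle_mono (sobolev s1 B0 hc) => k.
case: eqP => [->|/eqP k0]; first by rewrite c0 Normc.normc0 mul0r.
by rewrite mulrA powR_mul ?ab_gt0 // addNr powRr0 mul1r.
Qed.

Lemma hbd_sup s c B k : 0 <= s -> 0 <= B -> c 0 = 0 -> hbd s c B -> nc (c k) <= B.
Proof.
move=> s0 B0 c0 hc; have [->|k0] := eqVneq k 0; first by rewrite c0 Normc.normc0.
have h := sumle_term k hc; rewrite ler_sqr ?nnegrE ?mulr_ge0 ?powR_ge0 ?nc_ge0 // in h.
apply: le_trans h; rewrite ler_peMl ?nc_ge0 //.
by apply: powR_ge1 => //; exact: ab_ge1.
Qed.

Lemma hbd_le s c B B' : 0 <= B -> B <= B' -> hbd s c B -> hbd s c B'.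
Proof.
move=> B0 BB; move=> /sumle_le; apply.
by rewrite ler_sqr ?nnegrE // (le_trans B0).
Qed.

Lemma hbdD s u v A B : 0 <= A -> 0 <= B -> hbd s u A -> hbd s v B ->
  hbd s (fun k => u k + v k) (A + B).
Proof.
move=> A0 B0 hu hv r ur; have cs := sumle_CS A0 B0 hu hv ur.
apply: (@le_trans _ _ (\sum_(k <- r) ((ab k `^ s * nc (u k)) ^+ 2
    + 2 * ((ab k `^ s * nc (u k)) * (ab k `^ s * nc (v k))) + (ab k `^ s * nc (v k)) ^+ 2))).
  apply: ler_sum => k _; set p := ab k `^ s.
  have -> : (p * nc (u k)) ^+ 2 + 2 * (p * nc (u k) * (p * nc (v k)))
    + (p * nc (v k)) ^+ 2 = (p * (nc (u k) + nc (v k))) ^+ 2 by ring.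
  rewrite ler_sqr ?nnegrE ?mulr_ge0 ?powR_ge0 ?addr_ge0 ?nc_ge0 //.
  by rewrite ler_wpM2l ?powR_ge0 // ncD.
rewrite !big_split /= -mulr_sumr; have := hu r ur; have := hv r ur; move: cs.
set x := \sum_(k <- r) _; set y := \sum_(k <- r) _; set z := \sum_(k <- r) _.
by rewrite sqrrD; lra.
Qed.

Lemma hbdN s u A : hbd s u A -> hbd s (fun k => - u k) A.
Proof. by apply: sumle_mono => k; rewrite normcN. Qed.

Lemma hbdB s u v A B : 0 <= A -> 0 <= B -> hbd s u A -> hbd s v B ->
  hbd s (fun k => u k - v k) (A + B).
Proof. by move=> A0 B0 hu /hbdN; exact: hbdD. Qed.

End Hermitian.

(** The hypotheses on the kernel and on the exponents, with
    [max (3/2 - lambda, 1/2) < s] split into its two halves. *)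
Record admissible (R : realType) (lambda : R) (S : int -> int -> int -> R[i])
    (C s Cs : R) : Prop := Admissible {
  adm_lambda : 0 < lambda;
  adm_zero : forall k m n : int, k * m * n = 0 -> S k m n = 0;
  adm_conj : forall k m n : int, S k m n = ((S (- k) (- m) (- n))^*)%C;
  adm_swap23 : forall k m n : int, S k m n = S k n m;
  adm_rot : forall k m n : int, S k m n = S m n k;
  adm_bound : forall k m n : int, k * m * n != 0 ->
    nc (S k m n) <= C / Num.min (`|k%:~R| `^ lambda)
                       (Num.min (`|m%:~R| `^ lambda) (`|n%:~R| `^ lambda));
  adm_s1 : 1 / 2 < s;
  adm_s2 : 1 / 2 < s + lambda - 1;
  adm_Cs : is_Cslambda s lambda Cs }.

Section Kernel.
Variables (R : realType) (lambda : R) (S : int -> int -> int -> R[i]) (C s Cs : R).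
Hypothesis adm : admissible lambda S C s Cs.
Let hlambda := adm_lambda adm.
Let S_i := adm_zero adm.
Let S_ii := adm_conj adm.
Let S_iii := adm_swap23 adm.
Let S_iv := adm_rot adm.
Let S_vi := adm_bound adm.
Let hs1 := adm_s1 adm.
Let hs2 := adm_s2 adm.
Let hCs := adm_Cs adm.

Implicit Types (c u v w z : int -> R[i]) (k m n : int) (N : nat).

Lemma S_swap k m n : S k m n = S m k n.
Proof. by rewrite S_iv S_iii. Qed.

Lemma S_opp k m n : S (- k) (- m) (- n) = ((S k m n)^*)%C.
Proof. by rewrite S_ii !opprK. Qed.

Lemma min_pow_ge1 k m n : k * m * n != 0 ->
  1 <= Num.min (ab k `^ lambda) (Num.min (ab m `^ lambda) (ab n `^ lambda)).
Proof.
rewrite !mulf_eq0 !negb_or => /andP[/andP[k0 m0] n0].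
by rewrite !le_min !powR_ge1 ?ab_ge1 // ltW.
Qed.

Lemma C_ge0 : 0 <= C.
Proof.
have /S_vi := isT : (1 : int) * 1 * 1 != 0.
by rewrite normr1 powR1 !minxx divr1; exact: le_trans (nc_ge0 _).
Qed.

Lemma S_le k m n : nc (S k m n) <= C.
Proof.
have [/eqP/S_i ->|h] := boolP (k * m * n == 0).
  by rewrite Normc.normc0 C_ge0.
apply: le_trans (S_vi h) _; rewrite ler_piMr ?C_ge0 // invf_le1.
  exact: min_pow_ge1.
by apply: lt_le_trans (min_pow_ge1 h); rewrite ltr01.
Qed.

(** The convolution truncated to [[-N, N]]; the coefficient of index [k] of the
    nonlinearity is obtained at [- k]. *)
Definition bq N u v k : R[i] :=
  \sum_(m <- Zr N) \sum_(n <- Zr N | k + m + n == 0) S k m n * (u m * v n).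

(** [- i k], the symbol of [- d/dx]. *)
Definition mi k : R[i] := Complex 0 (- k%:~R).

Lemma nc_mi k : nc (mi k) = ab k.
Proof. by rewrite /mi /= expr0n /= add0r sqrrN sqrtr_sqr. Qed.

Lemma bqC N u v k : bq N u v k = bq N v u k.
Proof.
rewrite /bq; under eq_bigr do rewrite big_mkcond; rewrite exchange_big /=.
apply: eq_bigr => m _; rewrite [RHS]big_mkcond /=; apply: eq_bigr => n _.
by rewrite addrAC S_iii (mulrC (v m)).
Qed.

Lemma bqDl N u v w k : bq N (fun j => u j + v j) w k = bq N u w k + bq N v w k.
Proof.
rewrite /bq -big_split; apply: eq_bigr => m _; rewrite -big_split.
by apply: eq_bigr => n _ /=; rewrite mulrDl mulrDr.
Qed.

Lemma bqNl N u w k : bq N (fun j => - u j) w k = - bq N u w k.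
Proof.
rewrite /bq -sumrN; apply: eq_bigr => m _; rewrite -sumrN.
by apply: eq_bigr => n _; rewrite mulNr mulrN.
Qed.

Lemma bq_diff N u v k :
  bq N u u k - bq N v v k = bq N (fun j => u j - v j) (fun j => u j + v j) k.
Proof.
rewrite bqDl bqNl !(bqC N _ (fun j => u j + v j)) !bqDl (bqC N v u).
by ring.
Qed.

Lemma bq_hermitian N u v k : hermitian u -> hermitian v ->
  bq N u v (- k) = ((bq N u v k)^*)%C.
Proof.
move=> [_ hu] [_ hv]; rewrite /bq -sum_Zr_opp rmorph_sum /=; apply: eq_bigr => m _.
rewrite big_mkcond -sum_Zr_opp rmorph_sum /= [RHS]big_mkcond /=; apply: eq_bigr => n _.
by rewrite -!opprD oppr_eq0 hu hv S_opp !rmorphM.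
Qed.

Lemma nc_bq_le N u v k B : 0 <= B -> (forall n, nc (v n) <= B) ->
  nc (bq N u v k) <= C * B * \sum_(m <- Zr N) nc (u m).
Proof.
move=> B0 hv; apply: le_trans (nc_sum _ _ _) _; rewrite mulr_sumr.
apply: ler_sum => m _; have E n : (k + m + n == 0) = (k + n + m == 0) by rewrite addrAC.
rewrite (eq_bigl _ _ E) triad_collapse; case: ifP => _; last first.
  by rewrite Normc.normc0 !mulr_ge0 ?nc_ge0 ?C_ge0.
rewrite !Normc.normcM (mulrC (nc (u m))) mulrA ler_wpM2r ?nc_ge0 //.
by apply: ler_pM => //; rewrite ?nc_ge0 // S_le.
Qed.

(** With [energy_deriv], this makes the derivative of a weighted sum of squares a sum
    over triads, which can be symmetrized. *)
Lemma energy_T3 N (om : int -> R) u v w : hermitian u -> hermitian v -> hermitian w ->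
  \sum_(k <- Zr N) om k * (2 * Re ((w k)^*%C * (mi k * bq N u v (- k)))) =
  T3 N (fun k m n => - (2 * (om k * k%:~R)) * Im (S k m n * (w k * u m * v n))).
Proof.
move=> hu hv hw; apply: eq_bigr => k _; rewrite bq_hermitian //.
have -> : Re ((w k)^*%C * (mi k * (bq N u v k)^*%C)) =
    - (k%:~R * Im (w k * bq N u v k)).
  by rewrite !ReImE /=; ring.
rewrite /bq mulr_sumr Im_sum !mulr_sumr -sumrN !mulr_sumr; apply: eq_bigr => m _.
rewrite mulr_sumr Im_sum !mulr_sumr -sumrN !mulr_sumr; apply: eq_bigr => n _.
have -> : w k * (S k m n * (u m * v n)) = S k m n * (w k * u m * v n) by ring.
by ring.
Qed.

Lemma P_sym12 u v k m n : Im (S k m n * (u k * u m * v n)) = Im (S m k n * (u m * u k * v n)).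
Proof. by rewrite S_swap (mulrC (u k)). Qed.

(** The momentum is conserved because [k + m + n = 0] on a triad. *)
Lemma momentum_T3 N u : hermitian u ->
  \sum_(k <- Zr N) 2 * Re ((u k)^*%C * (mi k * bq N u u (- k))) = 0.
Proof.
move=> hu.
transitivity (\sum_(k <- Zr N) 1 * (2 * Re ((u k)^*%C * (mi k * bq N u u (- k))))).
  by apply: eq_bigr => k _; rewrite mul1r.
rewrite energy_T3 // T3_sym3; last 2 first.
- by move=> k m n; exact: P_sym12.
- by move=> k m n; rewrite S_iii -!mulrA (mulrC (u m)).
rewrite /T3 big1 // => k _; rewrite big1 // => m _; rewrite big1 // => n /eqP h.
have hR : k%:~R + m%:~R + n%:~R = 0 :> R by rewrite -!intrD h.
have -> : - (2 * (1 * k%:~R)) + - (2 * (1 * m%:~R)) + - (2 * (1 * n%:~R)) =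
  - 2 * (k%:~R + m%:~R + n%:~R) :> R by ring.
by rewrite hR mulr0 !mul0r.
Qed.

Lemma Cs_ge0 : 0 <= Cs.
Proof.
have := hCs (oner_neq0 _) (oner_neq0 _) (_ : - (2 : R) != 0) (_ : 1 + 1 + - (2 : R) = 0).
rewrite oppr_eq0 pnatr_eq0 => /(_ isT); rewrite addrN => /(_ erefl).
set X := _ / _; set Y := (X in _ * X) => h.
have Y0 : 0 < Y by rewrite !addr_gt0 // !mulr_gt0 // powR_gt0 // normr_gt0 ?oner_eq0 ?oppr_eq0 ?pnatr_eq0.
have X0 : 0 <= X by rewrite divr_ge0 // !le_min !powR_ge0.
by rewrite -(pmulr_lge0 _ Y0) (le_trans X0).
Qed.

Lemma weight_l1 u A : 0 <= A -> u 0 = 0 -> hbd s u A ->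
  sumle (fun k => ab k `^ (1 - lambda) * nc (u k)) (Mconst (s + lambda - 1) * A).
Proof.
move=> A0 u0 hu; apply: sumle_mono (sobolev hs2 A0 hu) => k.
case: eqP => [->|/eqP k0]; first by rewrite u0 Normc.normc0 mulr0 mul0r.
rewrite mulrA powR_mul ?ab_gt0 //.
by have -> : - (s + lambda - 1) + s = 1 - lambda by ring.
Qed.

(** After symmetrization over the triad, the defining inequality of
    [C_{s,lambda}] leaves two factors in the Sobolev norm and one in a weighted
    l^1 norm. *)
Lemma sobolev_T3 N u A : 0 <= A -> hermitian u -> hbd s u A ->
  `|\sum_(k <- Zr N) ab k `^ (2 * s) * (2 * Re ((u k)^*%C * (mi k * bq N u u (- k))))|
    <= 2 * (C * Cs * Mconst (s + lambda - 1)) * A ^+ 3.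
Proof.
move=> A0 hu hA; have u0 := hu.1.
rewrite energy_T3 // T3_sym3; last 2 first.
- by move=> k m n; exact: P_sym12.
- by move=> k m n; rewrite S_iii -!mulrA (mulrC (u m)).
pose a k := ab k `^ s * nc (u k); pose g k := ab k `^ (1 - lambda) * nc (u k).
have a0 k : 0 <= a k by rewrite mulr_ge0 ?powR_ge0 ?nc_ge0.
have g0 k : 0 <= g k by rewrite mulr_ge0 ?powR_ge0 ?nc_ge0.
have CC0 : 0 <= 2 / 3 * (C * Cs) by rewrite mulr_ge0 ?divr_ge0 // mulr_ge0 ?C_ge0 ?Cs_ge0.
apply: le_trans (norm_T3 _ _) _.
apply: (@le_trans _ _ (T3 N (fun k m n => 2 / 3 * (C * Cs) *
    (a k * a m * g n + a n * a k * g m + a m * a n * g k)))).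
  apply: ler_T3 => k m n kmn.
  have [h|h] := boolP (k * m * n == 0).
    rewrite (S_i (eqP h)) mul0r mulr0 normr0.
    by rewrite mulr_ge0 ?CC0 // !addr_ge0 //; apply: mulr_ge0 => //; apply: mulr_ge0.
  have := h; rewrite !mulf_eq0 !negb_or => /andP[/andP[k0 m0] n0].
  have kmnR : k%:~R + m%:~R + n%:~R = 0 :> R by rewrite -!intrD kmn.
  have := hCs (_ : k%:~R != 0) (_ : m%:~R != 0) (_ : n%:~R != 0) kmnR.
  rewrite !intr_eq0 => /(_ k0 m0 n0).
  set X := `|_ + _ + _|; set Y := Num.min _ _; set Z := (X in Cs * X) => hX.
  have Y0 : 0 < Y by apply: lt_le_trans (min_pow_ge1 h); exact: ltr01.
  have -> : - (2 * (ab k `^ (2 * s) * k%:~R)) + - (2 * (ab m `^ (2 * s) * m%:~R)) +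
      - (2 * (ab n `^ (2 * s) * n%:~R)) = - 2 * (k%:~R * ab k `^ (2 * s) +
      m%:~R * ab m `^ (2 * s) + n%:~R * ab n `^ (2 * s)) by ring.
  rewrite !normrM normrN -/X.
  have -> : `|2| = 2 :> R by rewrite ger0_norm.
  have -> : `|3^-1| = 3^-1 :> R by rewrite ger0_norm // invr_ge0.
  have hI : `|Im (S k m n * (u k * u m * u n))| <= C / Y * (nc (u k) * nc (u m) * nc (u n)).
    apply: le_trans (Im_le_nc _) _; rewrite !Normc.normcM.
    by rewrite ler_wpM2r ?mulr_ge0 ?nc_ge0 // S_vi.
  apply: le_trans (ler_wpM2l _ hI) _; first by rewrite !mulr_ge0 // normr_ge0.
  set U := nc (u k) * _ * _.
  have U0 : 0 <= U by rewrite !mulr_ge0 ?nc_ge0.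
  have -> : 2 * X / 3 * (C / Y * U) = 2 / 3 * C * U * (X / Y) by field; rewrite gt_eqF.
  have -> : 2 / 3 * (C * Cs) * (a k * a m * g n + a n * a k * g m + a m * a n * g k) =
    2 / 3 * C * U * (Cs * Z) by rewrite /a /g /U /Z; ring.
  by rewrite ler_wpM2l // mulr_ge0 // mulr_ge0 // C_ge0.
rewrite T3Z.
have hg := weight_l1 A0 u0 hA.
have hT := T3_CS N A0 A0 a0 a0 g0 hA hA hg.
rewrite !T3D.
have -> : T3 N (fun k m n => a n * a k * g m) = T3 N (fun k m n => a k * a m * g n).
  by rewrite T3_swap23; apply: eq_T3 => k m n _; rewrite (mulrC (a m)).
have -> : T3 N (fun k m n => a m * a n * g k) = T3 N (fun k m n => a k * a m * g n).
  rewrite T3_swap12 T3_swap23; apply: eq_T3 => k m n _; done.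
set T := T3 _ _ in hT *.
have CC : 0 <= C * Cs by rewrite mulr_ge0 ?C_ge0 ?Cs_ge0.
have -> : 2 / 3 * (C * Cs) * (T + T + T) = 2 * (C * Cs) * T by field.
have -> : 2 * (C * Cs * Mconst (s + lambda - 1)) * A ^+ 3 =
  2 * (C * Cs) * (A * A * (Mconst (s + lambda - 1) * A)) by ring.
by rewrite ler_wpM2l // mulr_ge0.
Qed.

(** The terms whose squares add up to the [H^(-1/2)] norm. *)
Definition hmhalf w j : R := ab j `^ (- (1 / 2)) * nc (w j).

(** The pointwise estimate behind stability in [H^(-1/2)]: the signs of [k] and [m]
    cancel unless they agree, and then [n] is the largest entry of the triad, so
    that all the smoothness can be charged to [z]. *)
Lemma stability_triad k m n (w z : int -> R[i]) : k + m + n = 0 -> hermitian w ->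
  `|Num.sg k%:~R + Num.sg m%:~R| * nc (S k m n * (w k * w m * z n)) <=
  2 * C * (ab k `^ (1 - lambda - s) + ab m `^ (1 - lambda - s)) *
    (hmhalf w k * hmhalf w m * (ab n `^ s * nc (z n))).
Proof.
move=> kmn hw; pose x := hmhalf w; rewrite -/x.
wlog km : k m kmn / ab k <= ab m :> R.
  move=> H; have [/H|/ltW /H] := leP (ab k : R) (ab m); first exact.
  rewrite (addrC m) => /(_ kmn); rewrite S_swap (mulrC (w m)) (addrC (Num.sg _)).
  by rewrite (addrC (_ `^ _)) (mulrC (x m)).
set T := (X in _ <= X).
have T0 : 0 <= T.
  by rewrite !mulr_ge0 ?addr_ge0 ?powR_ge0 ?nc_ge0 ?C_ge0.
have [h|h] := boolP (k * m * n == 0).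
  by rewrite (S_i (eqP h)) mul0r Normc.normc0 mulr0.
have := h; rewrite !mulf_eq0 !negb_or => /andP[/andP[k0 m0] n0].
have kmnR : k%:~R + m%:~R + n%:~R = 0 :> R by rewrite -!intrD kmn.
have nE : n%:~R = - (k%:~R + m%:~R) :> R by lra.
have [sg0|same] := eqVneq (Num.sg (k%:~R : R) + Num.sg m%:~R) 0.
  by rewrite sg0 normr0 mul0r.
have abn : ab n = ab k + ab m :> R.
  have /orP[k1|k1] : (0 < (k%:~R : R)) || ((k%:~R : R) < 0) by rewrite -neq_lt eq_sym intr_eq0.
    have /orP[m1|m1] : (0 < (m%:~R : R)) || ((m%:~R : R) < 0) by rewrite -neq_lt eq_sym intr_eq0.
      by rewrite nE normrN !gtr0_norm // addr_gt0.
    by move: same; rewrite gtr0_sg // ltr0_sg // subrr eqxx.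
  have /orP[m1|m1] : (0 < (m%:~R : R)) || ((m%:~R : R) < 0) by rewrite -neq_lt eq_sym intr_eq0.
    by move: same; rewrite ltr0_sg // gtr0_sg // addNr eqxx.
  by rewrite nE normrN !ltr0_norm ?opprD //; lra.
have sg2 : `|Num.sg (k%:~R : R) + Num.sg m%:~R| <= 2.
  by apply: le_trans (ler_normD _ _) _; rewrite !normr_sg !intr_eq0 k0 m0.
have a1 : 1 <= ab k :> R by exact: ab_ge1.
have hS : nc (S k m n) <= C * ab k `^ (- lambda).
  have l0 := ltW hlambda.
  have := S_vi h; rewrite powRN (min_idPl _) // le_min !ler_powR_base //.
  by rewrite abn lerDl.
pose a : R := ab k; pose b : R := ab m; pose d : R := ab n.
have a0 : 0 < a by exact: lt_le_trans a1.
have b0 : 0 < b by exact: lt_le_trans km.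
have d0 : 0 < d by rewrite /d abn addr_gt0.
have half (j : int) : j != 0 -> nc (w j) = ab j `^ (1 / 2) * x j.
  by move=> j0; rewrite /x /hmhalf mulrA powR_mul ?ab_gt0 // subrr powRr0 mul1r.
have zE : nc (z n) = d `^ (- s) * (ab n `^ s * nc (z n)).
  by rewrite mulrA powR_mul // addNr powRr0 mul1r.
rewrite !Normc.normcM (half k) // (half m) // zE.
have key : a `^ (- lambda) * (a `^ (1 / 2) * b `^ (1 / 2) * d `^ (- s)) <= a `^ (1 - lambda - s).
  have -> : a `^ (1 - lambda - s) = a `^ (- lambda) * (a `^ (1 / 2) * a `^ (1 / 2 - s)).
    by rewrite !powR_mul //; congr (_ `^ _); field.
  rewrite -mulrA ler_wpM2l ?powR_ge0 // ler_wpM2l ?powR_ge0 //.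
  apply: (@le_trans _ _ (d `^ (1 / 2) * d `^ (- s))).
    by rewrite ler_wpM2r ?powR_ge0 // ler_powR_base // ?(ltW b0) // /d abn lerDr ltW.
  by rewrite powR_mul // ler_powR_baseN //; [have := hs1; lra|rewrite /d abn lerDl ltW].
set X := x k; set Y := x m; set Z := ab n `^ s * nc (z n).
have X0 : 0 <= X by rewrite mulr_ge0 ?powR_ge0 ?nc_ge0.
have Y0 : 0 <= Y by rewrite mulr_ge0 ?powR_ge0 ?nc_ge0.
have Z0 : 0 <= Z by rewrite mulr_ge0 ?powR_ge0 ?nc_ge0.
have XYZ : 0 <= X * Y * Z by apply: mulr_ge0 => //; apply: mulr_ge0.
have C0 := C_ge0.
apply: (@le_trans _ _ (2 * (C * a `^ (- lambda) *
    (a `^ (1 / 2) * X * (b `^ (1 / 2) * Y) * (d `^ (- s) * Z))))).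
  have P0 : 0 <= a `^ (1 / 2) * X * (b `^ (1 / 2) * Y) * (d `^ (- s) * Z).
    by repeat first [exact: X0|exact: Y0|exact: Z0|exact: powR_ge0|apply: mulr_ge0].
  apply: ler_pM => //; first by apply: mulr_ge0 => //; exact: nc_ge0.
  exact: ler_wpM2r.
rewrite /T -/X -/Y -/Z.
apply: (@le_trans _ _ (2 * C * (X * Y * Z) * a `^ (1 - lambda - s))).
  rewrite [leLHS](_ : _ = 2 * C * (X * Y * Z) * (a `^ (- lambda) *
    (a `^ (1 / 2) * b `^ (1 / 2) * d `^ (- s)))); last by ring.
  by apply: ler_wpM2l key; apply: mulr_ge0 => //; apply: mulr_ge0.
rewrite [leRHS](_ : _ = 2 * C * (X * Y * Z) * (a `^ (1 - lambda - s) + b `^ (1 - lambda - s))).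
  apply: ler_wpM2l; last by rewrite lerDl powR_ge0.
  by apply: mulr_ge0 => //; apply: mulr_ge0.
by rewrite /a /b; ring.
Qed.

Lemma sumle_restrict N (x : int -> R) : (forall k, 0 <= x k) ->
  sumle (fun k => if k \in Zr N then x k else 0) (\sum_(k <- Zr N) x k).
Proof.
move=> x0; apply: sumle_win => [k|M]; first by case: ifP.
rewrite -big_mkcond -big_filter; apply: ler_sum_sub => //.
  by rewrite filter_uniq ?uniq_Zr.
by move=> k; rewrite mem_filter => /andP[].
Qed.

Lemma eq_T3_win N (G H : int -> int -> int -> R) :
  (forall k m n, k \in Zr N -> m \in Zr N -> G k m n = H k m n) -> T3 N G = T3 N H.
Proof.
move=> GH; apply: eq_big_seq => k kN; apply: eq_big_seq => m mN.
by apply: eq_bigr => n _; exact: GH.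
Qed.

(** The weight [|k|^-1] of [H^(-1/2)] turns the factor [k] of the derivative into the
    sign of [k]; symmetrizing in the two indices carried by [w] produces the sum of
    signs of [stability_triad]. *)
Lemma stability_T3 N w z B : 0 <= B -> hermitian w -> hermitian z -> hbd s z B ->
  `|\sum_(k <- Zr N) (ab k)^-1 * (2 * Re ((w k)^*%C * (mi k * bq N w z (- k))))|
    <= 4 * C * Mconst (s + lambda - 1) * B *
       \sum_(k <- Zr N) (ab k)^-1 * nc (w k) ^+ 2.
Proof.
move=> B0 hw hz hB; set E := \sum_(k <- Zr N) (ab k)^-1 * _ ^+ 2.
have C0 := C_ge0.
rewrite energy_T3 // T3_sym2; last by move=> k m n; exact: P_sym12.
pose x := hmhalf w.
pose y j := if j \in Zr N then x j else 0.
have x0 j : 0 <= x j by rewrite mulr_ge0 ?powR_ge0 ?nc_ge0.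
have y0 j : 0 <= y j by rewrite /y; case: ifP.
pose g j := ab j `^ s * nc (z j).
have g0 j : 0 <= g j by rewrite mulr_ge0 ?powR_ge0 ?nc_ge0.
pose kap j : R := ab j `^ (1 - lambda - s).
have E0 : 0 <= E by apply: sumr_ge0 => k _; rewrite mulr_ge0 ?invr_ge0 ?sqr_ge0.
pose X := Num.sqrt E.
have X0 : 0 <= X by exact: sqrtr_ge0.
have X2 : X ^+ 2 = E by rewrite sqr_sqrtr.
have hy : sumle (fun k => y k ^+ 2) (X ^+ 2).
  rewrite X2; apply: sumle_mono (sumle_restrict N (x := fun k => (ab k)^-1 * nc (w k) ^+ 2) _).
    move=> k; rewrite /y; case: ifP => _; last by rewrite expr0n.
    rewrite /x /hmhalf exprMn powRsq // (_ : 2 * - (1 / 2) = -1); last by field.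
    by rewrite powR_inv1.
  by move=> k; rewrite mulr_ge0 ?invr_ge0 ?sqr_ge0.
have hky : sumle (fun k => kap k * y k) (Mconst (s + lambda - 1) * X).
  apply: sumle_mono (sobolev hs2 X0 hy) => k.
  case: eqP => [->|_]; last by rewrite /kap (_ : 1 - lambda - s = - (s + lambda - 1)) //; ring.
  rewrite /y; case: ifP => _; last by rewrite mulr0 ?mul0r.
  by rewrite /x /hmhalf hw.1 Normc.normc0 !mulr0 ?mul0r.
have ky0 k : 0 <= kap k * y k by rewrite mulr_ge0 ?powR_ge0.
apply: le_trans (norm_T3 _ _) _.
apply: (@le_trans _ _ (T3 N (fun k m n =>
    2 * C * ((kap k * y k) * y m * g n + y k * (kap m * y m) * g n)))).
  rewrite [leRHS](@eq_T3_win _ _ (fun k m n =>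
      2 * C * (kap k + kap m) * (x k * x m * g n))); last first.
    by move=> k m n kN mN; rewrite /y kN mN; ring.
  apply: ler_T3 => k m n kmn; apply: le_trans _ (stability_triad _ kmn hw).
  have sgE j : (ab j)^-1 * j%:~R = Num.sg (j%:~R : R).
    have [->|j0] := eqVneq j 0; first by rewrite mulr0 sgr0.
    by rewrite {2}[j%:~R]numEsg mulrCA mulVf ?mulr1 // normr_eq0 intr_eq0.
  rewrite !sgE normrM; apply: ler_pM => //; last exact: Im_le_nc.
  rewrite (_ : _ / 2 = - (Num.sg (k%:~R : R) + Num.sg m%:~R)) ?normrN //; by field.
rewrite T3Z T3D.
have -> : T3 N (fun k m n => y k * (kap m * y m) * g n) =
          T3 N (fun k m n => (kap k * y k) * y m * g n).
  by rewrite T3_swap12; apply: eq_T3 => k m n _; rewrite (mulrC (y m)).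
have hT : T3 N (fun k m n => (kap k * y k) * y m * g n) <=
    X * B * (Mconst (s + lambda - 1) * X).
  rewrite T3_swap12 T3_swap23.
  rewrite (@eq_T3 _ N _ (fun k m n => y k * g m * (kap n * y n))); last first.
    by move=> k m n _; ring.
  exact: T3_CS.
set T := T3 _ _ in hT *.
rewrite -X2 -[T + T]mulr2n -mulr_natl.
rewrite [leLHS](_ : _ = 4 * C * T); last by ring.
rewrite [leRHS](_ : _ = 4 * C * (X * B * (Mconst (s + lambda - 1) * X))); last by ring.
by rewrite ler_wpM2l // mulr_ge0.
Qed.

End Kernel.

(** * One-variable calculus *)

Section Calculus.
Variable R : realType.
Implicit Types (f g E dE k dk df : R -> R) (t x y d c mu T L e K F : R).

Lemma is_deriveE t f d : is_derive t 1 f d <->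
  forall e, 0 < e -> exists2 del, 0 < del &
    forall h, `|h| < del -> `|f (t + h) - f t - h * d| <= e * `|h|.
Proof.
split=> [[/cvg_ex[l hl] dE] e e0|H].
  have ld : l = d.
    by rewrite -dE /derive; apply/esym; apply/cvg_lim => //.
  move/cvgrPdist_le: hl => /(_ e e0); rewrite near_withinE.
  move=> /nbhs_ballP[del /= del0 hdel]; exists del => // h hh.
  have [->|h0] := eqVneq h 0; first by rewrite addr0 mul0r subr0 subrr normr0 mulr0.
  have := hdel h; rewrite -ball_normE /ball_ /= sub0r normrN => /(_ hh h0).
  rewrite ld /GRing.scale /= mulr1 (addrC h).
  have -> : d - h^-1 * (f (t + h) - f t) = - (h^-1 * (f (t + h) - f t - h * d)).
    by field.
  by rewrite normrN normrM normfV mulrC ler_pdivrMr ?normr_gt0.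
have L : h^-1 *: ((f \o shift t) (h *: (1 : R)) - f t) @[h --> 0^'] --> d.
  apply/cvgrPdist_le => e e0; rewrite near_withinE.
  have [del del0 hdel] := H e e0; apply/nbhs_ballP; exists del => // h.
  rewrite -ball_normE /ball_ /= sub0r normrN => hh h0.
  have := hdel h hh; rewrite /GRing.scale /= mulr1 (addrC h) => H1.
  have -> : d - h^-1 * (f (t + h) - f t) = - (h^-1 * (f (t + h) - f t - h * d)).
    by field.
  by rewrite normrN normrM normfV mulrC ler_pdivrMr ?normr_gt0.
by split; [apply/cvg_ex; exists d|apply/cvg_lim].
Qed.

Lemma drv_cst t x : is_derive t 1 (fun=> x) (0 : R).
Proof. exact: is_derive_cst. Qed.

Lemma drv_id t : is_derive t 1 (fun x : R => x) (1 : R).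
Proof. exact: is_derive_id. Qed.

Lemma drv_add t f g a b : is_derive t 1 f a -> is_derive t 1 g b ->
  is_derive t 1 (fun x => f x + g x) (a + b).
Proof. exact: is_deriveD. Qed.

Lemma drv_opp t f a : is_derive t 1 f a -> is_derive t 1 (fun x => - f x) (- a).
Proof. exact: is_deriveN. Qed.

Lemma drv_sub t f g a b : is_derive t 1 f a -> is_derive t 1 g b ->
  is_derive t 1 (fun x => f x - g x) (a - b).
Proof. by move=> fa /drv_opp; exact: drv_add. Qed.

Lemma drv_mul t f g a b : is_derive t 1 f a -> is_derive t 1 g b ->
  is_derive t 1 (fun x => f x * g x) (a * g t + f t * b).
Proof.
move=> fa gb; have := is_deriveM fa gb; rewrite /GRing.scale /= => h.
by apply: is_derive_eq h _; ring.
Qed.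

Lemma drv_scale t x f a : is_derive t 1 f a -> is_derive t 1 (fun y => x * f y) (x * a).
Proof.
by move=> fa; apply: is_derive_eq (drv_mul (drv_cst t x) fa) _; rewrite mul0r add0r.
Qed.

Lemma drv_comp t f g a b : is_derive (g t) 1 f a -> is_derive t 1 g b ->
  is_derive t 1 (fun x => f (g x)) (a * b).
Proof. exact: is_derive1_comp. Qed.

Lemma drv_sum (T : eqType) (r : seq T) t (F : T -> R -> R) (dF : T -> R) :
  (forall i, i \in r -> is_derive t 1 (F i) (dF i)) ->
  is_derive t 1 (fun x => \sum_(i <- r) F i x) (\sum_(i <- r) dF i).
Proof.
elim: r => [|i r IH] H.
  rewrite big_nil; under eq_fun do rewrite big_nil; exact: drv_cst.
rewrite big_cons; under eq_fun do rewrite big_cons.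
apply: drv_add; first by apply: H; rewrite inE eqxx.
by apply: IH => k kr; apply: H; rewrite inE kr orbT.
Qed.

Lemma drv_cont t f a : is_derive t 1 f a -> {for t, continuous f}.
Proof. by move=> [h _]; apply: differentiable_continuous; apply/derivable1_diffP. Qed.

Lemma drv_shift t t0 f a : is_derive (t + t0) 1 f a -> is_derive t 1 (fun x => f (x + t0)) a.
Proof.
move=> h; apply: is_derive_eq (drv_comp (g := fun x => x + t0) h (drv_add (drv_id t) (drv_cst t t0))) _.
by rewrite addr0 mulr1.
Qed.

Lemma drv_refl t f a : is_derive (- t) 1 f a -> is_derive t 1 (fun x => f (- x)) (- a).
Proof.
move=> h; apply: is_derive_eq (drv_comp (g := -%R) h (drv_opp (drv_id t))) _.
by rewrite mulrN1.
Qed.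

Lemma mean_value f df x y :
  (forall z, Num.min x y <= z <= Num.max x y -> is_derive z 1 f (df z)) ->
  exists2 z, Num.min x y <= z <= Num.max x y & f y - f x = df z * (y - x).
Proof.
have aux (a b : R) : a <= b -> (forall z, a <= z <= b -> is_derive z 1 f (df z)) ->
    exists2 z, a <= z <= b & f b - f a = df z * (b - a).
  move=> ab H; have [| |z] := @MVT_segment _ f df a b ab; last by rewrite in_itv; exists z.
    by move=> z; rewrite in_itv /= => /andP[az zb]; apply: H; rewrite !ltW.
  by apply: derivable_within_continuous => z; rewrite in_itv /= => /H[].
have [xy H|yx H] := leP x y; first exact: aux.
have [z hz E] := aux y x (ltW yx) H; exists z => //.
by rewrite -[LHS]opprB E -mulrN opprB.
Qed.

Lemma ball_between (T x y z : R) : `|x| <= T -> `|y| <= T ->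
  Num.min x y <= z <= Num.max x y -> `|z| <= T.
Proof.
rewrite !ler_norml => /andP[? ?] /andP[? ?]; rewrite ge_min le_max.
by move=> /andP[/orP[] ? /orP[] ?]; apply/andP; split; lra.
Qed.

Lemma nonincreasing_deriv f df T : 0 <= T ->
  (forall t, 0 <= t <= T -> is_derive t 1 f (df t)) ->
  (forall t, 0 <= t <= T -> df t <= 0) -> f T <= f 0.
Proof.
move=> T0 H Hd; have [z|z] := @mean_value f df 0 T.
  by rewrite (min_idPl T0) (max_idPr T0); exact: H.
rewrite (min_idPl T0) (max_idPr T0) => /Hd dz E.
by rewrite -subr_le0 E subr0 mulr_le0_ge0.
Qed.

Lemma growth_bound (h dh : R -> R) c mu T : 0 < mu -> 0 <= c -> h 0 = 0 ->
  (forall t, `|t| <= T -> is_derive t 1 h (dh t)) ->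
  (forall t, `|t| <= T -> `|dh t| <= c * expR (mu * `|t|)) ->
  forall t, `|t| <= T -> `|h t| <= c / mu * expR (mu * `|t|).
Proof.
move=> mu0 c0.
(* the one-sided bound on [0, T], applied to h, -h and their reflections *)
have aux k dk : k 0 = 0 -> (forall t, 0 <= t <= T -> is_derive t 1 k (dk t)) ->
    (forall t, 0 <= t <= T -> dk t <= c * expR (mu * t)) ->
    forall t, 0 <= t <= T -> k t <= c / mu * expR (mu * t).
  move=> k0 H Hd t /andP[t0 tT].
  have := @nonincreasing_deriv (fun t => k t - c / mu * expR (mu * t))
    (fun t => dk t - c * expR (mu * t)) t t0.
  rewrite k0 mulr0 expR0 => hh.
  have {}hh : k t - c / mu * expR (mu * t) <= 0 - c / mu * 1.
    apply: hh => x /andP[x0 xt]; have xT : 0 <= x <= T by rewrite x0 (le_trans xt).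
      apply: drv_sub; first exact: H.
      have := drv_scale (c / mu) (drv_comp (is_derive_expR _) (drv_scale mu (drv_id x))).
      by move=> hd; apply: is_derive_eq hd _; field; rewrite gt_eqF.
    by rewrite subr_le0; exact: Hd.
  have : 0 <= c / mu by rewrite divr_ge0 // ltW.
  by lra.
move=> h0 H Hd t tT.
have [t0|t0] := leP 0 t.
  have Hx x : 0 <= x <= T -> `|x| <= T by case/andP => x0 xT; rewrite ger0_norm.
  have t0T : 0 <= t <= T by rewrite t0 -(ger0_norm t0).
  rewrite (ger0_norm t0) ler_norml lerNl; apply/andP; split.
    apply: (aux (fun x => - h x) (fun x => - dh x)) => //; first by rewrite h0 oppr0.
      by move=> x /Hx xT; apply: drv_opp; exact: H.
    move=> x /[dup] /andP[x0 _] /Hx /Hd; rewrite (ger0_norm x0); apply: le_trans.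
    by rewrite -normrN ler_norm.
  apply: (aux h dh) => //; first by move=> x /Hx; exact: H.
  move=> x /[dup] /andP[x0 _] /Hx /Hd; rewrite (ger0_norm x0); apply: le_trans.
  by rewrite ler_norm.
have Hx x : 0 <= x <= T -> `|- x| <= T by case/andP => x0 xT; rewrite normrN ger0_norm.
have t0T : 0 <= - t <= T by rewrite oppr_ge0 (ltW t0) -(ltr0_norm t0).
have -> : h t = h (- (- t)) by rewrite opprK.
rewrite (ltr0_norm t0) ler_norml lerNl; apply/andP; split.
  apply: (aux (fun x => - h (- x)) (fun x => dh (- x))) => //; first by rewrite oppr0 h0 oppr0.
    move=> x /Hx xT; have := drv_opp (drv_refl (H _ xT)); by rewrite opprK.
  move=> x /[dup] /andP[x0 _] /Hx /Hd; rewrite normrN (ger0_norm x0); apply: le_trans.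
  by rewrite ler_norm.
apply: (aux (fun x => h (- x)) (fun x => - dh (- x))) => //; first by rewrite oppr0 h0.
  by move=> x /Hx xT; apply: drv_refl; exact: H.
move=> x /[dup] /andP[x0 _] /Hx /Hd; rewrite normrN (ger0_norm x0); apply: le_trans.
by rewrite -normrN ler_norm.
Qed.

(** [(E + e / L) exp (- L t)] does not increase for [0 <= t]; negative times follow
    by reflection. *)
Lemma gronwall E dE L e T : 0 < L -> 0 <= e -> E 0 = 0 -> 
  (forall t, `|t| <= T -> is_derive t 1 E (dE t)) ->
  (forall t, `|t| <= T -> `|dE t| <= L * E t + e) ->
  forall t, `|t| <= T -> E t <= e / L * expR (L * `|t|).
Proof.
move=> L0 e0.
have aux k dk : k 0 = 0 -> (forall t, 0 <= t <= T -> is_derive t 1 k (dk t)) ->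
    (forall t, 0 <= t <= T -> dk t <= L * k t + e) ->
    forall t, 0 <= t <= T -> k t <= e / L * expR (L * t).
  move=> k0 H Hd t /andP[t0 tT].
  have := @nonincreasing_deriv (fun t => (k t + e / L) * expR (- L * t))
    (fun t => (dk t - (L * k t + e)) * expR (- L * t)) t t0.
  rewrite k0 mulr0 expR0 mulr1 add0r => h.
  have {}h : (k t + e / L) * expR (- L * t) <= e / L.
    apply: h => x /andP[x0 xt]; have xT : 0 <= x <= T by rewrite x0 (le_trans xt).
      have := drv_mul (drv_add (H x xT) (drv_cst x (e / L)))
        (drv_comp (is_derive_expR _) (drv_scale (- L) (drv_id x))).
      by move=> hd; apply: is_derive_eq hd _; field; rewrite gt_eqF.
    by rewrite mulr_le0_ge0 ?expR_ge0 // subr_le0; exact: Hd.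
  have : k t + e / L <= e / L * expR (L * t).
    by move: h; rewrite mulNr expRN ler_pdivrMr // expR_gt0.
  have : 0 <= e / L by rewrite divr_ge0 // ltW.
  by lra.
move=> h0 H Hd t tT.
have [t0|t0] := leP 0 t.
  have Hx x : 0 <= x <= T -> `|x| <= T by case/andP => x0 xT; rewrite ger0_norm.
  have t0T : 0 <= t <= T by rewrite t0 -(ger0_norm t0).
  rewrite (ger0_norm t0); apply: (aux E dE) => //; first by move=> x /Hx; exact: H.
  by move=> x /Hx /Hd; apply: le_trans; rewrite ler_norm.
have Hx x : 0 <= x <= T -> `|- x| <= T by case/andP => x0 xT; rewrite normrN ger0_norm.
have t0T : 0 <= - t <= T by rewrite oppr_ge0 (ltW t0) -(ltr0_norm t0).
have -> : E t = E (- (- t)) by rewrite opprK.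
rewrite (ltr0_norm t0).
apply: (aux (fun x => E (- x)) (fun x => - dE (- x))) => //; first by rewrite oppr0 h0.
  by move=> x /Hx xT; apply: drv_refl; exact: H.
by move=> x /Hx /Hd; apply: le_trans; rewrite -normrN ler_norm.
Qed.

(** Comparison with the solution of [y' = K y^2] for [y = sqrt E]; the positive
    shift of [E] keeps the square root differentiable where [E] vanishes. *)
Lemma riccati E dE K F T : 0 <= K -> 0 < F -> (forall t, 0 <= E t) -> E 0 < F ^+ 2 ->
  (forall t, `|t| <= T -> is_derive t 1 E (dE t)) ->
  (forall t, `|t| <= T -> `|dE t| <= 2 * K * Num.sqrt (E t) ^+ 3) ->
  forall t, `|t| <= T -> K * F * `|t| < 1 -> Num.sqrt (E t) <= F / (1 - K * F * `|t|).
Proof.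
move=> K0 F0.
have aux k dk : (forall t, 0 <= k t) -> k 0 < F ^+ 2 ->
    (forall t, 0 <= t <= T -> is_derive t 1 k (dk t)) ->
    (forall t, 0 <= t <= T -> dk t <= 2 * K * Num.sqrt (k t) ^+ 3) ->
    forall t, 0 <= t <= T -> K * F * t < 1 -> Num.sqrt (k t) <= F / (1 - K * F * t).
  move=> k0 kF H Hd t /andP[t0 tT] KF; pose del := F ^+ 2 - k 0.
  have del0 : 0 < del by rewrite subr_gt0.
  have kd x : 0 < k x + del by rewrite ltr_wpDl.
  pose y x := Num.sqrt (k x + del).
  have y0 x : 0 < y x by rewrite sqrtr_gt0.
  have := @nonincreasing_deriv (fun x => - (y x)^-1 - K * x)
    (fun x => (y x) ^- 2 * ((2 * y x)^-1 * dk x) - K) t t0.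
  have -> : y 0 = F by rewrite /y /del subrKC sqrtr_sqr gtr0_norm.
  rewrite mulr0 subr0.
  have dy x : 0 <= x <= t -> is_derive x 1 (fun x => - (y x)^-1 - K * x)
      ((y x) ^- 2 * ((2 * y x)^-1 * dk x) - K).
    case/andP => x0 xt; have xT : 0 <= x <= T by rewrite x0 (le_trans xt).
    have h1 : is_derive x 1 y ((2 * y x)^-1 * (dk x + 0)).
      exact: (@drv_comp x Num.sqrt (fun x => k x + del)) (is_derive1_sqrt (kd x)) (drv_add (H x xT) (drv_cst x del)).
    have h2 := @is_deriveV _ y x _ 1 (lt0r_neq0 (y0 x)) h1.
    apply: is_derive_eq (drv_sub (drv_opp h2) (drv_scale K (drv_id x))) _.
    by rewrite /GRing.scale /= addr0 mulr1 mulNr opprK.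
  move=> /(_ dy) h.
  have {}h : - (y t)^-1 - K * t <= - F^-1.
    apply: h => x /andP[x0 xt]; have xT : 0 <= x <= T by rewrite x0 (le_trans xt).
    have hk : dk x <= 2 * K * y x ^+ 3.
      apply: le_trans (Hd x xT) _; rewrite ler_wpM2l ?mulr_ge0 //.
      apply: lerXn2r; rewrite ?nnegrE ?sqrtr_ge0 //.
      by rewrite ler_wsqrtr // lerDl ltW.
    rewrite subr_le0 mulrA -[_ * dk x]mulrC.
    have -> : (y x) ^- 2 * (2 * y x)^-1 = (2 * y x ^+ 3)^-1.
      by field; rewrite gt_eqF.
    by rewrite ler_pdivrMr ?mulr_gt0 ?exprn_gt0 // mulrCA mulrA.
  have KF' : 0 < 1 - K * F * t by rewrite subr_gt0.
  apply: (@le_trans _ _ (y t)).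
    by rewrite ler_wsqrtr // lerDl ltW.
  have : F^-1 - K * t <= (y t)^-1 by lra.
  have -> : F^-1 - K * t = (1 - K * F * t) / F by field; rewrite gt_eqF.
  rewrite -invf_div lef_pV2 ?posrE //; by rewrite divr_gt0.
move=> E0 EF H Hd t tT.
have [t0|t0] := leP 0 t.
  have Hx x : 0 <= x <= T -> `|x| <= T by case/andP => x0 xT; rewrite ger0_norm.
  have t0T : 0 <= t <= T by rewrite t0 -(ger0_norm t0).
  rewrite (ger0_norm t0); apply: (aux E dE) => //; first by move=> x /Hx; exact: H.
  by move=> x /Hx /Hd; apply: le_trans; rewrite ler_norm.
have Hx x : 0 <= x <= T -> `|- x| <= T by case/andP => x0 xT; rewrite normrN ger0_norm.
have t0T : 0 <= - t <= T by rewrite oppr_ge0 (ltW t0) -(ltr0_norm t0).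
have -> : E t = E (- (- t)) by rewrite opprK.
rewrite (ltr0_norm t0).
apply: (aux (fun x => E (- x)) (fun x => - dE (- x))) => //; first by rewrite oppr0.
  by move=> x /Hx xT; apply: drv_refl; exact: H.
by move=> x /Hx /Hd; apply: le_trans; rewrite -normrN ler_norm.
Qed.

(** A nested-interval form of completeness that carries the rate along. *)
Lemma rate_lim (a eps : nat -> R) :
  (forall N M, (N <= M)%N -> `|a M - a N| <= eps N) ->
  exists l, forall N, `|a N - l| <= eps N.
Proof.
move=> H; pose A := [set a N - eps N | N in [set: nat]].
have e0 N : 0 <= eps N by apply: le_trans (H N N (leqnn N)); exact: normr_ge0.
have ub M : ubound A (a M + eps M).
  move=> _ [N _ <-]; have := e0 N; have := e0 M.
  have [/H|/ltnW/H] := leqP N M; rewrite ler_norml => /andP[]; lra.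
have supA : has_sup A by split; [exists (a 0%N - eps 0%N), 0%N|exists (a 0%N + eps 0%N)].
exists (sup A) => N; rewrite ler_distlC; apply/andP; split.
  by apply: sup_upper_bound => //; exists N.
by apply: ge_sup => //; case: supA.
Qed.

End Calculus.

(** * Limits of derivatives and globally Lipschitz differential equations *)

Section Limits.
Variable R : realType.
Implicit Types (t x y : R).

(** The mean value theorem, applied to the differences [f M - f N], makes the
    difference quotients converge uniformly. *)
Lemma derive_lim (f g : nat -> R -> R) (f0 g0 : R -> R) (N0 : nat) (T : R) :
  (forall N t, (N0 <= N)%N -> `|t| < T -> is_derive t 1 (f N) (g N t)) ->
  (forall t, `|t| < T -> forall e, 0 < e ->
     exists N, forall M, (N <= M)%N -> `|f M t - f0 t| <= e) ->
  (forall e, 0 < e -> exists N, forall M, (N <= M)%N ->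
     forall t, `|t| < T -> `|g M t - g0 t| <= e) ->
  forall t, `|t| < T -> is_derive t 1 f0 (g0 t).
Proof.
move=> df cf cg t tT; apply/is_deriveE => e e0.
have e4 : 0 < e / 4 by rewrite divr_gt0.
have [N1 hN1] := cg _ e4.
pose N := maxn N0 N1; have NN0 : (N0 <= N)%N by exact: leq_maxl.
have hN M : (N <= M)%N -> forall t, `|t| < T -> `|g M t - g0 t| <= e / 4.
  by move=> NM; apply: hN1; exact: leq_trans (leq_maxr _ _) NM.
have [del del0 hdel] := (is_deriveE _ _ _).1 (df N t NN0 tT) _ e4.
have Tt : 0 < T - `|t| by rewrite subr_gt0.
exists (Num.min del (T - `|t|)); first by rewrite lt_min del0.
move=> h; rewrite lt_min => /andP[hh hT].
have thT : `|t + h| < T by apply: le_lt_trans (ler_normD _ _) _; rewrite -ltrBrDl.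
have step M : (N <= M)%N ->
    `|(f M (t + h) - f N (t + h)) - (f M t - f N t)| <= e / 2 * `|h|.
  move=> NM; have NM0 := leq_trans NN0 NM.
  have T' x : Num.min t (t + h) <= x <= Num.max t (t + h) -> `|x| < T.
    move=> hx; have [h1|h1] := leP `|t| `|t + h|.
      by apply: le_lt_trans thT; exact: ball_between hx.
    by apply: le_lt_trans tT; apply: ball_between hx => //; exact: ltW.
  have [z hz ->] := @mean_value _ (fun x => f M x - f N x)
      (fun x => g M x - g N x) t (t + h)
      (fun z hz => drv_sub (df M z NM0 (T' z hz)) (df N z NN0 (T' z hz))).
  rewrite addrAC subrr add0r normrM ler_wpM2r //.
  have := hN M NM z (T' z hz); have := hN N (leqnn _) z (T' z hz).
  rewrite !ler_norml => /andP[? ?] /andP[? ?]; apply/andP; split; lra.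
apply/ler_addgt0Pr => eta eta0; have eta2 : 0 < eta / 2 by rewrite divr_gt0.
have [M1 hM1] := cf t tT _ eta2; have [M2 hM2] := cf (t + h) thT _ eta2.
pose M := maxn N (maxn M1 M2).
have s1 := step M (leq_maxl _ _).
have s2 := hM1 M (leq_trans (leq_maxl _ _) (leq_maxr _ _)).
have s3 := hM2 M (leq_trans (leq_maxr _ _) (leq_maxr _ _)).
have s4 := hdel h hh.
have s5 : `|h * (g N t - g0 t)| <= e / 4 * `|h|.
  by rewrite normrM mulrC ler_wpM2r // hN.
move: s1 s2 s3 s4 s5; rewrite !ler_norml.
move=> /andP[? ?] /andP[? ?] /andP[? ?] /andP[? ?] /andP[? ?].
apply/andP; split; lra.
Qed.

Lemma primitive (g : R -> R) : continuous g ->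
  exists G : R -> R, G 0 = 0 /\ forall t, is_derive t 1 G (g t).
Proof.
move=> cg; pose I (A : interval R) := \int[@lebesgue_measure R]_(x in [set` A]) g x.
pose P a x := I `[a, x] - I `[a, 0].
have intg a b : (@lebesgue_measure R).-integrable [set` `[a, b]] (EFin \o g).
  apply: continuous_compact_integrable; first exact: segment_compact.
  exact: continuous_subspaceT.
have Pind a b x : a <= b -> b <= x -> b <= 0 -> P a x = P b x.
  move=> ab bx b0.
  have H c y : c <= b -> b <= y -> I `[c, y] - I `[c, b] = I `]b, y].
    by move=> cb by_; apply: Rintegral_itvB; rewrite ?bnd_simp.
  have := H a x ab bx; have := H a 0 ab b0; have := H b x (lexx _) bx.
  have := H b 0 (lexx _) b0; rewrite /P; lra.
have dP a x : a < x -> is_derive x 1 (P a) (g x).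
  move=> ax; rewrite -[g x]subr0.
  apply: (@drv_sub _ x (fun y => I `[a, y]) (fun=> I `[a, 0])).
  have xx : x < x + 1 by rewrite ltrDl.
  have ax' : (BLeft a < BRight x)%E by rewrite lte_fin.
  have [d1 d2] := @continuous_FTC1 R g (BLeft a) x (x + 1) xx (intg _ _) ax' (cg x).
  by apply: DeriveDef d1 _; rewrite -derive1E.
exists (fun x => P (- `|x| - 1) x); split.
  by rewrite /P subrr.
move=> t; have a0 : - `|t| - 2 < t.
  by have := ler_norm (- t); rewrite normrN; lra.
apply: near_eq_is_derive (dP _ _ a0); near=> x.
have : `|t - x| < 1 by near: x; apply: nbhsx_ballx.
move=> tx; have xt : `|x| <= `|t| + 1.
  by rewrite -[x](subKr t); apply: le_trans (ler_normB _ _) _; rewrite lerD2l ltW.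
apply: Pind.
- by lra.
- by have := ler_norm (- x); rewrite normrN; lra.
- by have := normr_ge0 x; lra.
Unshelve. all: by end_near.
Qed.

Lemma expn2_small (A e : R) : 0 <= A -> 0 < e -> exists N, forall M, (N <= M)%N -> A / 2 ^+ M <= e.
Proof.
move=> A0 e0; pose N := Num.bound (A / e).
have hN : A / e < N%:R.
  by apply: le_lt_trans (archi_boundP _); rewrite ?ler_norm // divr_ge0 // ltW.
exists N => M NM.
rewrite ler_pdivrMr ?exprn_gt0 // mulrC -ler_pdivrMr //; apply: le_trans (ltW hN) _.
apply: (@le_trans _ _ M%:R); first by rewrite ler_nat.
by rewrite -natrX ler_nat; apply: ltnW; exact: ltn_expl.
Qed.

End Limits.

Section Picard.
Variable R : realType.
Implicit Types t : R.
Variables (J : eqType) (s : seq J) (G : (J -> R) -> J -> R) (x0 : J -> R) (L : R).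
Hypothesis L0 : 0 < L.
Hypothesis lipG : forall (x y : J -> R) j, `|G x j - G y j| <= L * \sum_(i <- s) `|x i - y i|.

Let prim (g : R -> R) : R -> R :=
  if pselect (continuous g) is left h then projT1 (cid (primitive h)) else cst 0.

Let primP (g : R -> R) : continuous g -> prim g 0 = 0 /\ forall t, is_derive t 1 (prim g) (g t).
Proof.
by rewrite /prim; case: pselect => // h _; exact: (projT2 (cid (primitive h))).
Qed.

Let X := fix X (n : nat) (t : R) (j : J) : R := if n is m.+1 then
  x0 j + prim (fun tau => G (X m tau) j) t else x0 j.

Let continuousG (x : R -> J -> R) : (forall j, continuous (x^~ j)) ->
  forall j, continuous (fun t => G (x t) j).
Proof.
move=> cx j t; apply/cvgrPdist_le => e e0.
pose d := e / (L * (size s)%:R + 1).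
have den : 0 < L * (size s)%:R + 1 by rewrite ltr_wpDl // mulr_ge0 // ltW.
have d0 : 0 < d by rewrite divr_gt0.
have near_r (r : seq J) : \forall t' \near t, \sum_(i <- r) `|x t i - x t' i| <= (size r)%:R * d.
  elim: r => [|i r IH]; first by near=> t'; rewrite big_nil mul0r.
  have Hi : \forall t' \near t, `|x t i - x t' i| <= d.
    by move/cvgrPdist_le: (cx i t); apply.
  near=> t'; rewrite big_cons /= -natr1 mulrDl mul1r addrC lerD //; first by near: t'.
  by near: t'.
have ns := near_r s.
near=> t'; apply: le_trans (lipG _ _ _) _.
apply: (@le_trans _ _ (L * ((size s)%:R * d))).
  have h : \sum_(i <- s) `|x t i - x t' i| <= (size s)%:R * d by near: t'.
  by rewrite ler_wpM2l // ltW.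
rewrite mulrA /d mulrCA ler_piMr ?(ltW e0) // ler_pdivrMr // mul1r lerDl.
Unshelve. all: by end_near.
Qed.

Let XP n : (forall j, X n 0 j = x0 j) /\ (forall j, continuous (fun t => X n t j)) /\
  forall t j, is_derive t 1 (fun t => X n.+1 t j) (G (X n t) j).
Proof.
elim: n => [|n [X0 [cX dX]]].
  have c0 j : continuous (fun t => X 0 t j) by move=> t; exact: cvg_cst.
  split=> //; split=> // t j.
  rewrite -[G _ _]add0r.
  exact: (@drv_add _ t (fun=> x0 j) _ _ _ (drv_cst _ _) ((primP (continuousG c0 (j := j))).2 t)).
have c1 j : continuous (fun t => X n.+1 t j) by move=> t; exact: drv_cont (dX t j).
split=> [j|].
  by rewrite /= (primP (continuousG cX (j := j))).1 addr0.
split=> // t j; rewrite -[G _ _]add0r.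
exact: (@drv_add _ t (fun=> x0 j) _ _ _ (drv_cst _ _) ((primP (continuousG c1 (j := j))).2 t)).
Qed.

(** With the weight [expR (mu * `|t|)] the Picard map contracts by one half. *)
Let mu := 2 * L * (size s)%:R + 1.
Let A := \sum_(i <- s) `|G x0 i| / mu.
Let mu0 : 0 < mu.
Proof. by rewrite ltr_wpDl // !mulr_ge0 // ltW. Qed.
Let A0 : 0 <= A.
Proof. by apply: sumr_ge0 => i _; rewrite divr_ge0 // ltW. Qed.

Let step n t : \sum_(i <- s) `|X n.+1 t i - X n t i| <= A / 2 ^+ n * expR (mu * `|t|) /\
  forall j, `|X n.+2 t j - X n.+1 t j| <= L * (A / 2 ^+ n) / mu * expR (mu * `|t|).
Proof.
have next m : (forall t, \sum_(i <- s) `|X m.+1 t i - X m t i| <= A / 2 ^+ m * expR (mu * `|t|)) ->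
    forall t j, `|X m.+2 t j - X m.+1 t j| <= L * (A / 2 ^+ m) / mu * expR (mu * `|t|).
  move=> H t' j.
  apply: (@growth_bound _ (fun t => X m.+2 t j - X m.+1 t j)
    (fun t => G (X m.+1 t) j - G (X m t) j) _ _ `|t'|) => //.
  - by rewrite mulr_ge0 ?divr_ge0 ?exprn_ge0 // ltW.
  - by rewrite (XP m.+2).1 (XP m.+1).1 subrr.
  - by move=> x _; apply: drv_sub; [exact: (XP m.+1).2.2|exact: (XP m).2.2].
  move=> x _; apply: le_trans (lipG _ _ _) _.
  by rewrite -[leRHS]mulrA ler_wpM2l ?H // ltW.
have main m : forall t, \sum_(i <- s) `|X m.+1 t i - X m t i| <= A / 2 ^+ m * expR (mu * `|t|).
  elim: m => [|m IH] t'.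
    rewrite expr0 divr1 /A mulr_suml; apply: ler_sum => i _.
    apply: (@growth_bound _ (fun t => X 1 t i - X 0 t i) (fun t => G x0 i - 0) _ _ `|t'|) => //.
    - by rewrite (XP 1).1 subrr.
    - by move=> x _; apply: drv_sub; [exact: (XP 0).2.2|exact: drv_cst].
    move=> x _; rewrite subr0 ler_peMr // -expR0 ler_expR mulr_ge0 // ltW //.
  apply: le_trans (ler_sum _ (fun i _ => next m IH t' i)) _.
  rewrite big_const_seq count_predT iter_addr_0 -[leLHS]mulr_natl mulrA ler_wpM2r ?expR_ge0 //.
  rewrite exprS; set B := 2 ^+ m; have B0 : 0 < B by rewrite exprn_gt0.
  have -> : (size s)%:R * (L * (A / B) / mu) = A / (2 * B) * (2 * L * (size s)%:R / mu).
    by field; rewrite !gt_eqF.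
  rewrite ler_piMr ?divr_ge0 ?mulr_ge0 ?(ltW B0) //.
  by rewrite ler_pdivrMr // mul1r lerDl.
by split=> [|j]; [exact: main|exact: next (main n) t j].
Qed.

Let cauchyX t j : forall N M, (N <= M)%N ->
  `|X M.+1 t j - X N.+1 t j| <= 2 * (L * A / mu * expR (mu * `|t|)) / 2 ^+ N.
Proof.
set B := L * A / mu * expR (mu * `|t|).
have B0 : 0 <= B by rewrite mulr_ge0 ?expR_ge0 // divr_ge0 ?mulr_ge0 // ltW.
suff H N d : `|X (N + d).+1 t j - X N.+1 t j| <= 2 * B / 2 ^+ N - 2 * B / 2 ^+ (N + d).
  move=> N M NM; have := H N (M - N)%N; rewrite subnKC // => /le_trans; apply.
  by rewrite gerBl divr_ge0 ?exprn_ge0 //; exact: mulr_ge0 (ler0n _ 2) B0.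
elim: d => [|d IH]; first by rewrite addn0 !subrr normr0.
have S := (step (N + d) t).2 j; rewrite addnS.
have E : L * (A / 2 ^+ (N + d)) / mu * expR (mu * `|t|) = B / 2 ^+ (N + d).
  by rewrite /B; field; rewrite !gt_eqF // exprn_gt0.
rewrite {}E in S; rewrite -(subrKA (X (N + d).+1 t j)); apply: le_trans (ler_normD _ _) _.
apply: le_trans (lerD S IH) _; rewrite exprS.
set c := 2 ^+ (N + d); have c0 : 0 < c by rewrite exprn_gt0.
rewrite [2 * B / (2 * c)](_ : _ = B / c); last by field; rewrite gt_eqF.
lra.
Qed.

(** A globally Lipschitz field has a global flow: the geometric rate of [cauchyX] gives
    locally uniform convergence of the iterates, and [derive_lim] then identifies
    the derivative of the limit. *)
Theorem picard : exists x : R -> J -> R, x 0 = x0 /\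
  forall t j, is_derive t 1 (x^~ j) (G (x t) j).
Proof.
have lim t j := rate_lim (@cauchyX t j).
pose x t j := projT1 (cid (lim t j)).
have xP t j N : `|X N.+1 t j - x t j| <= 2 * (L * A / mu * expR (mu * `|t|)) / 2 ^+ N.
  exact: (projT2 (cid (lim t j))).
have unif T e : 0 < e -> exists N, forall M, (N <= M)%N -> forall t, `|t| < T ->
    forall j, `|X M.+1 t j - x t j| <= e.
  move=> e0; have B0 : 0 <= 2 * (L * A / mu * expR (mu * T)).
    by rewrite !mulr_ge0 ?expR_ge0 ?invr_ge0 // ltW.
  have [N hN] := expn2_small B0 e0; exists N => M NM t tT j.
  apply: le_trans (xP t j M) _; apply: le_trans (hN M NM).
  rewrite ler_wpM2r ?invr_ge0 ?exprn_ge0 // ler_wpM2l // ler_wpM2l //.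
    by rewrite divr_ge0 ?mulr_ge0 // ltW.
  by rewrite ler_expR ler_wpM2l // ltW.
exists x; split.
  apply/funext => j; apply/eqP; rewrite eq_sym -subr_eq0 -normr_le0.
  apply/ler_addgt0Pr => e e0; have [N hN] := unif 1 e e0.
  have := hN N (leqnn _) 0; rewrite normr0 ltr01 add0r => /(_ isT j).
  by rewrite (XP N.+1).1.
move=> t j; apply: (@derive_lim _ (fun n t => X n.+1 t j) (fun n t => G (X n t) j)
    (fun t => x t j) (fun t => G (x t) j) 0 (`|t| + 1)).
- by move=> N t' _ _; exact: (XP N).2.2.
- move=> t' tT e e0; have [N hN] := unif (`|t| + 1) e e0; exists N => M NM.
  exact: hN.
- move=> e e0; have den : 0 < L * (size s)%:R + 1 by rewrite ltr_wpDl // mulr_ge0 // ltW.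
  have d0 : 0 < e / (L * (size s)%:R + 1) by rewrite divr_gt0.
  have [N hN] := unif (`|t| + 1) _ d0; exists N.+1 => -[//|M] NM t' tT.
  apply: le_trans (lipG _ _ _) _.
  apply: (@le_trans _ _ (L * \sum_(i <- s) (e / (L * (size s)%:R + 1)))).
    by rewrite ler_wpM2l ?(ltW L0) //; apply: ler_sum => i _; exact: hN.
  rewrite big_const_seq count_predT iter_addr_0 -[_ *+ size s]mulr_natl.
  rewrite [leLHS](_ : _ = e * (L * (size s)%:R / (L * (size s)%:R + 1))); last first.
    by field; rewrite gt_eqF.
  rewrite ler_piMr ?(ltW e0) //.
  by rewrite ler_pdivrMr // mul1r lerDl.
- by rewrite ltrDl.
Qed.

End Picard.

(** * Galerkin approximations *)

Section ComplexDerivative.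
Variable R : realType.
Implicit Types (t : R) (d : R[i]).

Definition cderiv (c : R -> R[i]) t d :=
  is_derive t 1 (fun x => Re (c x)) (Re d) /\ is_derive t 1 (fun x => Im (c x)) (Im d).

Lemma cderivB (a b : R -> R[i]) t d e : cderiv a t d -> cderiv b t e ->
  cderiv (fun x => a x - b x) t (d - e).
Proof.
move=> [ar ai] [br bi]; split; rewrite !ReImE.
  by under eq_fun do rewrite !ReImE; exact: drv_sub.
by under eq_fun do rewrite !ReImE; exact: drv_sub.
Qed.

Lemma energy_deriv (r : seq int) (om : int -> R) (c : R -> int -> R[i]) t (d : int -> R[i]) :
  (forall k, k \in r -> cderiv (c^~ k) t (d k)) ->
  is_derive t 1 (fun x => \sum_(k <- r) om k * nc (c x k) ^+ 2)
    (\sum_(k <- r) om k * (2 * Re ((c t k)^*%C * d k))).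
Proof.
move=> H; apply: drv_sum => k /H [hr hi]; apply: drv_scale.
under eq_fun do rewrite ncE !expr2.
apply: is_derive_eq (drv_add (drv_mul hr hr) (drv_mul hi hi)) _.
by rewrite !ReImE; ring.
Qed.

End ComplexDerivative.

Section Galerkin.
Variables (R : realType) (lambda : R) (S : int -> int -> int -> R[i]) (C s Cs : R).
Hypothesis adm : admissible lambda S C s Cs.
Implicit Types (c u v : int -> R[i]) (k m n : int) (t : R).
Let K := C * Cs * Mconst (s + lambda - 1).

Variable N : nat.

Definition l1N c : R := \sum_(k <- Zr N) nc (c k).

Lemma l1N_ge0 c : 0 <= l1N c.
Proof. by apply: sumr_ge0 => k _; exact: nc_ge0. Qed.

Lemma l1N_term c k : k \in Zr N -> nc (c k) <= l1N c.
Proof.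
by move=> kN; rewrite /l1N (big_rem k) //= lerDl sumr_ge0 // => m _; exact: nc_ge0.
Qed.

(** The radial retraction onto the ball of radius [B] of the l^1 norm: it makes the
    quadratic field globally Lipschitz, and being a real multiple of the identity
    it does not affect the conservation of the momentum. *)
Definition cut (B : R) c : R := B / Num.max B (l1N c).

Definition retract (B : R) c k : R[i] := (cut B c)%:C%C * c k.

Lemma nc_real (x : R) : 0 <= x -> nc (x%:C%C) = x.
Proof. by move=> x0; rewrite /= expr0n addr0 sqrtr_sqr ger0_norm. Qed.

Section Retract.
Variable B : R.
Hypothesis B0 : 0 < B.

Lemma max_gt0 c : 0 < Num.max B (l1N c).
Proof. by rewrite lt_max B0. Qed.

Lemma cut_gt0 c : 0 < cut B c.
Proof. by rewrite divr_gt0 // max_gt0. Qed.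

Lemma cut_le1 c : cut B c <= 1.
Proof. by rewrite ler_pdivrMr ?max_gt0 // mul1r le_max lexx. Qed.

Lemma cut_eq1 c : l1N c <= B -> cut B c = 1.
Proof. by move=> h; rewrite /cut (max_idPl h) divff // gt_eqF. Qed.

Lemma nc_retract c k : nc (retract B c k) = cut B c * nc (c k).
Proof. by rewrite Normc.normcM nc_real // ltW // cut_gt0. Qed.

Lemma l1N_retract c : l1N (retract B c) <= B.
Proof.
rewrite /l1N; under eq_bigr do rewrite nc_retract.
rewrite -mulr_sumr /cut mulrAC ler_pdivrMr ?max_gt0 // ler_wpM2l ?(ltW B0) //.
by rewrite le_max lexx orbT.
Qed.

Lemma retract_hermitian c : hermitian c -> hermitian (retract B c).
Proof.
move=> [c0 hc]; split=> [|k]; first by rewrite /retract c0 mulr0.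
by rewrite /retract hc; apply: complex_ext; rewrite !ReImE /=; ring.
Qed.

Lemma retract_lip c u : l1N (fun k => retract B c k - retract B u k) <=
  2 * l1N (fun k => c k - u k).
Proof.
pose d := l1N (fun k => c k - u k).
have dist : `|l1N u - l1N c| <= d.
  rewrite /l1N -sumrB; apply: le_trans (ler_norm_sum _ _ _) _; apply: ler_sum => k _.
  rewrite ler_norml lerNl opprB !lerBlDr; apply/andP; split.
    by rewrite -[X in nc X <= _](subrK (u k)); exact: ncD.
  by rewrite -(normcN (c k - u k)) opprB -[X in nc X <= _](subrK (c k)); exact: ncD.
pose X := Num.max B (l1N c); pose Y := Num.max B (l1N u).
have X0 : 0 < X by exact: max_gt0.
have Y0 : 0 < Y by exact: max_gt0.
have YX : `|Y - X| <= d.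
  apply: le_trans dist; rewrite /Y /X; have [h1|h1] := leP B (l1N u); have [h2|h2] := leP B (l1N c) => //.
  - by rewrite !ger0_norm; lra.
  - by rewrite !ler0_norm; lra.
  - by rewrite subrr normr0.
have cutd : `|cut B c - cut B u| * l1N u <= d.
  have -> : cut B c - cut B u = B * (Y - X) / (X * Y).
    by rewrite /cut -/X -/Y; field; rewrite !gt_eqF.
  have XY0 : 0 < (X * Y)^-1 by rewrite invr_gt0 mulr_gt0.
  rewrite !(normrM _ (X * Y)^-1) (normrM B) (gtr0_norm B0) (gtr0_norm XY0).
  have BX : B / X <= 1 by exact: cut_le1.
  have UY : l1N u / Y <= 1 by rewrite ler_pdivrMr // mul1r le_max lexx orbT.
  have -> : B * `|Y - X| / (X * Y) * l1N u = `|Y - X| * ((B / X) * (l1N u / Y)).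
    by field; rewrite !gt_eqF.
  apply: le_trans YX; rewrite ler_piMr // mulr_ile1 // divr_ge0 ?l1N_ge0 // ltW //.
have -> : 2 * d = d + d by ring.
apply: le_trans (lerD (lexx d) cutd).
rewrite {1}/d /l1N mulr_sumr -big_split; apply: ler_sum => k _ /=.
rewrite /retract.
have -> : (cut B c)%:C%C * c k - (cut B u)%:C%C * u k =
    (cut B c)%:C%C * (c k - u k) + ((cut B c)%:C%C - (cut B u)%:C%C) * u k by ring.
apply: le_trans (ncD _ _) _; apply: lerD; rewrite Normc.normcM.
  by rewrite nc_real ?(ltW (cut_gt0 c)) // ler_piMl ?nc_ge0 // cut_le1.
rewrite ler_wpM2r ?nc_ge0 //.
by rewrite -rmorphB /= expr0n addr0 sqrtr_sqr.
Qed.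

End Retract.

(** Only the coefficients of positive index are unknowns, so that the symmetry
    of real functions is built in. *)
Definition assemble (y : int * bool -> R) k : R[i] :=
  if k \in Zr N then
    if 0 < k then Complex (y (k, true)) (y (k, false))
    else if k < 0 then Complex (y (- k, true)) (- y (- k, false)) else 0
  else 0.

Lemma assemble_hermitian y : hermitian (assemble y).
Proof.
split=> [|k]; first by rewrite /assemble ltxx; case: ifP.
rewrite /assemble !mem_Zr abszN oppr_gt0 oppr_lt0; case: ifP => _; last by rewrite conjc0.
by case: (ltgtP k 0) => k0; rewrite ?opprK //= ?opprK ?oppr0.
Qed.

Lemma assemble_out y k : k \notin Zr N -> assemble y k = 0.
Proof. by rewrite /assemble => /negbTE ->. Qed.

Definition idx : seq (int * bool) := [seq (k, b) | k <- Zr N, b <- [:: true; false]].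

Lemma assemble_lip y z : l1N (fun k => assemble y k - assemble z k) <=
  (size (Zr N))%:R * (2 * \sum_(i <- idx) `|y i - z i|).
Proof.
set D := \sum_(i <- _) _.
have D0 : 0 <= D by apply: sumr_ge0.
have term k b : k \in Zr N -> `|y (k, b) - z (k, b)| <= D.
  move=> kN; rewrite /D (big_rem (k, b)) /= ?lerDl ?sumr_ge0 //.
  by apply/allpairsP; exists (k, b); split=> //; case: b.
rewrite mulr_natl -[X in _ <= _ *+ X]count_predT -iter_addr_0 -big_const_seq.
rewrite /l1N !big_seq; apply: ler_sum => k kN; rewrite /assemble kN.
have T0 : nc (0 - 0) <= 2 * D by rewrite subrr Normc.normc0 mulr_ge0.
have -> : 2 * D = D + D by ring.
case: ltgtP => k0; last by rewrite subrr Normc.normc0 addr_ge0.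
- by apply: le_trans (nc_le_ReIm _) _; rewrite /=; apply: lerD; exact: term.
- have kN' : - k \in Zr N by rewrite mem_Zr abszN -mem_Zr.
  apply: le_trans (nc_le_ReIm _) _; rewrite /=.
  rewrite [X in _ + X <= _](_ : _ = `|y (- k, false) - z (- k, false)|); last first.
    by rewrite -normrN; congr `|_|; ring.
  by apply: lerD; exact: term.
Qed.

(** The retracted equation has a global solution by [picard]. Its sum of squares is
    conserved, which bounds its l^1 norm; the radius [B] below exceeds that bound,
    so that the retraction acts as the identity along the solution. *)
Theorem galerkin (c0 : int -> R[i]) : hermitian c0 ->
  exists c : R -> int -> R[i], [/\ forall k, k \in Zr N -> c 0 k = c0 k,
    forall t, hermitian (c t), forall t k, k \notin Zr N -> c t k = 0 &
    forall t k, k \in Zr N -> cderiv (c^~ k) t (mi R k * bq S N (c t) (c t) (- k))].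
Proof.
move=> [c00 hc0].
pose B := \sum_(k <- Zr N) nc (c0 k) ^+ 2 + (size (Zr N))%:R + 1.
have E00 : 0 <= \sum_(k <- Zr N) nc (c0 k) ^+ 2 by apply: sumr_ge0 => k _; exact: sqr_ge0.
have B0 : 0 < B by rewrite ltr_wpDl // addr_ge0.
have C0 := C_ge0 adm.
pose f c k : R[i] := mi R k * bq S N (retract B c) (retract B c) (- k).
pose G (y : int * bool -> R) (j : int * bool) : R :=
  if j.1 \in Zr N then if j.2 then Re (f (assemble y) j.1) else Im (f (assemble y) j.1)
  else 0.
have rsup y k : nc (retract B (assemble y) k) <= B.
  have [kN|kN] := boolP (k \in Zr N).
    exact: le_trans (l1N_term _ kN) (l1N_retract B0 _).
  by rewrite /retract assemble_out // mulr0 Normc.normc0 ltW.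
have flip y z k : k \in Zr N -> nc (f (assemble y) k - f (assemble z) k) <=
   N%:R * (C * (2 * B) * (2 * ((size (Zr N))%:R * (2 * \sum_(i <- idx) `|y i - z i|)))).
  move=> kN; rewrite /f -mulrBr (bq_diff adm).
  rewrite Normc.normcM nc_mi; apply: ler_pM => //; rewrite ?nc_ge0 //.
    by rewrite abzE ler_nat -mem_Zr.
  apply: le_trans; first apply: (@nc_bq_le _ _ _ _ _ _ adm N _ _ _ (2 * B)).
  - by rewrite mulr_ge0 // ltW.
  - by move=> n; apply: le_trans (ncD _ _) _; rewrite mulr2n mulrDl mul1r lerD.
  rewrite ler_wpM2l ?mulr_ge0 ?(ltW B0) //.
  apply: le_trans (retract_lip B0 _ _) _; rewrite ler_wpM2l //; exact: assemble_lip.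
pose L := N%:R * (C * (2 * B) * (2 * ((size (Zr N))%:R * 2))) + 1.
have L0 : 0 < L by rewrite ltr_wpDl // !mulr_ge0 // ltW.
have lipG (y z : int * bool -> R) j : `|G y j - G z j| <= L * \sum_(i <- idx) `|y i - z i|.
  set D := \sum_(i <- _) _; have D0 : 0 <= D by apply: sumr_ge0.
  rewrite /G; case: ifP => kN; last by rewrite subrr normr0 mulr_ge0 // ltW.
  apply: (@le_trans _ _ (nc (f (assemble y) j.1 - f (assemble z) j.1))).
    case: ifP => _; first by rewrite -Re_opp -Re_add; exact: Re_le_nc.
    by rewrite -Im_opp -Im_add; exact: Im_le_nc.
  apply: le_trans (flip y z _ kN) _; rewrite -/D.
  rewrite [leLHS](_ : _ = (L - 1) * D); last by rewrite /L; ring.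
  by rewrite ler_wpM2r // gerBl.
have [y [y0 dy]] := picard
  (fun j : int * bool => if j.2 then Re (c0 j.1) else Im (c0 j.1)) L0 lipG.
pose c t := assemble (y t).
have hc t : hermitian (c t) by exact: assemble_hermitian.
have c0E k : k \in Zr N -> c 0 k = c0 k.
  move=> kN; rewrite /c /assemble kN y0 /=; case: ltgtP => k0.
  - by case: (c0 k).
  - by rewrite hc0; case: (c0 k) => a b /=; rewrite opprK.
  - by rewrite -k0 c00.
have dc t k : k \in Zr N -> cderiv (c^~ k) t (f (c t) k).
  move=> kN; have kN' : - k \in Zr N by rewrite mem_Zr abszN -mem_Zr.
  have fE : f (c t) (- k) = ((f (c t) k)^*)%C.
    rewrite /f rmorphM /= (bq_hermitian adm); [|exact: retract_hermitian..].
    by congr (_ * _); apply: complex_ext; rewrite /mi /= ?intrN ?mulrNz ?oppr0.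
  rewrite /cderiv /c /assemble; under eq_fun do rewrite kN; under [X in _ /\ is_derive _ _ X _]eq_fun do rewrite kN.
  case: ltgtP => k0 /=.
  - by have := dy t (k, true); have := dy t (k, false); rewrite /G kN /= -/(c t).
  - have := dy t (- k, true); have := dy t (- k, false).
    rewrite /G kN' /= -/(c t) fE Re_conj Im_conj => h1 h2; split => //.
    by apply: is_derive_eq (drv_opp h1) _; rewrite opprK.
  - have -> : f (c t) k = 0 by rewrite /f -k0 /mi oppr0 mul0r.
    by split; exact: drv_cst.
have E2 t : \sum_(k <- Zr N) nc (c t k) ^+ 2 = \sum_(k <- Zr N) nc (c0 k) ^+ 2.
  have dE x := @energy_deriv R (Zr N) (fun=> 1) c x _ (dc x).
  have dE0 x : \sum_(k <- Zr N) 1 * (2 * Re ((c x k)^*%C * f (c x) k)) = 0.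
    set X := \sum_(k <- _) _; have : cut B (c x) * X = 0.
      rewrite -[RHS](momentum_T3 adm N (retract_hermitian B (hc x))) mulr_sumr.
      apply: eq_bigr => k _; rewrite /f; set z := mi R k * _.
      by rewrite /retract !ReImE /=; ring.
    by move/eqP; rewrite mulf_eq0 (gt_eqF (cut_gt0 B0 (c x))) => /eqP.
  have [z _] := mean_value (x := 0) (y := t) (fun z _ => dE z).
  rewrite dE0 mul0r => /eqP; rewrite subr_eq0 => /eqP.
  under eq_bigr do rewrite mul1r; under [RHS]eq_bigr do rewrite mul1r.
  by move=> ->; apply: eq_big_seq => k /c0E ->.
have cutE t : cut B (c t) = 1.
  apply: cut_eq1 => //; rewrite /B -(E2 t) /l1N.
  apply: (@le_trans _ _ (\sum_(k <- Zr N) (nc (c t k) ^+ 2 + 1))).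
    apply: ler_sum => k _; have := sqr_ge0 (nc (c t k) - 1); nra.
  by rewrite big_split /= big_const_seq count_predT iter_addr_0 lerDl.
(* hence the truncated equation itself holds *)
have rE t : retract B (c t) = c t.
  by apply/funext => k; rewrite /retract cutE mul1r.
exists c; split=> //; first by move=> t k; exact: assemble_out.
by move=> t k kN; have := dc t k kN; rewrite /f rE.
Qed.

End Galerkin.

(** * Truncation errors and stability *)

Section Truncation.
Variables (R : realType) (lambda : R) (S : int -> int -> int -> R[i]) (C s Cs : R).
Hypothesis adm : admissible lambda S C s Cs.
Implicit Types (c u v : int -> R[i]) (k m n : int) (N : nat) (t B e T F : R).
Let hs1 := adm_s1 adm.
Let s_ge0 : 0 <= s.
Proof. by have := hs1; lra. Qed.
Let K := C * Cs * Mconst (s + lambda - 1).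

Lemma K_ge0 : 0 <= K.
Proof. by rewrite /K !mulr_ge0 ?(C_ge0 adm) ?(Cs_ge0 adm) ?Mconst_ge0. Qed.

(** The Fourier coefficients of [a(u, u)]. *)
Definition Qc c k : R[i] := sumZC (fun n => S (- k) (k - n) n * c (k - n) * c n).

Lemma sumle_outside (g : int -> R) A e : (forall k, 0 <= g k) -> sumle g A -> 0 < e ->
  exists N0, forall N, (N0 <= N)%N -> sumle (fun k => if k \in Zr N then 0 else g k) e.
Proof.
move=> g0 hg e0; have [N0 hN] := sumle_tail g0 hg e0.
exists N0 => N NN r ur; under eq_bigr do rewrite -if_neg.
rewrite -big_mkcond -big_filter; apply: hN; first exact: filter_uniq.
move=> k; rewrite mem_filter mem_Zr -ltnNge => /andP[h _].
exact: leq_ltn_trans NN h.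
Qed.

(** The tail is uniform in [c], by Cauchy-Schwarz against the tail of
    [|k| `^ - (2 s)]. *)
Lemma l1_outside B e : 0 <= B -> 0 < e ->
  exists N0, forall N, (N0 <= N)%N -> forall c, c 0 = 0 -> hbd s c B ->
    sumle (fun k => if k \in Zr N then 0 else nc (c k)) e.
Proof.
move=> B0 e0; have d0 : 0 < e / (B + 1) by rewrite divr_gt0 // ltr_wpDl.
have g0 k : 0 <= if k == 0 then 0 else ab k `^ (- (2 * s)) :> R.
  by case: ifP => // _; exact: powR_ge0.
have [N0 hN] := sumle_outside g0 (Mconst_sumle hs1) (exprn_gt0 2 d0).
exists N0 => N /hN h c c0 hc.
pose a k : R := if k \in Zr N then 0 else if k == 0 then 0 else ab k `^ (- s).
have ha : sumle (fun k => a k ^+ 2) ((e / (B + 1)) ^+ 2).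
  apply: sumle_mono h => k; rewrite /a; case: ifP => _; first by rewrite expr0n.
  by case: ifP => _; rewrite ?expr0n // powRsq // mulrN.
have hab := sumle_CS (ltW d0) B0 ha hc.
apply: sumle_le (sumle_mono _ hab) _.
  move=> k; rewrite /a; case: ifP => _; first by rewrite mul0r.
  case: eqP => [->|/eqP k0]; first by rewrite c0 Normc.normc0 mul0r.
  by rewrite mulrA powR_mul ?ab_gt0 // addNr powRr0 mul1r.
rewrite mulrAC ler_pdivrMr ?ltr_wpDl // ler_wpM2l ?(ltW e0) //; lra.
Qed.

Lemma Qc_terms c k B : 0 <= B -> c 0 = 0 -> hbd s c B ->
  sumle (fun n => nc (S (- k) (k - n) n * c (k - n) * c n)) (C * B * (Mconst s * B)).
Proof.
move=> B0 c0 hc; have C0 := C_ge0 adm.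
have := sumleZ (mulr_ge0 C0 B0) (hbd_l1 hs1 B0 c0 hc).
apply: sumle_mono => n; rewrite !Normc.normcM ler_wpM2r ?nc_ge0 //.
by apply: ler_pM; rewrite ?nc_ge0 // ?(S_le adm) // (hbd_sup _ s_ge0).
Qed.

Lemma sum_Zr_widen (V : zmodType) (g : int -> V) N M : (N <= M)%N ->
  \sum_(k <- Zr N) g k = \sum_(k <- Zr M) if k \in Zr N then g k else 0.
Proof.
move=> NM; rewrite -big_mkcond -big_filter; apply: perm_big; apply: uniq_perm.
- exact: uniq_Zr.
- by rewrite filter_uniq ?uniq_Zr.
move=> k; rewrite mem_filter !mem_Zr; case: leqP => //= h.
by rewrite (leq_trans h NM).
Qed.

(** A truncated convolution misses only terms in which one of the two indices is
    outside the window. *)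
Lemma Qc_approx B e : 0 <= B -> 0 < e ->
  exists N0, forall N, (N0 <= N)%N -> forall c, c 0 = 0 -> hbd s c B ->
    forall k, nc (Qc c k - bq S N c c (- k)) <= e.
Proof.
move=> B0 e0; have C0 := C_ge0 adm.
have d0 : 0 < e / (2 * (C * B) + 1) by rewrite divr_gt0 // ltr_wpDl // !mulr_ge0.
have [N0 hN] := l1_outside B0 d0; exists N0 => N /hN tail c c0 hc k.
apply: (@sumZC_near _ _ _ _ _ N (Qc_terms k B0 c0 hc)) => M NM.
pose a n := S (- k) (k - n) n * c (k - n) * c n.
have -> : bq S N c c (- k) = \sum_(n <- Zr M) if n \in Zr N then
    (if k - n \in Zr N then a n else 0) else 0.
  rewrite -sum_Zr_widen // /bq; under eq_bigr do rewrite big_mkcond.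
  rewrite exchange_big /=; apply: eq_bigr => n _.
  rewrite -big_mkcond triad_collapse opprK; case: ifP => // _.
  by rewrite /a mulrA.
rewrite -sumrB; apply: le_trans (nc_sum _ _ _) _.
pose o j := if j \in Zr N then 0 else nc (c j).
have o0 j : 0 <= o j by rewrite /o; case: ifP; rewrite ?nc_ge0.
have sup j : nc (c j) <= B by exact: hbd_sup s_ge0 B0 c0 hc.
have t1 := tail c c0 hc _ (uniq_Zr M).
have t2 : \sum_(n <- Zr M) o (k - n) <= e / (2 * (C * B) + 1).
  apply: (sumle_inj (h := fun n => k - n) _ (tail c c0 hc)); last exact: uniq_Zr.
  by move=> x y /addrI /oppr_inj.
apply: (@le_trans _ _ (\sum_(n <- Zr M) (C * B * o n + C * B * o (k - n)))).
  apply: ler_sum => n _; rewrite -/(a n).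
  have an : nc (a n) <= C * nc (c (k - n)) * nc (c n).
    rewrite !Normc.normcM ler_wpM2r ?nc_ge0 // ler_wpM2r ?nc_ge0 //; exact: S_le adm _ _ _.
  have r0 : 0 <= C * B * o n + C * B * o (k - n).
    by rewrite addr_ge0 // !mulr_ge0.
  case: ifP => h1; first case: ifP => h2; first by rewrite subrr Normc.normc0.
    rewrite subr0; apply: le_trans an _; rewrite /o h1 h2 mulr0 add0r mulrAC.
    by rewrite ler_wpM2r ?nc_ge0 // ler_wpM2l.
  rewrite subr0; apply: le_trans an _; apply: ler_wpDr; first by rewrite !mulr_ge0.
  by rewrite /o h1 ler_wpM2r ?nc_ge0 // ler_wpM2l.
rewrite big_split /= -!mulr_sumr.
apply: le_trans (lerD (ler_wpM2l (mulr_ge0 C0 B0) t1) (ler_wpM2l (mulr_ge0 C0 B0) t2)) _.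
have den : 0 < 2 * (C * B) + 1 by rewrite ltr_wpDl // !mulr_ge0.
rewrite [leLHS](_ : _ = 2 * (C * B) * e / (2 * (C * B) + 1)); last by field; rewrite gt_eqF.
by rewrite ler_pdivrMr //; nra.
Qed.

Lemma bq_lip N u v k B : 0 <= B -> (forall n, nc (u n) <= B) -> (forall n, nc (v n) <= B) ->
  nc (bq S N u u k - bq S N v v k) <= C * (2 * B) * \sum_(m <- Zr N) nc (u m - v m).
Proof.
move=> B0 hu hv; rewrite (bq_diff adm); apply: (nc_bq_le adm).
  by rewrite mulr_ge0.
by move=> n; apply: le_trans (ncD _ _) _; have := hu n; have := hv n; lra.
Qed.

(** Two approximate solutions with the same data up to frequency [N] stay close in
    [H^(-1/2)]; this yields both uniqueness and the convergence of the Galerkin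
    approximations. *)
Lemma stability B T : 0 <= B -> 0 <= T -> exists2 kap, 0 <= kap &
  forall N e (u v eu ev : R -> int -> R[i]), 0 <= e ->
  (forall t, `|t| <= T -> [/\ hermitian (u t), hermitian (v t), hbd s (u t) B & hbd s (v t) B]) ->
  (forall k, k \in Zr N -> u 0 k = v 0 k) ->
  (forall t k, `|t| <= T -> k \in Zr N ->
     cderiv (u^~ k) t (mi R k * (bq S N (u t) (u t) (- k) + eu t k)) /\
     cderiv (v^~ k) t (mi R k * (bq S N (v t) (v t) (- k) + ev t k))) ->
  (forall t k, `|t| <= T -> k \in Zr N -> nc (eu t k) <= e /\ nc (ev t k) <= e) ->
  forall t k, `|t| <= T -> k \in Zr N -> nc (u t k - v t k) ^+ 2 <= ab k * (kap * e).
Proof.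
move=> B0 T0; have C0 := C_ge0 adm.
pose L := 4 * C * Mconst (s + lambda - 1) * (2 * B) + 1.
have L0 : 0 < L by rewrite ltr_wpDl // !mulr_ge0 // Mconst_ge0.
pose D := 8 * (Mconst s * B).
have D0 : 0 <= D by rewrite !mulr_ge0 // Mconst_ge0.
exists (D / L * expR (L * T)).
  by rewrite mulr_ge0 ?expR_ge0 // divr_ge0 // ltW.
move=> N e u v eu ev e0 hyp init der err.
pose w t k := u t k - v t k.
pose E t := \sum_(k <- Zr N) (ab k)^-1 * nc (w t k) ^+ 2.
pose dw t k := mi R k * (bq S N (u t) (u t) (- k) + eu t k)
  - mi R k * (bq S N (v t) (v t) (- k) + ev t k).
have dE t : `|t| <= T -> is_derive t 1 E
    (\sum_(k <- Zr N) (ab k)^-1 * (2 * Re ((w t k)^*%C * dw t k))).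
  move=> tT; apply: (@energy_deriv _ _ _ w) => k kN.
  by have [h1 h2] := der t k tT kN; exact: cderivB.
have E0 : E 0 = 0.
  by apply: big1_seq => k /andP[_ kN]; rewrite /w init // subrr Normc.normc0 expr0n mulr0.
(* bilinearity splits the derivative into the commutator term and the errors *)
have dEb t : `|t| <= T -> `|\sum_(k <- Zr N) (ab k)^-1 * (2 * Re ((w t k)^*%C * dw t k))|
    <= L * E t + D * e.
  move=> tT; have [hu hv bu bv] := hyp t tT.
  have hw : hermitian (w t) by exact: hermitianB.
  pose z k := u t k + v t k.
  have hz : hermitian z by exact: hermitianD.
  have bz : hbd s z (2 * B) by rewrite mulr2n mulrDl mul1r; exact: hbdD.
  have bw : hbd s (w t) (2 * B) by rewrite mulr2n mulrDl mul1r; exact: hbdB.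
  have BB0 : 0 <= 2 * B by rewrite mulr_ge0.
  have -> : \sum_(k <- Zr N) (ab k)^-1 * (2 * Re ((w t k)^*%C * dw t k)) =
      \sum_(k <- Zr N) (ab k)^-1 * (2 * Re ((w t k)^*%C * (mi R k * bq S N (w t) z (- k)))) +
      \sum_(k <- Zr N) (ab k)^-1 * (2 * Re ((w t k)^*%C * (mi R k * (eu t k - ev t k)))).
    rewrite -big_split; apply: eq_bigr => k _ /=; rewrite -mulrDr -mulrDr -Re_add -mulrDr.
    by congr (_ * (_ * Re (_ * _))); rewrite /dw -(bq_diff adm); ring.
  apply: le_trans (ler_normD _ _) _; apply: lerD.
    apply: le_trans (stability_T3 adm N BB0 hw hz bz) _.
    rewrite -/(E t) ler_wpM2r ?lerDl //.
    by apply: sumr_ge0 => k _; rewrite mulr_ge0 ?invr_ge0 ?sqr_ge0.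
  apply: le_trans (ler_norm_sum _ _ _) _.
  apply: (@le_trans _ _ (\sum_(k <- Zr N) 4 * e * nc (w t k))); last first.
    rewrite -mulr_sumr /D.
    have := hbd_l1 hs1 BB0 hw.1 bw (uniq_Zr N).
    move=> h; rewrite [leRHS](_ : _ = 4 * e * (Mconst s * (2 * B))); last by ring.
    by rewrite ler_wpM2l ?mulr_ge0.
  rewrite !big_seq; apply: ler_sum => k kN; have [h1 h2] := err t k tT kN.
  have [->|k0] := eqVneq k 0.
    by rewrite normr0 invr0 mul0r normr0 !mulr_ge0 ?nc_ge0.
  have a0 : 0 < ab k :> R by exact: ab_gt0.
  rewrite normrM normrM normfV normr_id (ger0_norm (ler0n _ 2)).
  rewrite mulrC ler_pdivrMr //.
  apply: le_trans (ler_wpM2l (ler0n _ 2) (Re_le_nc _)) _.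
  rewrite !Normc.normcM ncJ nc_mi.
  have h3 : nc (eu t k - ev t k) <= 2 * e by apply: le_trans (ncB _ _) _; lra.
  rewrite [leRHS](_ : _ = 2 * (nc (w t k) * (ab k * (2 * e)))); last by ring.
  by rewrite ler_wpM2l // ler_wpM2l ?nc_ge0 // ler_wpM2l // ltW.
move=> t k tT kN.
have De0 : 0 <= D * e by rewrite mulr_ge0.
have G := gronwall L0 De0 E0 dE dEb tT.
have [k0|k0] := eqVneq k 0.
  by have [hu hv _ _] := hyp t tT; rewrite k0 hu.1 hv.1 subrr Normc.normc0 expr0n normr0 mul0r.
have a0 : 0 < ab k :> R by exact: ab_gt0.
have : (ab k)^-1 * nc (w t k) ^+ 2 <= E t.
  rewrite /E (big_rem k) //= lerDl sumr_ge0 // => j _.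
  by rewrite mulr_ge0 ?invr_ge0 ?sqr_ge0.
rewrite mulrC ler_pdivrMr // mulrC => /le_trans; apply; rewrite ler_wpM2l ?(ltW a0) //.
apply: le_trans G _; rewrite [leRHS](_ : _ = D * e / L * expR (L * T)); last by ring.
by rewrite ler_wpM2l ?divr_ge0 ?(ltW L0) // ler_expR ler_wpM2l // ltW.
Qed.

(** Coefficientwise solutions on [[-T, T]]. *)
Definition seq_sol T (c : R -> int -> R[i]) :=
  forall t, `|t| <= T -> hermitian (c t) /\
    forall k, cderiv (c^~ k) t (mi R k * Qc (c t) k).

(** Exact solutions solve the truncated equation up to the error of [Qc_approx],
    which vanishes as the window grows. *)
Lemma seq_unique T B (u v : R -> int -> R[i]) : 0 <= T -> 0 <= B ->
  seq_sol T u -> seq_sol T v -> (forall k, u 0 k = v 0 k) ->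
  (forall t, `|t| <= T -> hbd s (u t) B /\ hbd s (v t) B) ->
  forall t k, `|t| <= T -> u t k = v t k.
Proof.
move=> T0 B0 su sv init bd t k tT.
have [kap kap0 stab] := stability B0 T0.
have small e : 0 < e -> nc (u t k - v t k) ^+ 2 <= ab k * (kap * e).
  move=> e0; have [N0 hN] := Qc_approx B0 e0.
  pose N := maxn N0 `|k|%N; have := hN N (leq_maxl _ _) => app.
  pose er (c : R -> int -> R[i]) t k := Qc (c t) k - bq S N (c t) (c t) (- k).
  apply: (stab N e u v (er u) (er v) (ltW e0)) => //.
  - by move=> x xT; have [? _] := su x xT; have [? _] := sv x xT; have [] := bd x xT.
  - move=> x j xT _; rewrite /er !subrKC.
    by have [_ ?] := su x xT; have [_ ?] := sv x xT.
  - move=> x j xT _; have [[h1 _] _] := su x xT; have [[h2 _] _] := sv x xT.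
    by have [b1 b2] := bd x xT; split; exact: app.
  - by rewrite mem_Zr leq_maxr.
have : nc (u t k - v t k) ^+ 2 <= 0.
  apply/ler_addgt0Pr => e e0; rewrite add0r.
  have den : 0 < ab k * kap + 1 :> R by rewrite ltr_wpDl // mulr_ge0.
  apply: le_trans (small _ (divr_gt0 e0 den)) _.
  rewrite [leLHS](_ : _ = e * ((ab k * kap) / (ab k * kap + 1))); last by field; rewrite gt_eqF.
  by rewrite ler_piMr ?(ltW e0) // ler_pdivrMr // mul1r lerDl.
move=> h; have /eqP : nc (u t k - v t k) ^+ 2 = 0 by apply/le_anti; rewrite h sqr_ge0.
by rewrite sqrf_eq0 => /eqP /Normc.eq0_normc /eqP; rewrite subr_eq0 => /eqP.
Qed.

End Truncation.

(** * Existence for the system of Fourier coefficients *)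

Section CauchyLimit.
Variable R : realType.

Lemma cauchy_lim (a : nat -> R) :
  (forall e, 0 < e -> exists N, forall M M', (N <= M)%N -> (N <= M')%N -> `|a M - a M'| <= e) ->
  exists l, forall e N, (forall M M', (N <= M)%N -> (N <= M')%N -> `|a M - a M'| <= e) ->
    forall M, (N <= M)%N -> `|a M - l| <= e.
Proof.
move=> H; pose A := [set x | exists N, forall M, (N <= M)%N -> x <= a M].
have lowA e N : (forall M M', (N <= M)%N -> (N <= M')%N -> `|a M - a M'| <= e) ->
    forall M, (N <= M)%N -> A (a M - e).
  move=> h M NM; exists N => M' NM'; have := h M M' NM NM'.
  by rewrite ler_norml => /andP[]; lra.
have upA e N : (forall M M', (N <= M)%N -> (N <= M')%N -> `|a M - a M'| <= e) ->
    forall M, (N <= M)%N -> ubound A (a M + e).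
  move=> h M NM x [N' hN']; apply: le_trans (hN' (maxn N N') (leq_maxr _ _)) _.
  by have := h M (maxn N N') NM (leq_maxl _ _); rewrite ler_norml => /andP[]; lra.
have [N1 h1] := H 1 ltr01.
have supA : has_sup A.
  by split; [exists (a N1 - 1); exact: lowA h1 _ _|exists (a N1 + 1); exact: upA h1 _ _].
exists (sup A) => e N h M NM; rewrite ler_distlC; apply/andP; split.
  by apply: sup_upper_bound => //; exact: lowA h _ NM.
by apply: ge_sup; [case: supA|exact: upA h _ NM].
Qed.

Lemma cauchy_lim_complex (a : nat -> R[i]) :
  (forall e, 0 < e -> exists N, forall M M', (N <= M)%N -> (N <= M')%N -> nc (a M - a M') <= e) ->
  exists l, forall e N, (forall M M', (N <= M)%N -> (N <= M')%N -> nc (a M - a M') <= e) ->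
    forall M, (N <= M)%N -> nc (a M - l) <= 2 * e.
Proof.
move=> H.
have Rle M M' : `|Re (a M) - Re (a M')| <= nc (a M - a M').
  by rewrite -Re_opp -Re_add; exact: Re_le_nc.
have Ile M M' : `|Im (a M) - Im (a M')| <= nc (a M - a M').
  by rewrite -Im_opp -Im_add; exact: Im_le_nc.
have [|lr hr] := @cauchy_lim (fun n => Re (a n)).
  by move=> e /H[N hN]; exists N => M M' h h'; apply: le_trans (Rle _ _) _; exact: hN.
have [|li hi] := @cauchy_lim (fun n => Im (a n)).
  by move=> e /H[N hN]; exists N => M M' h h'; apply: le_trans (Ile _ _) _; exact: hN.
exists (Complex lr li) => e N h M NM.
apply: le_trans (nc_le_ReIm _) _; rewrite !ReImE /= mulr2n mulrDl mul1r; apply: lerD.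
  by apply: hr NM => M' M'' h' h''; apply: le_trans (Rle _ _) _; exact: h.
by apply: hi NM => M' M'' h' h''; apply: le_trans (Ile _ _) _; exact: h.
Qed.

Lemma complex_eq_eps (z w : R[i]) : (forall e, 0 < e -> nc (z - w) <= e) -> z = w.
Proof.
move=> h; apply/eqP; rewrite -subr_eq0; apply/eqP/Normc.eq0_normc/le_anti.
rewrite nc_ge0 andbT; apply/ler_addgt0Pr => e e0; rewrite add0r; exact: h.
Qed.

End CauchyLimit.

Section Existence.
Variables (R : realType) (lambda : R) (S : int -> int -> int -> R[i]) (C s Cs : R).
Hypothesis adm : admissible lambda S C s Cs.
Implicit Types (c u v : int -> R[i]) (k m n : int) (N : nat) (t B e T F : R).
Let hs1 := adm_s1 adm.
Let s_ge0 : 0 <= s.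
Proof. by have := hs1; lra. Qed.

Definition Kc : R := C * Cs * Mconst (s + lambda - 1).
Local Notation K := Kc.

Lemma Kc_ge0 : 0 <= K.
Proof. exact: K_ge0 adm. Qed.

(** Strict inequalities leave room for a larger norm and a longer time. *)
Lemma room F t : 0 <= F -> K * F * `|t| < 1 ->
  exists F' T, [/\ F < F', `|t| < T & K * F' * T < 1].
Proof.
move=> F0 h; have K0 := Kc_ge0.
pose g := 1 - K * F * `|t|; have g0 : 0 < g by rewrite subr_gt0.
pose den := 2 * (K * `|t| + K * F + K + 1); have den0 : 0 < den.
  by rewrite mulr_gt0 // ltr_wpDl // !addr_ge0 // mulr_ge0.
pose d := Num.min 1 (g / den); have d0 : 0 < d by rewrite lt_min ltr01 divr_gt0.
have d1 : d <= 1 by rewrite ge_min lexx.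
have dg : d * den <= g by rewrite -ler_pdivlMr // ge_min lexx orbT.
exists (F + d), (`|t| + d); split; rewrite ?ltrDl //.
have : K * d * d <= K * d by rewrite ler_piMr // mulr_ge0 // ltW.
have -> : K * (F + d) * (`|t| + d) =
  K * F * `|t| + d * (K * `|t| + K * F) + K * d * d by ring.
have : d * den = 2 * d * (K * `|t| + K * F + K + 1) by rewrite /den; ring.
have Kt : 0 <= K * `|t| + K * F by rewrite addr_ge0 // mulr_ge0.
move: dg; rewrite /g; nra.
Qed.

(** The solution of [y' = K y^2], [y(0) = F], run in both directions of time. *)
Definition growth F t : R := F / (1 - K * F * `|t|).

Lemma growth_le F t T : 0 <= F -> `|t| <= T -> K * F * T < 1 ->
  K * F * `|t| < 1 /\ growth F t <= growth F T.
Proof.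
move=> F0 tT h; have K0 := Kc_ge0.
have T0 : 0 <= T by exact: le_trans tT.
have h1 : K * F * `|t| <= K * F * T by apply: ler_wpM2l => //; exact: mulr_ge0.
split; first exact: le_lt_trans h1 h.
rewrite /growth (ger0_norm T0) ler_wpM2l // lef_pV2 ?posrE ?subr_gt0 //; lra.
Qed.

Lemma growth_ge0 F t : 0 <= F -> K * F * `|t| < 1 -> 0 <= growth F t.
Proof. by move=> F0 h; rewrite divr_ge0 // subr_ge0 ltW. Qed.

(** The comparison [riccati], applied to the squared norm of the truncated solution,
    whose derivative is bounded by [sobolev_T3]. *)
Lemma galerkin_growth N F F' c0 (c : R -> int -> R[i]) t :
  0 <= F -> F < F' -> hbd s c0 F -> (forall k, k \in Zr N -> c 0 k = c0 k) ->
  (forall t, hermitian (c t)) -> (forall t k, k \notin Zr N -> c t k = 0) ->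
  (forall t k, k \in Zr N -> cderiv (c^~ k) t (mi R k * bq S N (c t) (c t) (- k))) ->
  K * F' * `|t| < 1 -> hbd s (c t) (growth F' t).
Proof.
move=> F0 FF hc0 ci hc cout dc KF; have F'0 : 0 < F' by exact: le_lt_trans FF.
pose E t := \sum_(k <- Zr N) ab k `^ (2 * s) * nc (c t k) ^+ 2.
have Eh x : hbd s (c x) (Num.sqrt (E x)).
  have E0 : 0 <= E x by apply: sumr_ge0 => k _; rewrite mulr_ge0 ?powR_ge0 ?sqr_ge0.
  rewrite /hbd sqr_sqrtr //.
  apply: sumle_mono (sumle_restrict N (x := fun k => ab k `^ (2 * s) * nc (c x k) ^+ 2) _).
    move=> k; rewrite exprMn powRsq //; case: ifP => // /negbT kN.
    by rewrite cout // Normc.normc0 expr0n mulr0.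
  by move=> k; rewrite mulr_ge0 ?powR_ge0 ?sqr_ge0.
have E0 : E 0 < F' ^+ 2.
  apply: (@le_lt_trans _ _ (F ^+ 2)); last by rewrite ltr_sqr ?nnegrE // ltW.
  apply: le_trans (hc0 _ (uniq_Zr N)); rewrite /E !big_seq; apply: ler_sum => k kN.
  by rewrite ci // exprMn powRsq.
have dE x := @energy_deriv R (Zr N) (fun k => ab k `^ (2 * s)) c x _ (dc x).
have := @riccati R E _ K F' `|t| Kc_ge0 F'0 (fun x => _) E0 (fun x _ => dE x) _ t (lexx _) KF.
move=> H; rewrite /hbd; apply: sumle_le (Eh t) _.
rewrite ler_sqr ?nnegrE ?sqrtr_ge0 ?growth_ge0 ?(ltW F'0) //; apply: H.
- by move=> x; apply: sumr_ge0 => k _; rewrite mulr_ge0 ?powR_ge0 ?sqr_ge0.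
- move=> x _; have := sobolev_T3 adm N (sqrtr_ge0 (E x)) (hc x) (Eh x).
  exact.
Qed.

Lemma hbd_lim (a : nat -> int -> R[i]) c B : 0 <= B -> (forall n : nat, hbd s (a n) B) ->
  (forall k e, 0 < e -> exists N, forall M, (N <= M)%N -> nc (a M k - c k) <= e) ->
  hbd s c B.
Proof.
move=> B0 ha hl r ur; apply/ler_addgt0Pr => e e0.
(* pass to the limit in the finite sum, one index at a time *)
have lim1 k d : 0 < d -> exists N, forall M, (N <= M)%N ->
    (ab k `^ s * nc (c k)) ^+ 2 <= (ab k `^ s * nc (a M k)) ^+ 2 + d.
  move=> d0; set p := ab k `^ s; have p0 : 0 <= p by exact: powR_ge0.
  have pa M : p * nc (a M k) <= B.
    by have := sumle_term k (ha M); rewrite -/p ler_sqr ?nnegrE ?mulr_ge0 ?nc_ge0.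
  have den : 0 < 2 * B * p + p + p ^+ 2 + 1.
    by rewrite ltr_wpDl // !addr_ge0 ?sqr_ge0 // !mulr_ge0.
  pose q := Num.min 1 (d / (2 * B * p + p + p ^+ 2 + 1)).
  have q0 : 0 < q by rewrite lt_min ltr01 divr_gt0.
  have q1 : q <= 1 by rewrite ge_min lexx.
  have qd : q * (2 * B * p + p + p ^+ 2 + 1) <= d.
    by rewrite -ler_pdivlMr // ge_min lexx orbT.
  have [N hN] := hl k q q0; exists N => M /hN h.
  have h2 : nc (c k) <= nc (a M k) + q.
    by rewrite -{1}[c k](subKr (a M k)); apply: le_trans (ncB _ _) _; lra.
  have h3 : p * nc (c k) <= p * nc (a M k) + p * q by rewrite -mulrDr ler_wpM2l.
  have := pa M; set x := p * nc (a M k) in h3 * => xB.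
  have x0 : 0 <= x by rewrite mulr_ge0 ?nc_ge0.
  have y0 : 0 <= p * nc (c k) by rewrite mulr_ge0 ?nc_ge0.
  have pq0 : 0 <= p * q by rewrite mulr_ge0 // ltW.
  apply: (@le_trans _ _ ((x + p * q) ^+ 2)).
    by rewrite ler_sqr // nnegrE addr_ge0.
  have : x * (p * q) <= B * (p * q) by rewrite ler_wpM2r.
  have : (p * q) * (p * q) <= p * (p * q).
    by rewrite ler_wpM2r // ler_piMr.
  rewrite sqrrD; have := ltW q0; nra.
have lim d : 0 < d -> exists N, forall M, (N <= M)%N ->
    \sum_(k <- r) (ab k `^ s * nc (c k)) ^+ 2 <=
    \sum_(k <- r) (ab k `^ s * nc (a M k)) ^+ 2 + (size r)%:R * d.
  move=> d0; elim: {ur} r => [|k r [N hN]].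
    by exists 0%N => M _; rewrite !big_nil mul0r addr0.
  have [N' hN'] := lim1 k d d0; exists (maxn N N') => M; rewrite geq_max => /andP[h h'].
  rewrite !big_cons /= -natr1 mulrDl mul1r.
  have := hN M h; have := hN' M h'; lra.
have d0 : 0 < e / ((size r)%:R + 1) by rewrite divr_gt0 // ltr_wpDl.
have [N /(_ N (leqnn _)) hN] := lim _ d0; apply: le_trans hN _; apply: lerD; first exact: ha.
rewrite mulrCA ler_piMr ?(ltW e0) // ler_pdivrMr ?ltr_wpDl // mul1r lerDl ler01 //.
Qed.

(** The Galerkin approximations satisfy [galerkin_growth] uniformly in the window. By
    [stability] each of their coefficients is a Cauchy sequence, locally uniformly
    in time, and [derive_lim] carries the equation over to the limit. *)
Theorem seq_exists c0 F : 0 <= F -> hermitian c0 -> hbd s c0 F ->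
  exists c : R -> int -> R[i], [/\ c 0 = c0,
    forall t, K * F * `|t| < 1 -> hermitian (c t) /\
      forall k, cderiv (c^~ k) t (mi R k * Qc S (c t) k) &
    forall F' t, F < F' -> K * F' * `|t| < 1 -> hbd s (c t) (growth F' t)].
Proof.
move=> F0 hc0 bc0; have C0 := C_ge0 adm.
pose g N := projT1 (cid (galerkin adm N hc0)).
have gP N : [/\ forall k, k \in Zr N -> g N 0 k = c0 k,
    forall t, hermitian (g N t), forall t k, k \notin Zr N -> g N t k = 0 &
    forall t k, k \in Zr N -> cderiv ((g N)^~ k) t (mi R k * bq S N (g N t) (g N t) (- k))].
  exact: (projT2 (cid (galerkin adm N hc0))).
have gbd N F' t : F < F' -> K * F' * `|t| < 1 -> hbd s (g N t) (growth F' t).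
  by move=> FF; have [h1 h2 h3 h4] := gP N; exact: galerkin_growth F0 FF bc0 h1 h2 h3 h4.
have gbdT N F' T t : F < F' -> `|t| <= T -> K * F' * T < 1 -> hbd s (g N t) (growth F' T).
  move=> FF tT h; have F'0 : 0 <= F' by exact: le_trans (ltW FF).
  have [h1 h2] := growth_le F'0 tT h.
  by apply: hbd_le h2 (gbd _ _ _ FF h1); exact: growth_ge0.
(* uniformly on compact time intervals, each coefficient is a Cauchy sequence *)
have cau F' T k e : F < F' -> 0 <= T -> K * F' * T < 1 -> 0 < e ->
    exists N, forall M M', (N <= M)%N -> (N <= M')%N -> forall t, `|t| <= T ->
      nc (g M t k - g M' t k) <= e.
  move=> FF T0 h e0; have F'0 : 0 <= F' by exact: le_trans (ltW FF).
  set B := growth F' T; have B0 : 0 <= B by rewrite growth_ge0 // (ger0_norm T0).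
  have [kap kap0 stab] := stability adm B0 T0.
  have den : 0 < ab k * kap + 1 :> R by rewrite ltr_wpDl // mulr_ge0.
  pose d := (e / 2) ^+ 2 / (ab k * kap + 1).
  have d0 : 0 < d by rewrite divr_gt0 // exprn_gt0 // divr_gt0.
  have [N0 hN0] := Qc_approx adm B0 (divr_gt0 d0 (ltr0Sn R 1)).
  pose N := maxn N0 `|k|%N.
  have close M t : (N <= M)%N -> `|t| <= T -> nc (g N t k - g M t k) <= e / 2.
    move=> NM tT; have N0N : (N0 <= N)%N by exact: leq_maxl.
    pose ev t k := bq S M (g M t) (g M t) (- k) - bq S N (g M t) (g M t) (- k).
    have sq : nc (g N t k - g M t k) ^+ 2 <= ab k * (kap * d).
      apply: (stab N d (g N) (g M) (fun _ _ => 0) ev (ltW d0)) => //.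
      - by move=> x xT; have [_ ? _ _] := gP N; have [_ ? _ _] := gP M; split=> //;
          exact: gbdT xT h.
      - move=> j jN; have [-> // _ _ _] := gP N; have [h1 _ _ _] := gP M.
        by rewrite h1 //; move: jN; rewrite !mem_Zr => jN; exact: leq_trans jN NM.
      - move=> x j xT jN; rewrite addr0 /ev subrKC; split; first by have [_ _ _] := gP N; apply.
        have [_ _ _] := gP M; apply; move: jN; rewrite !mem_Zr => /leq_trans; exact.
      - move=> x j xT jN; rewrite Normc.normc0 (ltW d0); split => //.
        have gx := gbdT M F' T x FF xT h; have [_ hM _ _] := gP M.
        have a1 := hN0 N N0N _ (hM x).1 gx j.
        have a2 := hN0 M (leq_trans N0N NM) _ (hM x).1 gx j.
        rewrite /ev; set q1 := bq S M _ _ _ in a2 *; set q2 := bq S N _ _ _ in a1 *.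
        rewrite -(subrKA (Qc S (g M x) j)); apply: le_trans (ncD _ _) _.
        rewrite -normcN opprB in a2; lra.
      - by rewrite mem_Zr leq_maxr.
    rewrite -ler_sqr ?nnegrE ?nc_ge0 ?divr_ge0 ?(ltW e0) //; apply: le_trans sq _.
    rewrite /d [leLHS](_ : _ = (e / 2) ^+ 2 * ((ab k * kap) / (ab k * kap + 1))).
      by rewrite ler_piMr ?sqr_ge0 // ler_pdivrMr // mul1r lerDl.
    by field; rewrite gt_eqF.
  exists N => M M' NM NM' t tT; rewrite -(subrKA (g N t k)).
  apply: le_trans (ncD _ _) _; rewrite -(normcN (g M t k - _)) opprB.
  by have := close M t NM tT; have := close M' t NM' tT; lra.
have cau1 t k : K * F * `|t| < 1 -> forall e, 0 < e -> exists N, forall M M',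
    (N <= M)%N -> (N <= M')%N -> nc (g M t k - g M' t k) <= e.
  move=> h e e0; have [F' [T [FF tT h']]] := room F0 h.
  have [N hN] := cau F' T k e FF (ltW (le_lt_trans (normr_ge0 t) tT)) h' e0.
  by exists N => M M' NM NM'; apply: hN => //; exact: ltW.
pose c t k : R[i] := if pselect (K * F * `|t| < 1) is left h
  then projT1 (cid (cauchy_lim_complex (cau1 t k h))) else 0.
have cP t k : K * F * `|t| < 1 -> forall e N,
    (forall M M', (N <= M)%N -> (N <= M')%N -> nc (g M t k - g M' t k) <= e) ->
    forall M, (N <= M)%N -> nc (g M t k - c t k) <= 2 * e.
  rewrite /c; case: pselect => // h _.
  exact: (projT2 (cid (cauchy_lim_complex (cau1 t k h)))).
have conv F' T k e : F < F' -> 0 <= T -> K * F' * T < 1 -> 0 < e ->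
    exists N, forall M, (N <= M)%N -> forall t, `|t| <= T -> nc (g M t k - c t k) <= e.
  move=> FF T0 h e0; have F'0 : 0 <= F' by exact: le_trans (ltW FF).
  have [N hN] := cau F' T k _ FF T0 h (divr_gt0 e0 (ltr0Sn R 1)).
  exists N => M NM t tT; have [h1 _] := growth_le F'0 tT h.
  have h2 : K * F * `|t| < 1.
    by apply: le_lt_trans h1; rewrite ler_wpM2r // ler_wpM2l ?Kc_ge0 // ltW.
  rewrite -[e](divfK (_ : 2 != 0)) // mulrC; apply: (cP t k h2 _ N) => //.
  by move=> M1 M2 n1 n2; exact: hN.
have conv1 t k e : K * F * `|t| < 1 -> 0 < e ->
    exists N, forall M, (N <= M)%N -> nc (g M t k - c t k) <= e.
  move=> h e0; have [F' [T [FF tT h']]] := room F0 h.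
  have [N hN] := conv F' T k e FF (ltW (le_lt_trans (normr_ge0 t) tT)) h' e0.
  by exists N => M NM; apply: hN => //; exact: ltW.
have hherm t : K * F * `|t| < 1 -> hermitian (c t).
  move=> h; split=> [|k].
    apply: complex_eq_eps => e e0; have [N /(_ N (leqnn _))] := conv1 t 0 e h e0.
    by have [_ hN _ _] := gP N; rewrite (hN t).1 sub0r subr0 normcN.
  apply: complex_eq_eps => e e0; have e2 := divr_gt0 e0 (ltr0Sn R 1).
  have [N1 h1] := conv1 t k _ h e2; have [N2 h2] := conv1 t (- k) _ h e2.
  pose M := maxn N1 N2; have [_ hM _ _] := gP M.
  have := h1 M (leq_maxl _ _); have := h2 M (leq_maxr _ _).
  rewrite (hM t).2 -(ncJ (g M t k - _)) rmorphB /= => i1 i2.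
  rewrite -(subrKA ((g M t k)^*)%C); apply: le_trans (ncD _ _) _.
  by rewrite -(normcN (c t (- k) - _)) opprB; lra.
have hbdc F' t : F < F' -> K * F' * `|t| < 1 -> hbd s (c t) (growth F' t).
  move=> FF h; have F'0 : 0 <= F' by exact: le_trans (ltW FF).
  refine (@hbd_lim (fun n : nat => g n t) (c t) (growth F' t) _ _ _).
  - exact: growth_ge0.
  - by move=> n; exact: gbd.
  move=> k e e0; apply: conv1 => //; apply: le_lt_trans h.
  by rewrite ler_wpM2r // ler_wpM2l ?Kc_ge0 // ltW.
exists c; split=> //.
  apply/funext => k; apply: complex_eq_eps => e e0.
  have [|N hN] := @conv1 0 k e _ e0; first by rewrite normr0 mulr0 ltr01.
  pose M := maxn N `|k|%N; have := hN M (leq_maxl _ _).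
  have [h1 _ _ _] := gP M; rewrite h1; first by rewrite -normcN opprB.
  by rewrite mem_Zr leq_maxr.
move=> t0 h0; split=> [|k]; first exact: hherm.
have [F' [T [FF tT h]]] := room F0 h0.
have T0 : 0 <= T by exact: ltW (le_lt_trans (normr_ge0 t0) tT).
have F'0 : 0 <= F' by exact: le_trans (ltW FF).
set B := growth F' T; have B0 : 0 <= B by rewrite growth_ge0 // (ger0_norm T0).
have hT t : `|t| <= T -> K * F * `|t| < 1 /\ hbd s (c t) B.
  move=> tT'; have [h1 h2] := growth_le F'0 tT' h; split.
    by apply: le_lt_trans h1; rewrite ler_wpM2r // ler_wpM2l ?Kc_ge0 // ltW.
  by apply: hbd_le h2 (hbdc _ _ FF h1); exact: growth_ge0.
(* the right-hand sides converge uniformly as well *)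
have rhs e : 0 < e -> exists N, forall M, (N <= M)%N -> forall t, `|t| < T ->
    nc (mi R k * bq S M (g M t) (g M t) (- k) - mi R k * Qc S (c t) k) <= e.
  move=> e0; have den : 0 < ab k + 1 :> R by rewrite ltr_wpDl.
  pose d := e / (ab k + 1) / 4.
  have d0 : 0 < d by rewrite !divr_gt0.
  have [P hP] := Qc_approx adm B0 d0.
  pose W := C * (2 * B) * (size (Zr P))%:R + 1.
  have CB0 : 0 <= C * (2 * B) by apply: mulr_ge0 => //; apply: mulr_ge0.
  have W0 : 0 < W by apply: ltr_wpDl => //; apply: mulr_ge0.
  have unif (r : seq int) : exists N, forall M, (N <= M)%N -> forall t, `|t| <= T ->
      \sum_(j <- r) nc (g M t j - c t j) <= (size r)%:R * (d / W).
    elim: r => [|j r [N hN]]; first by exists 0%N => M _ t _; rewrite big_nil mul0r.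
    have [N' hN'] := conv F' T j _ FF T0 h (divr_gt0 d0 W0).
    exists (maxn N N') => M; rewrite geq_max => /andP[m1 m2] t tT'.
    rewrite big_cons /= -natr1 mulrDl mul1r.
    by have := hN M m1 t tT'; have := hN' M m2 t tT'; lra.
  have [N hN] := unif (Zr P).
  exists (maxn P N) => M; rewrite geq_max => /andP[PM NM] t /ltW tT'.
  have [hcF hcB] := hT t tT'; have hc := hherm t hcF.
  have [_ hM _ _] := gP M; have hgM := hM t.
  have gB := gbdT M F' T t FF tT' h.
  rewrite -mulrBr Normc.normcM nc_mi.
  have i1 := hP M PM _ hgM.1 gB k.
  have i2 := hP P (leqnn _) _ hgM.1 gB k.
  have i3 := hP P (leqnn _) _ hc.1 hcB k.
  have i4 := bq_lip adm P (- k) B0 (fun n => hbd_sup n s_ge0 B0 hgM.1 gB)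
    (fun n => hbd_sup n s_ge0 B0 hc.1 hcB).
  have i5 : C * (2 * B) * \sum_(j <- Zr P) nc (g M t j - c t j) <= d.
    apply: le_trans (ler_wpM2l CB0 (hN M NM t tT')) _.
    rewrite [leLHS](_ : _ = d * ((W - 1) / W)); last by rewrite /W; field; rewrite gt_eqF.
    by rewrite ler_piMr ?(ltW d0) // ler_pdivrMr // mul1r gerBl.
  have tot : nc (bq S M (g M t) (g M t) (- k) - Qc S (c t) k) <= 4 * d.
    set q1 := bq S M _ _ _ in i1 *; set q2 := bq S P _ _ _ in i2 i4.
    set q3 := bq S P _ _ _ in i3 i4; set Q1 := Qc S _ _ in i1 i2; set Q2 := Qc S _ _ in i3 *.
    have -> : q1 - Q2 = - (Q1 - q1) + ((Q1 - q2) + ((q2 - q3) - (Q2 - q3))) by ring.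
    apply: le_trans (ncD _ _) _; rewrite normcN.
    have := ncD (Q1 - q2) ((q2 - q3) - (Q2 - q3)); have := ncB (q2 - q3) (Q2 - q3).
    lra.
  apply: le_trans (ler_wpM2l (normr_ge0 _) tot) _.
  rewrite /d [leLHS](_ : _ = e * (ab k / (ab k + 1))); last by field; rewrite gt_eqF.
  by rewrite ler_piMr ?(ltW e0) // ler_pdivrMr // mul1r lerDl.
have dg N t : (`|k|%N <= N)%N -> cderiv ((g N)^~ k) t (mi R k * bq S N (g N t) (g N t) (- k)).
  by move=> kN; have [_ _ _] := gP N; apply; rewrite mem_Zr.
split.
- apply: (@derive_lim R (fun N t => Re (g N t k))
    (fun N t => Re (mi R k * bq S N (g N t) (g N t) (- k)))
    (fun t => Re (c t k)) (fun t => Re (mi R k * Qc S (c t) k)) `|k|%N T) => //.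
  + by move=> N t kN _; have [] := dg N t kN.
  + move=> t /ltW tT' e e0; have [N hN] := conv1 t k e (hT t tT').1 e0; exists N => M NM.
    by rewrite -Re_opp -Re_add; apply: le_trans (Re_le_nc _) _; exact: hN.
  + move=> e e0; have [N hN] := rhs e e0; exists N => M NM t tT'.
    by rewrite -Re_opp -Re_add; apply: le_trans (Re_le_nc _) _; exact: hN.
- apply: (@derive_lim R (fun N t => Im (g N t k))
    (fun N t => Im (mi R k * bq S N (g N t) (g N t) (- k)))
    (fun t => Im (c t k)) (fun t => Im (mi R k * Qc S (c t) k)) `|k|%N T) => //.
  + by move=> N t kN _; have [] := dg N t kN.
  + move=> t /ltW tT' e e0; have [N hN] := conv1 t k e (hT t tT').1 e0; exists N => M NM.
    by rewrite -Im_opp -Im_add; apply: le_trans (Im_le_nc _) _; exact: hN.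
  + move=> e e0; have [N hN] := rhs e e0; exists N => M NM t tT'.
    by rewrite -Im_opp -Im_add; apply: le_trans (Im_le_nc _) _; exact: hN.
Qed.

End Existence.

(** * Strong continuity in time *)

Section Convolution.
Variables (R : realType) (lambda : R) (S : int -> int -> int -> R[i]) (C s Cs : R).
Hypothesis adm : admissible lambda S C s Cs.
Implicit Types (c u v : int -> R[i]) (k m n : int) (N M : nat) (t B e T F : R).
Let hs1 := adm_s1 adm.
Let s_ge0 : 0 <= s.
Proof. by have := hs1; lra. Qed.

Lemma sumle_sqD (f g : int -> R) (A B : R) : 0 <= A -> 0 <= B ->
  sumle (fun k => f k ^+ 2) (A ^+ 2) -> sumle (fun k => g k ^+ 2) (B ^+ 2) ->
  sumle (fun k => (f k + g k) ^+ 2) ((A + B) ^+ 2).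
Proof.
move=> A0 B0 hf hg r ur; have cs := sumle_CS A0 B0 hf hg ur.
have h1 := hf r ur; have h2 := hg r ur.
rewrite (eq_bigr (fun k => f k ^+ 2 + 2 * (f k * g k) + g k ^+ 2)); last by move=> k _; ring.
rewrite !big_split /= -mulr_sumr; nra.
Qed.

(** Cauchy-Schwarz with a summable weight, the step behind Young's inequality for
    convolutions of l^2 with l^1. *)
Lemma sum_weight_CS (r : seq int) (a y : int -> R) (Y : R) : (forall n, 0 <= y n) ->
  \sum_(n <- r) y n <= Y ->
  (\sum_(n <- r) a n * y n) ^+ 2 <= Y * \sum_(n <- r) a n ^+ 2 * y n.
Proof.
move=> y0 hY; have Y0 : 0 <= Y by apply: le_trans hY; exact: sumr_ge0.
set X := \sum_(n <- r) a n ^+ 2 * y n.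
have X0 : 0 <= X by apply: sumr_ge0 => n _; rewrite mulr_ge0 ?sqr_ge0.
have cs b : (b = a \/ b = (fun n => - a n)) ->
    \sum_(n <- r) b n * y n <= Num.sqrt X * Num.sqrt Y.
  move=> hb; rewrite (eq_bigr (fun n => (b n * Num.sqrt (y n)) * Num.sqrt (y n))).
    apply: sum_CS; rewrite ?sqrtr_ge0 // sqr_sqrtr //.
      by apply: ler_sum => n _; case: hb => ->; rewrite exprMn ?sqrrN sqr_sqrtr.
    by under eq_bigr do rewrite sqr_sqrtr //.
  by move=> n _; rewrite -mulrA -expr2 sqr_sqrtr.
have h1 := cs a (or_introl erefl); have := cs _ (or_intror erefl).
under eq_bigr do rewrite mulNr; rewrite sumrN => h2.
have h3 : `|\sum_(n <- r) a n * y n| <= Num.sqrt X * Num.sqrt Y.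
  by rewrite ler_norml; apply/andP; split; lra.
have : `|\sum_(n <- r) a n * y n| ^+ 2 <= (Num.sqrt X * Num.sqrt Y) ^+ 2.
  by rewrite ler_sqr ?nnegrE ?normr_ge0 // mulr_ge0 ?sqrtr_ge0.
by rewrite real_normK ?num_real // exprMn !sqr_sqrtr // mulrC.
Qed.

Lemma young_l M (U y : int -> R) (A Y : R) : 0 <= A -> (forall n, 0 <= y n) ->
  sumle (fun k => U k ^+ 2) (A ^+ 2) -> sumle y Y ->
  sumle (fun k => (\sum_(n <- Zr M) U (k - n) * y n) ^+ 2) ((A * Y) ^+ 2).
Proof.
move=> A0 y0 hU hY r ur; have Y0 := sumle_ge0 hY.
apply: (@le_trans _ _ (\sum_(k <- r) Y * \sum_(n <- Zr M) U (k - n) ^+ 2 * y n)).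
  by apply: ler_sum => k _; apply: sum_weight_CS => //; exact: hY _ (uniq_Zr M).
rewrite -mulr_sumr exchange_big /=.
rewrite [leRHS](_ : _ = Y * (A ^+ 2 * Y)); last by ring.
rewrite ler_wpM2l //.
apply: (@le_trans _ _ (\sum_(n <- Zr M) A ^+ 2 * y n)).
  apply: ler_sum => n _; rewrite -mulr_suml ler_wpM2r //.
  by apply: (sumle_inj (h := fun k => k - n) _ hU ur); exact: addIr.
by rewrite -mulr_sumr ler_wpM2l ?sqr_ge0 //; exact: hY _ (uniq_Zr M).
Qed.

Lemma young_r M (V x : int -> R) (A X : R) : 0 <= A -> (forall n, 0 <= x n) ->
  sumle (fun k => V k ^+ 2) (A ^+ 2) -> sumle x X ->
  sumle (fun k => (\sum_(n <- Zr M) V n * x (k - n)) ^+ 2) ((A * X) ^+ 2).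
Proof.
move=> A0 x0 hV hX r ur; have X0 := sumle_ge0 hX.
apply: (@le_trans _ _ (\sum_(k <- r) X * \sum_(n <- Zr M) V n ^+ 2 * x (k - n))).
  apply: ler_sum => k _; apply: sum_weight_CS => //.
  apply: (sumle_inj (h := fun n => k - n) _ hX (uniq_Zr M)).
  by move=> a b /addrI /oppr_inj.
rewrite -mulr_sumr exchange_big /=.
rewrite [leRHS](_ : _ = X * (A ^+ 2 * X)); last by ring.
rewrite ler_wpM2l //.
apply: (@le_trans _ _ (\sum_(n <- Zr M) V n ^+ 2 * X)).
  apply: ler_sum => n _; rewrite -mulr_sumr ler_wpM2l ?sqr_ge0 //.
  by apply: (sumle_inj (h := fun k => k - n) _ hX ur); exact: addIr.
by rewrite -mulr_suml ler_wpM2r //; exact: hV _ (uniq_Zr M).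
Qed.

Definition conv M u v k : R[i] :=
  \sum_(n <- Zr M) S (- k) (k - n) n * u (k - n) * v n.

Definition algC : R := 2 `^ (s + 1) * C * Mconst s.

Lemma algC_ge0 : 0 <= algC.
Proof. by rewrite !mulr_ge0 ?powR_ge0 ?(C_ge0 adm) ?Mconst_ge0. Qed.

(** [H^s] is an algebra for [s > 1/2]: the weight goes to the larger of the two
    frequencies, and the other factor is summable. *)
Lemma conv_hbd M u v A B : 0 <= A -> 0 <= B -> u 0 = 0 -> v 0 = 0 ->
  hbd s u A -> hbd s v B -> hbd s (conv M u v) (algC * A * B).
Proof.
move=> A0 B0 u0 v0 hu hv; have C0 := C_ge0 adm.
pose U k := ab k `^ s * nc (u k); pose V k := ab k `^ s * nc (v k).
have y1 := young_l M A0 (fun n => nc_ge0 (v n)) hu (hbd_l1 hs1 B0 v0 hv).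
have y2 := young_r M B0 (fun n => nc_ge0 (u n)) hv (hbd_l1 hs1 A0 u0 hu).
have AY0 : 0 <= A * (Mconst s * B) by rewrite !mulr_ge0 ?Mconst_ge0.
have BX0 : 0 <= B * (Mconst s * A) by rewrite !mulr_ge0 ?Mconst_ge0.
have y3 := sumleZ (sqr_ge0 (C * 2 `^ s)) (sumle_sqD AY0 BX0 y1 y2).
apply: (sumle_mono (b := fun k => (C * 2 `^ s) ^+ 2 *
    (\sum_(n <- Zr M) U (k - n) * nc (v n) + \sum_(n <- Zr M) V n * nc (u (k - n))) ^+ 2)).
  move=> k; rewrite -exprMn.
  have p0 : 0 <= C * 2 `^ s by rewrite mulr_ge0 ?powR_ge0.
  have U0 j : 0 <= U j by rewrite mulr_ge0 ?powR_ge0 ?nc_ge0.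
  have V0 j : 0 <= V j by rewrite mulr_ge0 ?powR_ge0 ?nc_ge0.
  rewrite ler_sqr ?nnegrE; last 2 first.
  - by rewrite mulr_ge0 ?powR_ge0 ?nc_ge0.
  - by rewrite mulr_ge0 // addr_ge0 // sumr_ge0 // => n _; rewrite mulr_ge0 ?nc_ge0.
  apply: le_trans (ler_wpM2l (powR_ge0 _ _) (nc_sum _ _ _)) _.
  rewrite -big_split !mulr_sumr; apply: ler_sum => n _ /=.
  rewrite !Normc.normcM.
  have tri : ab k `^ s <= 2 `^ s * (ab (k - n) `^ s + ab n `^ s) :> R.
    have le2 (x y z : R) : 0 <= x -> 0 <= y -> y <= x -> z <= x + y -> 0 <= z ->
        z `^ s <= 2 `^ s * (x `^ s + y `^ s).
      move=> x0 y0 yx zxy z0; apply: (@le_trans _ _ ((2 * x) `^ s)).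
        by apply: ler_powR_base => //; lra.
      by rewrite powRM // ler_wpM2l ?powR_ge0 // lerDl powR_ge0.
    have kk : ab k <= ab (k - n) + ab n :> R.
      have -> : k%:~R = (k - n)%:~R + n%:~R :> R by rewrite -intrD subrK.
      exact: ler_normD.
    have [h|h] := leP (ab n : R) (ab (k - n)); first exact: le2.
    rewrite [_ `^ s + _]addrC; apply: le2 => //; first exact: ltW.
    by rewrite [ab n + _]addrC.
  apply: (@le_trans _ _ ((2 `^ s * (ab (k - n) `^ s + ab n `^ s)) *
      (C * nc (u (k - n)) * nc (v n)))).
    apply: ler_pM => //; first by rewrite !mulr_ge0 ?nc_ge0.
    by rewrite ler_wpM2r ?nc_ge0 // ler_wpM2r ?nc_ge0 //; exact: S_le adm _ _ _.
  by rewrite /U /V le_eqVlt; apply/orP; left; apply/eqP; ring.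
apply: sumle_le y3 _; rewrite -exprMn le_eqVlt; apply/orP; left; apply/eqP; congr (_ ^+ 2).
have -> : algC = 2 `^ s * 2 * C * Mconst s.
  by rewrite /algC powRD ?powRr1 // pnatr_eq0 implybT.
ring.
Qed.

Lemma conv_lim u k A : 0 <= A -> u 0 = 0 -> hbd s u A -> forall e, 0 < e ->
  exists N, forall M, (N <= M)%N -> nc (conv M u u k - Qc S u k) <= e.
Proof.
move=> A0 u0 hu e e0; have T := Qc_terms adm k A0 u0 hu.
have [N hN] := sumle_outside (fun n => nc_ge0 _) T e0.
exists N => M /hN tail; rewrite -normcN opprB.
apply: (sumZC_near (N := M) T) => M' MM; rewrite /conv (sum_Zr_widen _ MM) -sumrB.
apply: le_trans (nc_sum _ _ _) _; apply: le_trans (tail _ (uniq_Zr M')).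
by apply: ler_sum => n _; case: ifP => _; rewrite ?subrr ?Normc.normc0 ?subr0.
Qed.

Lemma Qc_hbd u A : 0 <= A -> u 0 = 0 -> hbd s u A -> hbd s (Qc S u) (algC * A * A).
Proof.
move=> A0 u0 hu; refine (@hbd_lim R s (fun M => conv M u u) _ _ _ _ _).
- by have a0 := algC_ge0; apply: mulr_ge0 => //; apply: mulr_ge0.
- by move=> M; exact: conv_hbd.
- by move=> k; exact: conv_lim A0 u0 hu.
Qed.

Lemma Qc_lip u v B D : 0 <= B -> 0 <= D -> u 0 = 0 -> v 0 = 0 -> hbd s u B -> hbd s v B ->
  hbd s (fun k => u k - v k) D ->
  hbd s (fun k => Qc S u k - Qc S v k) (2 * algC * B * D).
Proof.
move=> B0 D0 u0 v0 hu hv hw; have a0 := algC_ge0.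
refine (@hbd_lim R s (fun M k => conv M (fun k => u k - v k) u k
  + conv M v (fun k => u k - v k) k) _ _ _ _ _).
- by apply: mulr_ge0 => //; apply: mulr_ge0 => //; apply: mulr_ge0.
- move=> M; rewrite (_ : 2 * algC * B * D = algC * D * B + algC * B * D); last by ring.
  by apply: hbdD; do ?[by apply: mulr_ge0 => //; apply: mulr_ge0];
    apply: conv_hbd; rewrite ?u0 ?v0 ?subrr.
move=> k e e0; have e2 := divr_gt0 e0 (ltr0Sn R 1).
have [N1 h1] := conv_lim k B0 u0 hu e2; have [N2 h2] := conv_lim k B0 v0 hv e2.
exists (maxn N1 N2) => M; rewrite geq_max => /andP[/h1 i1 /h2 i2].
have -> : conv M (fun k => u k - v k) u k + conv M v (fun k => u k - v k) k =
    conv M u u k - conv M v v k.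
  rewrite /conv -big_split -sumrB; apply: eq_bigr => n _ /=; ring.
have -> : conv M u u k - conv M v v k - (Qc S u k - Qc S v k) =
  (conv M u u k - Qc S u k) - (conv M v v k - Qc S v k) by ring.
by apply: le_trans (ncB _ _) _; lra.
Qed.

(** The coefficients of [- a(u, u)_x]. *)
Definition rhs c k : R[i] := mi R k * Qc S c k.

(** One derivative costs one power of [|k|]. *)
Lemma hbd_mi u A : hbd s u A -> hbd (s - 1) (fun k => mi R k * u k) A.
Proof.
apply: sumle_mono => k; rewrite Normc.normcM nc_mi.
have [->|k0] := eqVneq k 0; first by rewrite normr0 mul0r mulr0 expr0n sqr_ge0.
by rewrite mulrA -{2}(powRr1 (normr_ge0 k%:~R)) powR_mul ?ab_gt0 // subrK.
Qed.

(** Mean value inequality in the Hilbert space, by pairing with the increment. *)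
Lemma hbd_mean_value sg (c d : R -> int -> R[i]) t h e : 0 <= e -> h != 0 ->
  (forall z, Num.min t (t + h) <= z <= Num.max t (t + h) ->
     (forall k, cderiv (c^~ k) z (d z k)) /\ hbd sg (fun k => d z k - d t k) e) ->
  hbd sg (fun k => (h^-1)%:C%C * (c (t + h) k - c t k) - d t k) e.
Proof.
move=> e0 h0 H r ur.
pose xi k : R[i] := c (t + h) k - c t k - (h%:C)%C * d t k.
pose om k : R := ab k `^ (2 * sg).
pose psi x := \sum_(k <- r) om k *
  (Re (xi k) * (Re (c x k) - x * Re (d t k)) + Im (xi k) * (Im (c x k) - x * Im (d t k))).
pose dpsi x := \sum_(k <- r) om k *
  (Re (xi k) * (Re (d x k) - Re (d t k)) + Im (xi k) * (Im (d x k) - Im (d t k))).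
have [z hz E] : exists2 z, Num.min t (t + h) <= z <= Num.max t (t + h) &
    psi (t + h) - psi t = dpsi z * (t + h - t).
  apply: mean_value => z /H[hd _]; apply: drv_sum => k _; have [h1 h2] := hd k.
  apply: drv_scale; apply: drv_add; apply: drv_scale; apply: drv_sub => //.
    by apply: is_derive_eq (drv_mul (drv_id z) (drv_cst z _)) _; rewrite mulr0 addr0 mul1r.
  by apply: is_derive_eq (drv_mul (drv_id z) (drv_cst z _)) _; rewrite mulr0 addr0 mul1r.
pose X := \sum_(k <- r) (ab k `^ sg * nc (xi k)) ^+ 2.
have X0 : 0 <= X by apply: sumr_ge0 => k _; exact: sqr_ge0.
have EX : psi (t + h) - psi t = X.
  rewrite /psi /X -sumrB; apply: eq_bigr => k _.
  rewrite exprMn powRsq // ncE /om /xi !ReImE /=; ring.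
have [_ hb] := H z hz.
have dle : `|dpsi z| <= Num.sqrt X * e.
  apply: le_trans (ler_norm_sum _ _ _) _.
  apply: (@le_trans _ _ (\sum_(k <- r) (ab k `^ sg * nc (xi k)) *
    (ab k `^ sg * nc (d z k - d t k)))).
    apply: ler_sum => k _.
    have -> : Re (xi k) * (Re (d z k) - Re (d t k)) + Im (xi k) * (Im (d z k) - Im (d t k)) =
        Re ((xi k)^*%C * (d z k - d t k)) by rewrite !ReImE; ring.
    rewrite normrM (ger0_norm (powR_ge0 _ _)) /om -powRsq //.
    have hR := Re_le_nc ((xi k)^*%C * (d z k - d t k)).
    rewrite [leRHS](_ : _ = (ab k `^ sg) ^+ 2 * (nc (xi k) * nc (d z k - d t k))); last by ring.
    by rewrite ler_wpM2l ?sqr_ge0 //; rewrite Normc.normcM ncJ in hR.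
  by apply: sum_CS; rewrite ?sqrtr_ge0 // ?sqr_sqrtr //; exact: hb.
have hX : X <= (`|h| * e) ^+ 2.
  have : X <= Num.sqrt X * e * `|h|.
    rewrite -{1}EX E addrAC subrr add0r; apply: le_trans (ler_norm _) _.
    by rewrite normrM ler_wpM2r.
  rewrite -{1}(sqr_sqrtr X0) -{3}(sqr_sqrtr X0).
  have := sqrtr_ge0 X; set y := Num.sqrt X; move=> y0 hy.
  have he0 : 0 <= `|h| * e by rewrite mulr_ge0.
  rewrite ler_sqr ?nnegrE //; have [->//|yn] := eqVneq y 0.
  have yp : 0 < y by rewrite lt_def yn.
  by rewrite -(ler_pM2l yp); move: hy; rewrite expr2 -mulrA (mulrC e).
have hh : 0 < `|h| by rewrite normr_gt0.
rewrite -(ler_pM2l (exprn_gt0 2 hh)) -exprMn; apply: le_trans hX.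
rewrite /X mulr_sumr; apply: ler_sum => k _; rewrite -exprMn le_eqVlt.
apply/orP; left; apply/eqP; congr (_ ^+ 2); rewrite mulrCA; congr (_ * _).
have -> : `|h| = nc (h%:C)%C by rewrite /= expr0n addr0 sqrtr_sqr.
rewrite -Normc.normcM; congr nc; rewrite /xi mulrBr mulrA.
have -> : (h%:C)%C * (h^-1)%:C%C = 1 by rewrite -rmorphM divff.
by rewrite mul1r.
Qed.

End Convolution.

Section StrongContinuity.
Variables (R : realType) (lambda : R) (S : int -> int -> int -> R[i]) (C s Cs : R).
Hypothesis adm : admissible lambda S C s Cs.
Implicit Types (u v : int -> R[i]) (k m n : int) (N M : nat) (t B e T F : R).
Let hs1 := adm_s1 adm.
Let s_ge0 : 0 <= s.
Proof. by have := hs1; lra. Qed.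
Local Notation K := (Kc lambda C s Cs).
Local Notation growth := (growth lambda C s Cs).
Let K0 : 0 <= K. Proof. exact: Kc_ge0 adm. Qed.

Lemma drv_delta (f : R -> R) t0 d e : is_derive t0 1 f d -> 0 < e ->
  exists2 del, 0 < del & forall t, `|t - t0| < del -> `|f t - f t0| <= e.
Proof.
move=> /drv_cont /cvgrPdist_le /(_ e) h e0; have /nbhs_ballP[del /= d0 hd] := h e0.
exists del => // t tt; rewrite distrC; apply: hd.
by rewrite -ball_normE /ball_ /= distrC.
Qed.

Lemma delta_of_room F t0 : 0 <= F -> K * F * `|t0| < 1 ->
  exists F' del, [/\ F < F', 0 < del &
    forall t, `|t - t0| <= del -> K * F * `|t| < 1 /\
      (K * F' * `|t| < 1 /\ growth F' t <= growth F' (`|t0| + del))].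
Proof.
move=> F0 h; have [F' [T [FF tT h']]] := room adm F0 h.
have F'0 : 0 <= F' by exact: le_trans (ltW FF).
exists F', (T - `|t0|); split=> //; first by rewrite subr_gt0.
move=> t tt; have tT' : `|t| <= T.
  by rewrite -[t](subrK t0); apply: le_trans (ler_normD _ _) _; lra.
have [h1 h2] := growth_le adm F'0 tT' h'.
rewrite subrKC; split=> //; apply: le_lt_trans h1.
by rewrite ler_wpM2r // ler_wpM2l // ltW.
Qed.

Variables (F : R) (c : R -> int -> R[i]).
Hypothesis F0 : 0 <= F.
Hypothesis sol : forall t, K * F * `|t| < 1 -> hermitian (c t) /\
  forall k, cderiv (c^~ k) t (rhs S (c t) k).
Hypothesis bd : forall F' t, F < F' -> K * F' * `|t| < 1 -> hbd s (c t) (growth F' t).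

Lemma cderiv_shift (a : R -> R[i]) t t0 d : cderiv a (t + t0) d ->
  cderiv (fun x => a (x + t0)) t d.
Proof.
by move=> [h1 h2]; split; [exact: drv_shift h1|exact: drv_shift h2].
Qed.

(** Restarting the construction at time [t0] shows that the norm cannot jump up:
    by uniqueness the restarted solution is the original one. *)
Lemma norm_usc t0 A eta : K * F * `|t0| < 1 -> hbd s (c t0) (Num.sqrt A) -> 0 <= A -> 0 < eta ->
  exists2 del, 0 < del & forall t, `|t - t0| < del ->
    K * F * `|t| < 1 /\ hbd s (c t) (Num.sqrt (A + eta)).
Proof.
move=> h0 hA A0 eta0.
have [F' [d1 [FF d10 hd1]]] := delta_of_room F0 h0.
have F'0 : 0 <= F' by exact: le_trans (ltW FF).
have [ct [ct0 ctsol ctbd]] := seq_exists adm (sqrtr_ge0 A) (sol h0).1 hA.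
pose G := Num.sqrt (A + eta / 2); pose H := Num.sqrt (A + eta).
have Ae : 0 < A + eta by lra.
have Ae2 : 0 < A + eta / 2 by lra.
have AG : Num.sqrt A < G by rewrite ltr_sqrt //; lra.
have GH : G < H by rewrite ltr_sqrt //; lra.
have G0 : 0 < G by exact: le_lt_trans (sqrtr_ge0 A) AG.
have H0 : 0 < H by exact: lt_trans GH.
pose th := 1 - G / H.
have th0 : 0 < th by rewrite subr_gt0 ltr_pdivrMr // mul1r.
have den : 0 < K * G + 1 by rewrite ltr_wpDl // mulr_ge0 // ltW.
pose del := Num.min d1 (th / (K * G + 1)).
have del0 : 0 < del by rewrite lt_min d10 divr_gt0.
have small (x : R) : `|x| <= del -> K * G * `|x| <= th.
  move=> xd; have : `|x| * (K * G + 1) <= th.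
    by rewrite -ler_pdivlMr //; apply: le_trans xd _; rewrite ge_min lexx orbT.
  have : 0 <= `|x| by []. rewrite mulrDr mulr1 mulrC; lra.
have th1 : th < 1 by rewrite /th gtrBl divr_gt0.
have KG (x : R) : `|x| <= del -> K * G * `|x| < 1 by move=> /small; lra.
have KA (x : R) : `|x| <= del -> K * Num.sqrt A * `|x| < 1.
  move=> /KG; apply: le_lt_trans; rewrite ler_wpM2r // ler_wpM2l // ltW //.
have gr (x : R) : `|x| <= del -> growth G x <= H.
  move=> xd; have := KG x xd; have := small x xd; rewrite /growth /th => i1 i2.
  rewrite ler_pdivrMr ?subr_gt0 // mulrC -ler_pdivrMr //; lra.
have dd1 : del <= d1 by rewrite ge_min lexx.
exists del => // t tt; have [hF [hF' hg]] := hd1 t (le_trans (ltW tt) dd1).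
split=> //.
pose B := Num.max H (growth F' (`|t0| + d1)).
have B0 : 0 <= B by rewrite le_max (ltW H0).
have near0 (x : R) : `|x| <= del -> `|x + t0 - t0| <= d1.
  by move=> xd; rewrite addrK; apply: le_trans xd _; rewrite ge_min lexx.
have bct (x : R) : `|x| <= del -> hbd s (ct x) H.
  move=> xd; apply: hbd_le (gr x xd) (ctbd _ _ AG (KG x xd)).
  exact: growth_ge0 (ltW G0) (KG x xd).
have eqct : forall (x : R) k, `|x| <= del -> ct x k = c (x + t0) k.
  apply: (@seq_unique _ _ _ _ _ _ adm del B ct (fun x => c (x + t0)) (ltW del0) B0).
  - by move=> x xd; exact: (ctsol x (KA x xd)).
  - move=> x xd; have [h1 _] := hd1 _ (near0 x xd); have [i1 i2] := sol h1.
    by split=> // k; exact: (@cderiv_shift (fun t => c t k) x t0 _ (i2 k)).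
  - by move=> k; rewrite ct0 add0r.
  move=> x xd; split.
    by apply: hbd_le (bct x xd); [exact: ltW|rewrite le_max lexx].
  have [_ [h1 h2]] := hd1 _ (near0 x xd); apply: hbd_le (bd FF h1).
    exact: growth_ge0 F'0 h1.
  by rewrite le_max h2 orbT.
have tt' : `|t - t0| <= del by exact: ltW.
have := bct _ tt'; rewrite /H; congr (hbd s _ _).
by apply/funext => k; rewrite eqct // subrK.
Qed.

Lemma window_delta N t0 e : K * F * `|t0| < 1 -> 0 < e ->
  exists2 del, 0 < del & forall t, `|t - t0| < del ->
   \sum_(k <- Zr N) ab k `^ (2 * s) * nc (c t k - c t0 k) ^+ 2 <= e /\
   \sum_(k <- Zr N) ab k `^ (2 * s) * nc (c t0 k) ^+ 2 - e <=
   \sum_(k <- Zr N) ab k `^ (2 * s) * nc (c t k) ^+ 2.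
Proof.
move=> h0 e0; have [_ dc] := sol h0.
have d1 := @energy_deriv R (Zr N) (fun k => ab k `^ (2 * s)) c t0 _ (fun k _ => dc k).
have dw k : cderiv (fun t => c t k - c t0 k) t0 (rhs S (c t0) k - 0).
  by apply: cderivB => //; split; exact: drv_cst.
have d2 := @energy_deriv R (Zr N) (fun k => ab k `^ (2 * s)) (fun t k => c t k - c t0 k)
  t0 _ (fun k _ => dw k).
have [r1 r10 hr1] := drv_delta d1 e0; have [r2 r20 hr2] := drv_delta d2 e0.
exists (Num.min r1 r2); first by rewrite lt_min r10.
move=> t; rewrite lt_min => /andP[/hr1 i1 /hr2 i2]; split.
  move: i2; rewrite [X in _ - X]big1 ?subr0; last first.
    by move=> k _; rewrite subrr Normc.normc0 expr0n mulr0.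
  by apply: le_trans; exact: ler_norm.
by move: i1; rewrite ler_norml => /andP[]; lra.
Qed.

(** Convergence of the coefficients together with [norm_usc], which prevents the norm
    from exceeding its limit, gives convergence in norm. *)
Lemma strong_cont t0 e : K * F * `|t0| < 1 -> 0 < e ->
  exists2 del, 0 < del & forall t, `|t - t0| < del ->
    K * F * `|t| < 1 /\ hbd s (fun k => c t k - c t0 k) e.
Proof.
move=> h0 e0; have [F' [d1 [FF d10 hd1]]] := delta_of_room F0 h0.
have F'0 : 0 <= F' by exact: le_trans (ltW FF).
have t00 : `|t0 - t0| <= d1 by rewrite subrr normr0 ltW.
have [_ [h1 _]] := hd1 t0 t00.
pose g (u : int -> R[i]) k := (ab k `^ s * nc (u k)) ^+ 2.
have gE (u : int -> R[i]) k : g u k = ab k `^ (2 * s) * nc (u k) ^+ 2 by rewrite /g exprMn powRsq.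
have g0 u k : 0 <= g u k by exact: sqr_ge0.
have [A [hA _ supA]] := sumle_sup (g0 (c t0)) (bd FF h1).
have A0 := sumle_ge0 hA.
pose eta := e ^+ 2 / 9; have eta0 : 0 < eta by rewrite divr_gt0 // exprn_gt0.
have hA' : hbd s (c t0) (Num.sqrt A) by rewrite /hbd sqr_sqrtr.
have [d2 d20 hd2] := norm_usc h0 hA' A0 eta0.
have [N /(_ N (leqnn _)) hN] := supA eta eta0.
have [d3 d30 hd3] := window_delta N h0 eta0.
exists (Num.min d2 d3); first by rewrite lt_min d20.
move=> t; rewrite lt_min => /andP[/hd2[hF hH] /hd3[i1 i2]]; split=> // r ur.
move: hH; rewrite /hbd sqr_sqrtr ?addr_ge0 ?(ltW eta0) // => hH.
(* inside the window by coefficientwise continuity, outside by smallness of the tails *)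
rewrite (bigID (fun k => k \in Zr N)) /=.
have in_ : \sum_(k <- r | k \in Zr N) (ab k `^ s * nc (c t k - c t0 k)) ^+ 2 <= eta.
  rewrite -big_filter; apply: le_trans i1.
  under [leRHS]eq_bigr do rewrite -(gE (fun k => c t k - c t0 k)).
  apply: ler_sum_sub; [by move=> k; exact: g0 (fun k => c t k - c t0 k) k|exact: filter_uniq|].
  by move=> k; rewrite mem_filter => /andP[].
have out (u : int -> R[i]) X : sumle (g u) X ->
    \sum_(k <- r | k \notin Zr N) g u k <= X - \sum_(k <- Zr N) g u k.
  move=> hX; rewrite lerBrDr -big_filter -big_cat; apply: hX.
  rewrite cat_uniq filter_uniq // uniq_Zr andbT andTb; apply/hasPn => k kN.
  by rewrite mem_filter kN.
have o1 := out _ _ hA; have o2 := out _ _ hH.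
have o3 : \sum_(k <- r | k \notin Zr N) (ab k `^ s * nc (c t k - c t0 k)) ^+ 2 <=
    2 * \sum_(k <- r | k \notin Zr N) g (c t) k + 2 * \sum_(k <- r | k \notin Zr N) g (c t0) k.
  rewrite !mulr_sumr -big_split; apply: ler_sum => k _ /=; rewrite /g.
  set p := ab k `^ s; set x := nc (c t k); set y := nc (c t0 k).
  have p0 : 0 <= p by exact: powR_ge0.
  apply: (@le_trans _ _ ((p * x + p * y) ^+ 2)).
    rewrite ler_sqr ?nnegrE ?mulr_ge0 ?addr_ge0 ?mulr_ge0 ?nc_ge0 // -mulrDr.
    by rewrite ler_wpM2l //; exact: ncB.
  by have := sqr_ge0 (p * x - p * y); nra.
have e1 : \sum_(k <- Zr N) ab k `^ (2 * s) * nc (c t0 k) ^+ 2 = \sum_(k <- Zr N) g (c t0) k.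
  by apply: eq_bigr => k _; rewrite gE.
have e2 : \sum_(k <- Zr N) ab k `^ (2 * s) * nc (c t k) ^+ 2 = \sum_(k <- Zr N) g (c t) k.
  by apply: eq_bigr => k _; rewrite gE.
rewrite e1 e2 in i2.
have : e ^+ 2 = 9 * eta by rewrite /eta; field.
by move=> ->; lra.
Qed.

Lemma rhs_cont t0 e : K * F * `|t0| < 1 -> 0 < e ->
  exists2 del, 0 < del & forall t, `|t - t0| < del ->
    K * F * `|t| < 1 /\ hbd (s - 1) (fun k => rhs S (c t) k - rhs S (c t0) k) e.
Proof.
move=> h0 e0; have [F' [d1 [FF d10 hd1]]] := delta_of_room F0 h0.
have F'0 : 0 <= F' by exact: le_trans (ltW FF).
set B := growth F' (`|t0| + d1).
have hB t : `|t - t0| <= d1 -> 0 <= B /\ hbd s (c t) B.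
  move=> /hd1[_ [i1 i2]]; have g0 := growth_ge0 F'0 i1.
  by split; [exact: le_trans i2|exact: hbd_le g0 i2 (bd FF i1)].
have t00 : `|t0 - t0| <= d1 by rewrite subrr normr0 ltW.
have [B0 b0] := hB t0 t00.
have a0 := algC_ge0 adm.
have L0 : 0 <= 2 * algC C s * B by apply: mulr_ge0 => //; apply: mulr_ge0.
have den : 0 < 2 * algC C s * B + 1 by rewrite ltr_wpDl.
have q0 : 0 < e / (2 * algC C s * B + 1) by rewrite divr_gt0.
have [d2 d20 hd2] := strong_cont h0 q0.
exists (Num.min d1 d2); first by rewrite lt_min d10.
move=> t; rewrite lt_min => /andP[/ltW t1 /hd2[hF hD]]; split=> //.
have [_ bt] := hB t t1.
have Q := Qc_lip adm B0 (ltW q0) (sol hF).1.1 (sol h0).1.1 bt b0 hD.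
have -> : (fun k => rhs S (c t) k - rhs S (c t0) k) =
    (fun k => mi R k * (Qc S (c t) k - Qc S (c t0) k)).
  by apply/funext => k; rewrite /rhs mulrBr.
apply: hbd_mi; apply: hbd_le Q; first by apply: mulr_ge0 => //; exact: ltW.
rewrite [leLHS](_ : _ = e * (2 * algC C s * B / (2 * algC C s * B + 1))); last first.
  by field; rewrite gt_eqF.
by rewrite ler_piMr ?(ltW e0) // ler_pdivrMr // mul1r lerDl.
Qed.

Lemma quotient_cont t0 e : K * F * `|t0| < 1 -> 0 < e ->
  exists2 del, 0 < del & forall h, h != 0 -> `|h| < del ->
    hbd (s - 1) (fun k => (h^-1)%:C%C * (c (t0 + h) k - c t0 k) - rhs S (c t0) k) e.
Proof.
move=> h0 e0; have [del del0 hd] := rhs_cont h0 e0; exists del => // h hn hdel.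
apply: (@hbd_mean_value _ _ c (fun t => rhs S (c t)) t0 h e (ltW e0) hn) => z hz.
have zd : `|z - t0| < del.
  apply: le_lt_trans hdel; apply: (@ball_between _ `|h| 0 h); rewrite ?normr0 //.
  move: hz; rewrite !ge_min !le_max => /andP[h1 h2]; apply/andP; split.
    by case/orP: h1 => ?; apply/orP; [left|right]; lra.
  by case/orP: h2 => ?; apply/orP; [left|right]; lra.
have [hF hb] := hd z zd; split=> //; exact: (sol hF).2.
Qed.

End StrongContinuity.

(** * Integration over one period *)

Section Period.
Variable R : realType.
Implicit Types (f g phi : R -> R) (x : R).

Local Notation mu := (@lebesgue_measure R).
Local Notation D := (`[0, 2 * pi]%classic : set (measurableTypeR R)).

Definition intg f := mu.-integrable D (EFin \o f).
Definition integ f : R := \int[mu]_(x in D) f x.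

Lemma measD : measurable D. Proof. exact: measurable_itv. Qed.

Lemma pi2_gt0 : 0 < 2 * pi :> R.
Proof. by rewrite mulr_gt0 // pi_gt0. Qed.

Lemma muD : mu D = (2 * pi)%:E.
Proof. by rewrite lebesgue_measure_itv /= lte_fin pi2_gt0 -EFinD subr0. Qed.

Lemma cont_intg f : continuous f -> intg f.
Proof.
move=> cf; apply: continuous_compact_integrable; first exact: segment_compact.
exact: continuous_subspaceT.
Qed.

Lemma intgD f g : intg f -> intg g -> intg (fun x => f x + g x).
Proof. by move=> hf hg; have := integrableD measD hf hg; apply: eq_integrable => //. Qed.

Lemma intgB f g : intg f -> intg g -> intg (fun x => f x - g x).
Proof. by move=> hf hg; have := integrableB measD hf hg; apply: eq_integrable => //. Qed.

Lemma intgZ a f : intg f -> intg (fun x => a * f x).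
Proof. by move=> hf; have := integrableZl measD a hf; apply: eq_integrable => //. Qed.

Lemma cont_bounded f : continuous f -> exists2 M, 0 <= M & forall x, D x -> `|f x| <= M.
Proof.
move=> cf; have cn : {within `[0, 2 * pi], continuous (fun x => `|f x|)}.
  apply: continuous_subspaceT => x; apply: (@continuous_comp _ _ _ f Num.norm); first exact: cf.
  exact: norm_continuous.
have [z _ hz] := EVT_max (ltW pi2_gt0) cn.
by exists `|f z| => // x /hz.
Qed.

Lemma cont_meas f : continuous f -> measurable_fun D f.
Proof. by move=> cf; apply: measurable_funTS; exact: continuous_measurable_fun. Qed.

Lemma intgM g phi : intg g -> continuous phi -> intg (fun x => g x * phi x).
Proof.
move=> hg cp; have [M M0 hM] := cont_bounded cp.
have := integrableMl measD hg (cont_meas cp) _; apply.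
exists M; split; first by rewrite realE M0.
by move=> y My x Dx /=; apply: le_trans (hM x Dx) (ltW My).
Qed.

Lemma integD f g : intg f -> intg g -> integ (fun x => f x + g x) = integ f + integ g.
Proof. exact: RintegralD measD. Qed.

Lemma integB f g : intg f -> intg g -> integ (fun x => f x - g x) = integ f - integ g.
Proof. exact: RintegralB measD. Qed.

Lemma integZ a f : intg f -> integ (fun x => a * f x) = a * integ f.
Proof. exact: RintegralZl measD. Qed.

Lemma eq_integ f g : (forall x, D x -> f x = g x) -> integ f = integ g.
Proof. by move=> fg; apply: eq_Rintegral => x; rewrite inE; exact: fg. Qed.

Lemma integ_sum (r : seq int) (F : int -> R -> R) : (forall k, intg (F k)) ->
  intg (fun x => \sum_(k <- r) F k x) /\
  integ (fun x => \sum_(k <- r) F k x) = \sum_(k <- r) integ (F k).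
Proof.
move=> hF; elim: r => [|k r [IH1 IH2]].
  have -> : (fun x => \sum_(k <- [::]) F k x) = (fun=> 0).
    by apply/funext => x; rewrite big_nil.
  rewrite big_nil /integ (Rintegral_cst _ measD) mul0r.
  by split=> //; apply: cont_intg; exact: cst_continuous.
have -> : (fun x => \sum_(j <- k :: r) F j x) = (fun x => F k x + \sum_(j <- r) F j x).
  by apply/funext => x; rewrite big_cons.
by rewrite big_cons -IH2 integD //; split=> //; exact: intgD.
Qed.

Lemma intg_norm f : intg f -> intg (fun x => `|f x|).
Proof. by move=> hf; have := integrable_abse hf; apply: eq_integrable => //; exact: measD. Qed.

Lemma integ_le f g : intg f -> intg g -> (forall x, D x -> f x <= g x) -> integ f <= integ g.
Proof. by move=> hf hg; exact: (le_Rintegral measD hf hg). Qed.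

Lemma integ_cst a : integ (fun=> a) = a * (2 * pi).
Proof. rewrite /integ (Rintegral_cst _ measD) [X in fine X](_ : _ = (2 * pi)%:E) //; exact: muD. Qed.

Lemma norm_integ_le g phi M : intg g -> continuous phi -> (forall x, D x -> `|phi x| <= M) ->
  `|integ (fun x => g x * phi x)| <= M * integ (fun x => `|g x|).
Proof.
move=> hg cp hM; have hgp := intgM hg cp.
apply: le_trans (le_normr_Rintegral measD hgp) _.
rewrite -integZ; last exact: intg_norm.
apply: integ_le; [exact: intg_norm hgp|by apply: intgZ; exact: intg_norm|].
by move=> x Dx; rewrite normrM mulrC ler_wpM2r // hM.
Qed.

Lemma integ_deriv (F f : R -> R) : (forall x, is_derive x 1 F (f x)) -> continuous f ->
  integ f = F (2 * pi) - F 0.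
Proof.
move=> dF cf; rewrite /integ /Rintegral (@continuous_FTC2 _ f F) //=.
- exact: pi2_gt0.
- exact: continuous_subspaceT.
- have cF x : {for x, continuous F} by exact: drv_cont (dF x).
  split; first by move=> x _; have [] := dF x.
  + by apply: cvg_at_right_filter; exact: cF.
  + by apply: cvg_at_left_filter; exact: cF.
- by move=> x _; rewrite derive1E; have [] := dF x.
Qed.

End Period.

(** * Trigonometric functions *)

Section Trigonometric.
Variable R : realType.
Implicit Types (f g phi : R -> R) (x : R) (k j m : int).

Definition ck k x : R := cos (k%:~R * x).
Definition sk k x : R := sin (k%:~R * x).

Lemma drv_ck k x : is_derive x 1 (ck k) (- (k%:~R * sk k x)).
Proof.
have := drv_comp (is_derive_cos (k%:~R * x)) (drv_scale k%:~R (drv_id x)).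
by move=> h; apply: is_derive_eq h _; rewrite /sk; ring.
Qed.

Lemma drv_sk k x : is_derive x 1 (sk k) (k%:~R * ck k x).
Proof.
have := drv_comp (is_derive_sin (k%:~R * x)) (drv_scale k%:~R (drv_id x)).
by move=> h; apply: is_derive_eq h _; rewrite /ck; ring.
Qed.

Lemma cont_ck k : continuous (ck k : R -> R).
Proof. by move=> x; exact: drv_cont (drv_ck k x). Qed.

Lemma cont_sk k : continuous (sk k : R -> R).
Proof. by move=> x; exact: drv_cont (drv_sk k x). Qed.

Lemma per_nat (f : R -> R) (T : R) (n : nat) x : periodic f T -> f (x + n%:R * T) = f x.
Proof.
move=> hf; elim: n => [|n IH]; first by rewrite mul0r addr0.
by rewrite -natr1 mulrDl mul1r addrA hf IH.
Qed.

Lemma per_int (f : R -> R) (T : R) k x : periodic f T -> f (x + k%:~R * T) = f x.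
Proof.
move=> hf; case: k => n; first exact: per_nat.
by rewrite NegzE mulrNz -(per_nat n.+1 _ hf) mulNr subrK.
Qed.

Lemma per_ck k : periodic (ck k : R -> R) (2 * pi).
Proof.
have hp : periodic (@cos R) (2 * pi) by move=> y; rewrite mulr_natl cosD2pi.
by move=> x; rewrite /ck mulrDr; exact: per_int.
Qed.

Lemma per_sk k : periodic (sk k : R -> R) (2 * pi).
Proof.
have hp : periodic (@sin R) (2 * pi) by move=> y; rewrite mulr_natl sinD2pi.
by move=> x; rewrite /sk mulrDr; exact: per_int.
Qed.

Lemma integ_ck k : integ (ck k : R -> R) = if k == 0 then 2 * pi else 0.
Proof.
case: eqP => [->|/eqP k0].
  rewrite -[RHS]mul1r -integ_cst; apply: eq_integ => x _.
  by rewrite /ck mul0r cos0.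
have kR : k%:~R != 0 :> R by rewrite intr_eq0.
have d x : is_derive x 1 (fun x => (k%:~R)^-1 * sk k x) (ck k x).
  by apply: is_derive_eq (drv_scale _ (drv_sk k x)) _; rewrite mulKf.
rewrite (integ_deriv d (@cont_ck k)).
by have := per_sk k 0; rewrite add0r => ->; rewrite subrr.
Qed.

Lemma integ_sk k : integ (sk k : R -> R) = 0.
Proof.
have [->|k0] := eqVneq k 0.
  rewrite -[RHS](mul0r (2 * pi)) -integ_cst; apply: eq_integ => x _.
  by rewrite /sk mul0r sin0.
have kR : k%:~R != 0 :> R by rewrite intr_eq0.
have d x : is_derive x 1 (fun x => - ((k%:~R)^-1 * ck k x)) (sk k x).
  apply: is_derive_eq (drv_opp (drv_scale _ (drv_ck k x))) _.
  by rewrite mulrN opprK mulKf.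
rewrite (integ_deriv d (@cont_sk k)).
by have := per_ck k 0; rewrite add0r => ->; rewrite subrr.
Qed.

Lemma ck_mul j k x : ck j x * ck k x = 2^-1 * (ck (j - k) x + ck (j + k) x).
Proof.
rewrite /ck intrD intrD rmorphN /= !mulrDl mulNr cosB cosD; lra.
Qed.

Lemma sk_ck_mul j k x : sk j x * ck k x = 2^-1 * (sk (j + k) x + sk (j - k) x).
Proof.
rewrite /sk /ck intrD intrD rmorphN /= !mulrDl mulNr sinB sinD; lra.
Qed.

Lemma sk_mul j k x : sk j x * sk k x = 2^-1 * (ck (j - k) x - ck (j + k) x).
Proof.
rewrite /sk /ck intrD intrD rmorphN /= !mulrDl mulNr cosB cosD; lra.
Qed.

Lemma ck_le1 k x : `|ck k x| <= 1.
Proof. by rewrite ler_norml cos_geN1 cos_le1. Qed.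

Lemma sk_le1 k x : `|sk k x| <= 1.
Proof. by rewrite ler_norml sin_geN1 sin_le1. Qed.

(** * Test functions and periodic distributions *)

Lemma testfun_deriv phi : testfun phi ->
  testfun (phi^`())%classic /\ forall x, is_derive x 1 phi ((phi^`())%classic x).
Proof.
move=> [per dp]; have d0 x : is_derive x 1 phi ((phi^`())%classic x).
  by have := dp 0%N x; rewrite derive1n0 => h; split=> //; rewrite derive1E.
split=> //; split=> [x|n x]; last by have := dp n.+1 x; rewrite derive1Sn.
rewrite !derive1E.
have h : is_derive x 1 (fun y => phi (y + 2 * pi)) ((phi^`())%classic (x + 2 * pi)).
  exact: drv_shift (d0 (x + 2 * pi)).
have : (fun y => phi (y + 2 * pi)) = phi by apply/funext => y; rewrite per.
move=> E; rewrite E in h; have [_ e1] := h; have [_ e2] := d0 x.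
by rewrite -derive1E -e1 -derive1E.
Qed.

Lemma testfun_cont phi : testfun phi -> continuous phi.
Proof. by move=> /testfun_deriv[_ d] x; exact: drv_cont (d x). Qed.

Lemma testfun_trig k (a b : R) : testfun (fun x => a * ck k x + b * sk k x).
Proof.
have D (p q : R) x : is_derive x 1 (fun x => p * ck k x + q * sk k x)
    ((q * k%:~R) * ck k x + (- (p * k%:~R)) * sk k x).
  apply: is_derive_eq (drv_add (drv_scale p (drv_ck k x)) (drv_scale q (drv_sk k x))) _.
  by ring.
split=> [x|n x]; first by rewrite per_ck per_sk.
have [a' [b' ->]] : exists a' b', ((fun x => a * ck k x + b * sk k x)^`(n))%classic =
    (fun x => a' * ck k x + b' * sk k x).
  elim: n => [|n [a' [b' IH]]]; first by exists a, b.
  exists (b' * k%:~R), (- (a' * k%:~R)).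
  by rewrite derive1nS IH; apply/funext => y; rewrite derive1E; have [] := D a' b' y.
by have [] := D a' b' x.
Qed.

Lemma testfun_ck k : testfun (ck k : R -> R).
Proof.
have := testfun_trig k 1 0; rewrite (_ : (fun x => _) = ck k) //.
by apply/funext => x; ring.
Qed.

Lemma testfun_sk k : testfun (sk k : R -> R).
Proof.
have := testfun_trig k 0 1; rewrite (_ : (fun x => _) = sk k) //.
by apply/funext => x; ring.
Qed.

Lemma distr_of_is_distr g : circle_fun g -> is_distr (distr_of g).
Proof.
move=> [_ hg]; split=> [a phi psi /testfun_cont c1 /testfun_cont c2|].
  have i1 := intgM hg c1; have i2 := intgM hg c2.
  rewrite -[LHS]/(integ _) -[distr_of g phi]/(integ _) -[distr_of g psi]/(integ _).
  rewrite -integZ // -integD //; last exact: intgZ.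
  by apply: eq_integ => x _; ring.
exists 0%N, (integ (fun x => `|g x|)) => phi M tp hM; rewrite mulrC.
apply: norm_integ_le => //; first exact: testfun_cont.
by move=> x _; exact: hM 0%N x isT.
Qed.

Lemma distr_scale (T : (R -> R) -> R) a phi : is_distr T -> testfun phi ->
  T (fun x => a * phi x) = a * T phi.
Proof.
move=> [lin _] tp.
have t0 : testfun (fun=> 0 : R).
  have := testfun_trig 0 0 0; rewrite (_ : (fun x => _) = (fun=> 0)) //.
  by apply/funext => x; rewrite !mul0r addr0.
have T0 : T (fun=> 0) = 0.
  have := lin (- 1) _ _ t0 t0; rewrite (_ : (fun x => _) = (fun=> 0)); last first.
    by apply/funext => x; rewrite mulr0 addr0.
  by move=> h; lra.
have := lin a _ _ tp t0; rewrite T0 addr0 => <-.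
by congr T; apply/funext => x; rewrite addr0.
Qed.

Lemma fourierE (T : (R -> R) -> R) k :
  fourier T k = Complex ((2 * pi)^-1 * T (ck k)) (- ((2 * pi)^-1 * T (sk k))).
Proof. by []. Qed.

Lemma fourier_hermitian (T : (R -> R) -> R) : is_distr T -> fourier T 0 = 0 ->
  hermitian (fourier T).
Proof.
move=> dT T0; split=> // k; rewrite !fourierE.
have -> : ck (- k) = ck k :> (R -> R).
  by apply/funext => x; rewrite /ck rmorphN /= mulNr cosN.
have -> : sk (- k) = (fun x => - 1 * sk k x) :> (R -> R).
  by apply/funext => x; rewrite mulN1r /sk rmorphN /= mulNr sinN.
rewrite distr_scale //; last exact: testfun_sk.
by apply: complex_ext => /=; ring.
Qed.

Lemma fourier_ddx (T : (R -> R) -> R) k : is_distr T ->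
  fourier (ddx T) k = - (mi R k * fourier T k).
Proof.
move=> dT; rewrite !fourierE /ddx.
have -> : ((ck k)^`())%classic = (fun x => - k%:~R * sk k x) :> (R -> R).
  by apply/funext => x; rewrite derive1E; have [_ ->] := drv_ck k x; rewrite mulNr.
have -> : ((sk k)^`())%classic = (fun x => k%:~R * ck k x) :> (R -> R).
  by apply/funext => x; rewrite derive1E; have [_ ->] := drv_sk k x.
rewrite !distr_scale //; [|exact: testfun_ck|exact: testfun_sk].
by apply: complex_ext; rewrite !ReImE /=; ring.
Qed.

End Trigonometric.

(** * Trigonometric series *)

Section Synthesis.
Variable R : realType.
Implicit Types (c d : int -> R[i]) (phi : R -> R) (x A e : R) (k j : int) (N M : nat).

(** The real part of [c_k e^(ikx)]. *)
Definition ek c k x : R := Re (c k) * ck k x - Im (c k) * sk k x.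
Definition trigP N c x : R := \sum_(k <- Zr N) ek c k x.
Definition synth c x : R := sumZ (fun k => ek c k x).

Lemma ek_le c k x : `|ek c k x| <= 2 * nc (c k).
Proof.
apply: le_trans (ler_normB _ _) _; rewrite !normrM mulr2n mulrDl mul1r; apply: lerD.
  by apply: le_trans (Re_le_nc _); rewrite ler_piMr // ck_le1.
by apply: le_trans (Im_le_nc _); rewrite ler_piMr // sk_le1.
Qed.

Lemma per_ek c k : periodic (ek c k) (2 * pi).
Proof. by move=> x; rewrite /ek per_ck per_sk. Qed.

Lemma drv_trigP N c x : is_derive x 1 (trigP N c) (- trigP N (fun k => mi R k * c k) x).
Proof.
have H k : is_derive x 1 (ek c k) (- ek (fun k => mi R k * c k) k x).
  apply: is_derive_eq (drv_sub (drv_scale _ (drv_ck k x)) (drv_scale _ (drv_sk k x))) _.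
  by rewrite /ek !ReImE /=; ring.
by rewrite /trigP -sumrN; apply: drv_sum => k _.
Qed.

Lemma cont_trigP N c : continuous (trigP N c).
Proof. by move=> x; exact: drv_cont (drv_trigP N c x). Qed.

Lemma per_trigP N c : periodic (trigP N c) (2 * pi).
Proof. by move=> x; apply: eq_bigr => k _; exact: per_ek. Qed.

Section Summable.
Variables (c : int -> R[i]) (A : R).
Hypothesis cA : sumle (fun k => nc (c k)) A.

Lemma synth_cvg x : (fun N => trigP N c x) @ \oo --> synth c x.
Proof.
apply: (sumZ_cvg (A := 2 * A)); apply: sumle_mono (sumleZ (ler0n R 2) cA) => k.
exact: ek_le.
Qed.

Lemma synth_close e : 0 < e -> exists N0, forall N, (N0 <= N)%N ->
  forall x, `|trigP N c x - synth c x| <= e.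
Proof.
move=> e0; have e2 : 0 < e / 2 by rewrite divr_gt0.
have [N0 hN] := sumle_outside (fun k => nc_ge0 (c k)) cA e2.
exists N0 => N /hN tail x; apply/ler_addgt0Pr => eta eta0.
move/cvgrPdist_le: (@synth_cvg x) => /(_ eta eta0) [M0 _ hM0].
pose M := maxn N M0; have h1 := hM0 M (leq_maxr _ _).
have h2 : `|trigP N c x - trigP M c x| <= e.
  rewrite distrC /trigP (sum_Zr_widen _ (leq_maxl N M0)) -sumrB.
  apply: le_trans (ler_norm_sum _ _ _) _.
  apply: (@le_trans _ _ (\sum_(k <- Zr M) 2 * (if k \in Zr N then 0 else nc (c k)))).
    apply: ler_sum => k _; case: ifP => _; first by rewrite subrr normr0 mulr0.
    by rewrite subr0 ek_le.
  by rewrite -mulr_sumr; have := tail _ (uniq_Zr M); lra.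
rewrite -(subrKA (trigP M c x)); apply: le_trans (ler_normD _ _) _; apply: lerD => //.
by rewrite distrC.
Qed.

Lemma cont_synth : continuous (synth c).
Proof.
move=> x; apply/cvgrPdist_le => e e0; have e3 : 0 < e / 3 by rewrite divr_gt0.
have [N /(_ N (leqnn _)) hN] := synth_close e3.
have H : \forall t \near x, `|trigP N c x - trigP N c t| <= e / 3.
  by move/cvgrPdist_le: (@cont_trigP N c x); apply.
near=> t; have h : `|trigP N c x - trigP N c t| <= e / 3 by near: t.
have := hN x; have := hN t; move: h; rewrite !ler_norml.
by move=> /andP[? ?] /andP[? ?] /andP[? ?]; apply/andP; split; lra.
Unshelve. all: by end_near.
Qed.

Lemma circle_synth : circle_fun (synth c).
Proof.
split; last exact: cont_intg cont_synth.
by move=> x; rewrite /synth; congr sumZ; apply/funext => k; exact: per_ek.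
Qed.

Lemma integ_synth phi e : continuous phi -> 0 < e -> exists N0, forall N, (N0 <= N)%N ->
  `|integ (fun x => trigP N c x * phi x) - integ (fun x => synth c x * phi x)| <= e.
Proof.
move=> cp e0; have [M M0 hM] := cont_bounded cp.
have den : 0 < M * (2 * pi) + 1 by rewrite ltr_wpDl // mulr_ge0 // ltW // pi2_gt0.
have [N0 hN] := synth_close (divr_gt0 e0 den); exists N0 => N /hN h.
have i1 := intgM (cont_intg (@cont_trigP N c)) cp.
have i2 := intgM (cont_intg cont_synth) cp.
rewrite -integB //.
rewrite (@eq_integ _ _ (fun x => (trigP N c x - synth c x) * phi x)); last first.
  by move=> x _; rewrite mulrBl.
have i3 := intgB (cont_intg (@cont_trigP N c)) (cont_intg cont_synth).
apply: le_trans (norm_integ_le i3 cp hM) _.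
apply: (@le_trans _ _ (M * (e / (M * (2 * pi) + 1) * (2 * pi)))).
  rewrite ler_wpM2l // -integ_cst; apply: integ_le; first exact: intg_norm.
    by apply: cont_intg; exact: cst_continuous.
  by move=> x _; exact: h.
rewrite [leLHS](_ : _ = e * (M * (2 * pi) / (M * (2 * pi) + 1))); last first.
  by ring.
by rewrite ler_piMr ?(ltW e0) // ler_pdivrMr // mul1r lerDl.
Qed.

End Summable.

Lemma pick_sum (f : int -> R) N k : k \in Zr N ->
  \sum_(j <- Zr N) (if j == k then f j else 0) = f k.
Proof.
by move=> kN; rewrite -big_mkcond -big_filter filter_pred1_uniq ?uniq_Zr // big_seq1.
Qed.

Lemma integ_trigP_ck N c k : hermitian c -> k \in Zr N ->
  integ (fun x => trigP N c x * ck k x) = 2 * pi * Re (c k).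
Proof.
move=> [_ hc] kN; have kN' : - k \in Zr N by rewrite mem_Zr abszN -mem_Zr.
pose F j x := 2^-1 * Re (c j) * (ck (j - k) x + ck (j + k) x)
   - 2^-1 * Im (c j) * (sk (j + k) x + sk (j - k) x).
have iC m := cont_intg (@cont_ck R m); have iS m := cont_intg (@cont_sk R m).
have iF j : intg (F j).
  by apply: intgB; apply: intgZ; apply: intgD.
have -> : (fun x => trigP N c x * ck k x) = (fun x => \sum_(j <- Zr N) F j x).
  apply/funext => x; rewrite /trigP mulr_suml; apply: eq_bigr => j _.
  by rewrite /ek mulrBl -!mulrA ck_mul sk_ck_mul /F; ring.
have [_ ->] := integ_sum (Zr N) iF.
have E j : integ (F j) = pi * (if j == k then Re (c j) else 0) +
    pi * (if j == - k then Re (c j) else 0).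
  rewrite integB; [|by apply: intgZ; exact: intgD|by apply: intgZ; exact: intgD].
  rewrite !integZ ?integD //; try exact: intgD.
  rewrite !integ_ck !integ_sk subr_eq0 addr_eq0.
  by case: (j == k); case: (j == - k); lra.
rewrite (eq_bigr _ (fun j _ => E j)) big_split /= -!mulr_sumr !pick_sum // hc Re_conj; lra.
Qed.

Lemma integ_trigP_sk N c k : hermitian c -> k \in Zr N ->
  integ (fun x => trigP N c x * sk k x) = - (2 * pi * Im (c k)).
Proof.
move=> [_ hc] kN; have kN' : - k \in Zr N by rewrite mem_Zr abszN -mem_Zr.
pose F j x := 2^-1 * Re (c j) * (sk (k + j) x + sk (k - j) x)
   - 2^-1 * Im (c j) * (ck (j - k) x - ck (j + k) x).
have iC m := cont_intg (@cont_ck R m); have iS m := cont_intg (@cont_sk R m).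
have iF j : intg (F j).
  by apply: intgB; apply: intgZ; [apply: intgD|apply: intgB].
have -> : (fun x => trigP N c x * sk k x) = (fun x => \sum_(j <- Zr N) F j x).
  apply/funext => x; rewrite /trigP mulr_suml; apply: eq_bigr => j _.
  by rewrite /ek mulrBl -!mulrA [ck j x * _]mulrC sk_ck_mul sk_mul /F; ring.
have [_ ->] := integ_sum (Zr N) iF.
have E j : integ (F j) = - pi * (if j == k then Im (c j) else 0) +
    pi * (if j == - k then Im (c j) else 0).
  rewrite integB; [|by apply: intgZ; exact: intgD|by apply: intgZ; exact: intgB].
  rewrite !integZ; [|exact: intgB|exact: intgD].
  rewrite (integD (iS _) (iS _)) (integB (iC _) (iC _)) !integ_ck !integ_sk subr_eq0 addr_eq0.
  by case: (j == k); case: (j == - k); lra.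
rewrite (eq_bigr _ (fun j _ => E j)) big_split /= -!mulr_sumr !pick_sum // hc Im_conj; lra.
Qed.

Lemma integ_trigP_sq N c : hermitian c ->
  integ (fun x => trigP N c x ^+ 2) = 2 * pi * \sum_(k <- Zr N) nc (c k) ^+ 2.
Proof.
move=> hc.
pose F k x := Re (c k) * (trigP N c x * ck k x) - Im (c k) * (trigP N c x * sk k x).
have iT := cont_intg (@cont_trigP N c).
have iC k := intgM iT (@cont_ck R k); have iS k := intgM iT (@cont_sk R k).
have iF k : intg (F k) by apply: intgB; exact: intgZ.
have -> : (fun x => trigP N c x ^+ 2) = (fun x => \sum_(k <- Zr N) F k x).
  apply/funext => x; rewrite expr2 {2}/trigP mulr_sumr; apply: eq_bigr => k _.
  by rewrite /F /ek; ring.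
have [_ ->] := integ_sum (Zr N) iF; rewrite mulr_sumr.
apply: eq_big_seq => k kN; rewrite integB; [|exact: intgZ|exact: intgZ].
by rewrite !integZ // integ_trigP_ck // integ_trigP_sk // ncE; ring.
Qed.

Lemma fourier_synth c A k : hermitian c -> sumle (fun k => nc (c k)) A ->
  fourier (distr_of (synth c)) k = c k.
Proof.
move=> hc cA; have p0 := pi2_gt0 R.
have H phi l : continuous phi ->
    (forall N, k \in Zr N -> integ (fun x => trigP N c x * phi x) = l) ->
    integ (fun x => synth c x * phi x) = l.
  move=> cp hN; apply/eqP; rewrite -subr_eq0 -normr_le0; apply/ler_addgt0Pr => e e0.
  rewrite add0r; have [N0 h] := integ_synth cA cp e0.
  pose N := maxn N0 `|k|%N; have := h N (leq_maxl _ _).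
  by rewrite hN ?mem_Zr ?leq_maxr // distrC.
rewrite fourierE; apply: complex_ext => /=.
  rewrite -[distr_of _ _]/(integ (fun x => synth c x * ck k x)).
  rewrite (H _ (2 * pi * Re (c k)) (@cont_ck R k)); first by rewrite mulKf // gt_eqF.
  by move=> N kN; exact: integ_trigP_ck.
rewrite -[distr_of _ _]/(integ (fun x => synth c x * sk k x)).
rewrite (H _ (- (2 * pi * Im (c k))) (@cont_sk R k)).
  by rewrite mulrN opprK mulKf // gt_eqF.
by move=> N kN; exact: integ_trigP_sk.
Qed.

(** Integration by parts over a period. *)
Lemma integ_trigP_deriv N c phi : testfun phi ->
  integ (fun x => trigP N c x * (phi^`())%classic x) =
  integ (fun x => trigP N (fun k => mi R k * c k) x * phi x).
Proof.
move=> tp; have [tp' dp] := testfun_deriv tp.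
have c1 := @cont_trigP N c; have c2 := @cont_trigP N (fun k => mi R k * c k).
have cp := testfun_cont tp; have cp' := testfun_cont tp'.
have i1 := intgM (cont_intg c1) cp'; have i2 := intgM (cont_intg c2) cp.
apply/eqP; rewrite -subr_eq0 -integB //; apply/eqP.
have d x : is_derive x 1 (fun x => trigP N c x * phi x)
    (trigP N c x * (phi^`())%classic x - trigP N (fun k => mi R k * c k) x * phi x).
  by apply: is_derive_eq (drv_mul (drv_trigP N c x) (dp x)) _; ring.
rewrite (integ_deriv d); first by rewrite -[2 * pi]add0r per_trigP tp.1 subrr.
by move=> x; apply: cvgB; apply: cvgM; [exact: c1|exact: cp'|exact: c2|exact: cp].
Qed.

End Synthesis.

(** * Square summable coefficients *)

Section RieszFischer.
Variable R : realType.
Local Notation mu := (@lebesgue_measure R).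
Local Notation D := (`[0, 2 * pi]%classic : set (measurableTypeR R)).
Variables (d : int -> R[i]) (A : R).
Hypothesis hd : hermitian d.
Hypothesis dA : sumle (fun k => nc (d k) ^+ 2) A.

Let sq0 k : 0 <= nc (d k) ^+ 2. Proof. exact: sqr_ge0. Qed.

Let n_ (j : nat) : nat := projT1 (cid (sumle_outside sq0 dA
  (exprn_gt0 2 (exprn_gt0 j (divr_gt0 ltr01 (ltr0Sn R 1)))))).

Let n_P j N : (n_ j <= N)%N ->
  sumle (fun k => if k \in Zr N then 0 else nc (d k) ^+ 2) (((1 / 2) ^+ j) ^+ 2).
Proof. exact: (projT2 (cid (sumle_outside sq0 dA _))). Qed.

(** Frequencies at which the partial sums are sampled: the blocks between them
    have square norms decreasing geometrically. *)
Let N_ (j : nat) : nat := \sum_(i < j.+1) (n_ i).+1.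

Let N_S j : N_ j.+1 = (N_ j + (n_ j.+1).+1)%N.
Proof. by rewrite /N_ big_ord_recr. Qed.

Let N_mono j : (N_ j <= N_ j.+1)%N.
Proof. by rewrite N_S leq_addr. Qed.

Let N_ge j : (n_ j <= N_ j)%N.
Proof. by case: j => [|j]; rewrite ?N_S /N_ ?big_ord1 //; lia. Qed.

Let N_infty j : (j <= N_ j)%N.
Proof. by elim: j => // j IH; rewrite N_S; lia. Qed.

Let p (j : nat) (x : R) : R := trigP (N_ j) d x.
Let h (j : nat) (x : R) : R := p j.+1 x - p j x.

Let ah (j : nat) (x : R) : R := `|h j x|.

Let cp j : continuous (p j). Proof. exact: cont_trigP. Qed.
Let ch j : continuous (h j).
Proof. by move=> x; apply: cvgB; exact: cp. Qed.

Let h_l1 j : integ (ah j) <= 2 * pi * (1 / 2) ^+ j.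
Proof.
pose d' k := if k \in Zr (N_ j) then 0 else d k.
have hd' : hermitian d'.
  have [d0 hdk] := hd; split=> [|k]; first by rewrite /d' d0; case: ifP.
  by rewrite /d' !mem_Zr abszN; case: ifP => _; rewrite ?conjc0 // hdk.
have hE : h j = trigP (N_ j.+1) d'.
  apply/funext => x; rewrite /h /p /trigP (sum_Zr_widen _ (N_mono j)) -sumrB.
  apply: eq_bigr => k _; rewrite /ek /d'; case: ifP => _; last by rewrite subr0.
  by rewrite subrr /= !mul0r subrr.
set q := (1 / 2) ^+ j; have q0 : 0 < q by rewrite exprn_gt0 // divr_gt0.
have sq : integ (fun x => h j x ^+ 2) <= 2 * pi * q ^+ 2.
  rewrite hE integ_trigP_sq // ler_wpM2l ?(ltW (pi2_gt0 R)) //.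
  apply: le_trans (n_P (N_ge j) (uniq_Zr (N_ j.+1))).
  apply: ler_sum => k _; rewrite /d'; case: ifP => // _.
  by rewrite Normc.normc0 expr0n.
have ih2 : intg (fun x => h j x ^+ 2).
  by apply: cont_intg => x; rewrite /=; under eq_fun do rewrite expr2; apply: cvgM; exact: ch.
have cst_i (a : R) : intg (fun=> a) by apply: cont_intg; exact: cst_continuous.
(* AM-GM with the weight q that balances the two terms *)
apply: (@le_trans _ _ (integ (fun x => q / 2 + (2 * q)^-1 * h j x ^+ 2))).
  apply: integ_le.
  - by apply: intg_norm; exact: cont_intg.
  - by apply: intgD => //; exact: intgZ.
  move=> x _; rewrite -subr_ge0 /ah -(real_normK (num_real (h j x))).
  rewrite [X in 0 <= X](_ : _ = (2 * q)^-1 * (q - `|h j x|) ^+ 2).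
    by rewrite mulr_ge0 ?sqr_ge0 // invr_ge0 mulr_ge0 // ltW.
  by field; rewrite gt_eqF.
rewrite integD //; last exact: intgZ.
rewrite integ_cst integZ //.
have : (2 * q)^-1 * integ (fun x => h j x ^+ 2) <= (2 * q)^-1 * (2 * pi * q ^+ 2).
  by rewrite ler_wpM2l // invr_ge0 mulr_ge0 // ltW.
have -> : (2 * q)^-1 * (2 * pi * q ^+ 2) = pi * q by field; rewrite gt_eqF.
by lra.
Qed.

Local Open Scope ereal_scope.

Let G (x : R) : \bar R := \sum_(0 <= j <oo) (ah j x)%:E.

Let mh j : measurable_fun D (EFin \o ah j).
Proof.
apply/measurable_EFinP; apply: cont_meas => x; apply: (@continuous_comp _ _ _ (h j) Num.norm).
  exact: ch.
exact: norm_continuous.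
Qed.

Let h0 (j : nat) (x : R) : 0 <= (ah j x)%:E.
Proof. by rewrite lee_fin; exact: normr_ge0. Qed.

Let mG : measurable_fun D G.
Proof.
have := @ge0_emeasurable_sum _ _ R D (fun j => EFin \o ah j) xpredT
  (fun j x _ _ => h0 j x) (fun j _ => mh j).
by apply: eq_measurable_fun => x _; congr (limn _); apply/funext => n; apply: eq_bigl => i; rewrite inE.
Qed.

Let iG : mu.-integrable D G.
Proof.
apply/integrableP; split; first exact: mG.
have G0 (x : R) : 0 <= G x by apply: nneseries_ge0 => j _ _; exact: h0.
have -> : \int[mu]_(x in D) `|G x| = \int[mu]_(x in D) G x.
  by apply: eq_integral => x _; rewrite gee0_abs.
rewrite (integral_nneseries mu (@measD R) mh (fun j x _ => h0 j x)).
apply: (@le_lt_trans _ _ (4 * pi)%:E); last by rewrite ltry.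
apply: lime_le; first by apply: is_cvg_nneseries => j _ _; apply: integral_ge0 => x _; exact: h0.
near=> n; apply: (@le_trans _ _ (\sum_(0 <= j < n) (2 * pi * (1 / 2) ^+ j)%:E)).
  apply: lee_sum => j _.
  have ih : intg (ah j) by apply: intg_norm; exact: cont_intg.
  have := h_l1 j; rewrite /integ /Rintegral -lee_fin fineK //.
  by apply: integrable_fin_num => //; exact: measD.
rewrite sumEFin lee_fin.
suff -> : (\sum_(0 <= j < n) 2 * pi * (1 / 2) ^+ j = 4 * pi - 4 * pi * (1 / 2) ^+ n :> R)%R.
  by rewrite gerBl !mulr_ge0 ?pi_ge0 // exprn_ge0 // divr_ge0.
elim: (n) => [|m IH]; first by rewrite big_geq // expr0 mulr1 subrr.
by rewrite big_nat_recr //= IH exprS; lra.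
Unshelve. all: by end_near.
Qed.

Let g (x : R) : R := fine (limn_esup (fun j => (p j x)%:E)).

Local Close Scope ereal_scope.

Let g_cvg (x : R) : (G x \is a fin_num) -> (fun j => p j x) @ \oo --> g x /\
  forall j, `|p j x| <= `|p 0 x| + fine (G x).
Proof.
move=> fG; pose u j := h j x.
have part n : \sum_(0 <= j < n) `|u j| <= fine (G x).
  rewrite -lee_fin fineK // -sumEFin; apply: nneseries_lim_ge => j _ _; exact: h0.
have pE n : p n x = p 0 x + series u n.
  rewrite /series /=; elim: n => [|n IH]; first by rewrite big_geq // addr0.
  by rewrite big_nat_recr //= addrA -IH /u /h addrC subrK.
have cu : cvgn (series u).
  apply: normed_cvg; apply: nondecreasing_is_cvgn.
    by apply: nondecreasing_series => n _ _; exact: normr_ge0.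
  by exists (fine (G x)) => _ [n _ <-]; exact: part.
have cvp : cvgn (fun j => p j x).
  apply/cvg_ex; exists (p 0 x + limn (series u)); under eq_fun do rewrite pE.
  by apply: cvgD => //; exact: cvg_cst.
split; last first.
  move=> j; rewrite pE; apply: le_trans (ler_normD _ _) _; rewrite lerD2l.
  by apply: le_trans (part j); exact: ler_norm_sum.
have cvE : (fun j => (p j x)%:E) @ \oo --> (limn (fun j => p j x))%:E.
  by apply: cvg_EFin; [exact: nearW|exact: cvp].
rewrite /g is_cvg_limn_esupE; last by apply/cvg_ex; eexists; exact: cvE.
by rewrite (cvg_lim _ cvE) //; exact: cvp.
Qed.

(** Some periodic integrable function is the limit in the mean of a subsequence
    of the partial sums, and so it represents every limit of their pairings. *)
Lemma riesz_fischer : exists g : R -> R, circle_fun g /\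
  forall phi l, continuous phi ->
    (forall e, 0 < e -> exists N0, forall N, (N0 <= N)%N ->
       `|integ (fun x => trigP N d x * phi x) - l| <= e) ->
    integ (fun x => g x * phi x) = l.
Proof.
have mE j : measurable_fun D (EFin \o p j) by apply/measurable_EFinP; exact: cont_meas.
have mg : measurable_fun D g.
  apply: measurableT_comp; first exact: fine_measurable.
  by apply: measurable_fun_limn_esup => j; exact: mE.
have ae_fin := integrable_ae (@measD R) iG.
have ibound := integrableD (@measD R) (intg_norm (cont_intg (@cp 0))) iG.
have H1 : \forall x \ae mu, D x -> (EFin \o p j) x @[j --> \oo] --> (EFin \o g) x.
  apply: filterS ae_fin => x H Dx; have [c _] := g_cvg (H Dx).
  by apply: cvg_EFin; [exact: nearW|exact: c].
have H2 : \forall x \ae mu, forall n, D x ->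
    (`|(EFin \o p n) x| <= ((EFin \o (fun x : R => `|p 0 x|%R)) \+ G) x)%E.
  apply: filterS ae_fin => x H n Dx; have [_ b] := g_cvg (H Dx).
  by rewrite /= -(fineK (H Dx)) -EFinD lee_fin.
have [ig lim_ _] := dominated_convergence (@measD R) mE
  ((measurable_EFinP D g).2 mg) H1 ibound H2.
have igg : intg g by exact: ig.
exists g; split.
  split=> // x; rewrite /g; congr (fine (limn_esup _)); apply/funext => j.
  by rewrite /p per_trigP.
move=> phi l cphi hl; apply/eqP; rewrite -subr_eq0 -normr_le0.
apply/ler_addgt0Pr => e e0; rewrite add0r.
have [M M0 hM] := cont_bounded cphi.
have M1 : 0 < 2 * (M + 1) by rewrite mulr_gt0 // ltr_wpDl.
have e2 : 0 < e / 2 by rewrite divr_gt0.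
have [N0 hN] := hl _ e2.
have flim : (fun n => integ (fun x => `|p n x - g x|)) @ \oo --> (0 : R).
  have -> : (fun n => integ (fun x => `|p n x - g x|)) =
      fine \o (fun n => (\int[mu]_(x in D) `|(EFin \o p n) x - (EFin \o g) x|)%E).
    by apply/funext => n; rewrite /integ /Rintegral.
  by apply: fine_cvg; exact: lim_.
move/cvgrPdist_le: flim => /(_ _ (divr_gt0 e0 M1)) [j0 _ hj].
pose j := maxn j0 N0.
have Nj : (N0 <= N_ j)%N by apply: leq_trans (N_infty j); exact: leq_maxr.
have i1 := hN _ Nj.
have := hj j (leq_maxl _ _); rewrite sub0r normrN /= => i2.
have ip := cont_intg (@cp j).
have ipg := intgB ip igg.
have i3 : integ (fun x => `|p j x - g x|) <= e / (2 * (M + 1)).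
  by apply: le_trans (ler_norm _) i2.
have i4 := norm_integ_le ipg cphi hM.
have E : integ (fun x => (p j x - g x) * phi x) =
    integ (fun x => p j x * phi x) - integ (fun x => g x * phi x).
  rewrite -integB; [|exact: intgM ip cphi|exact: intgM igg cphi].
  by apply: eq_integ => x _; ring.
rewrite {}E in i4.
have i5 : M * integ (fun x => `|p j x - g x|) <= e / 2.
  apply: le_trans (ler_wpM2l M0 i3) _.
  rewrite [leLHS](_ : _ = (M / (M + 1)) * (e / 2)); last by field; rewrite gt_eqF // ltr_wpDl.
  by rewrite ler_piMl ?(ltW e2) // ler_pdivrMr ?ltr_wpDl // mul1r lerDl.
move: i1 (le_trans i4 i5); rewrite /p !ler_norml => /andP[? ?] /andP[? ?].
by apply/andP; split; lra.
Qed.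

End RieszFischer.

(** * Uniqueness of Fourier coefficients in L1 *)

Section Window.
Variable R : realType.
Implicit Types (z w : R) (n m : nat).

Lemma bernoulli_lower w m : 0 <= w <= 1 -> 1 - m%:R * w <= (1 - w) ^+ m.
Proof.
move=> /andP[w0 w1]; elim: m => [|m IH]; first by rewrite mul0r subr0 expr0.
rewrite exprS -natr1; have h : (1 - w) * (1 - m%:R * w) <= (1 - w) * (1 - w) ^+ m.
  by rewrite ler_wpM2l // subr_ge0.
apply: le_trans h; have := mulr_ge0 (ler0n R m) (mulr_ge0 w0 w0); nra.
Qed.

Lemma bernoulli_upper w m : 0 <= w <= 1 -> (1 - w) ^+ m * (m%:R * w) <= 1.
Proof.
move=> /andP[w0 w1]; have : (1 - w) ^+ m * (1 + m%:R * w) <= 1.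
  elim: m => [|m IH]; first by rewrite expr0 mul0r addr0 mulr1.
  apply: le_trans IH; rewrite exprSr -mulrA ler_wpM2l ?exprn_ge0 ?subr_ge0 //.
  rewrite -natr1; have := mulr_ge0 (ler0n R m) (mulr_ge0 w0 w0); nra.
have : 0 <= (1 - w) ^+ m by rewrite exprn_ge0 // subr_ge0.
lra.
Qed.

(** Polynomials in [z] which, on [[0, 1]] and away from [z = 1/2], converge to the
    indicator of [z > 1/2]. *)
Definition step n z : R := 1 - (1 - z ^+ n) ^+ (2 ^ n)%N.

Lemma step_norm n z : 0 <= z <= 1 -> `|step n z| <= 1.
Proof.
move=> /andP[z0 z1]; have a0 : 0 <= 1 - z ^+ n by rewrite subr_ge0 exprn_ile1.
have a1 : 1 - z ^+ n <= 1 by rewrite gerBl exprn_ge0.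
have b0 : 0 <= (1 - z ^+ n) ^+ (2 ^ n)%N by rewrite exprn_ge0.
have b1 : (1 - z ^+ n) ^+ (2 ^ n)%N <= 1 by rewrite exprn_ile1.
by rewrite /step ger0_norm ?subr_ge0 // gerBl.
Qed.

Lemma step_cvg0 z : 0 <= z -> z < 1 / 2 -> step n z @[n --> \oo] --> (0 : R).
Proof.
move=> z0 z2; apply: (@squeeze_cvgr _ _ _ _ (fun=> 0) (fun n => (2 * z) ^+ n)).
- near=> n; have /andP[w0 w1] : 0 <= z ^+ n <= 1 by rewrite exprn_ge0 // exprn_ile1 //; lra.
  rewrite /step; apply/andP; split.
    by rewrite subr_ge0 exprn_ile1 //; lra.
  have := @bernoulli_lower (z ^+ n) (2 ^ n)%N; rewrite w0 w1 natrX exprMn => /(_ isT); lra.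
- exact: cvg_cst.
- by apply: cvg_expr; rewrite ger0_norm; lra.
Unshelve. all: by end_near. Qed.

Lemma step_cvg1 z : z <= 1 -> 1 / 2 < z -> step n z @[n --> \oo] --> (1 : R).
Proof.
move=> z1 z2.
suff h : (1 - z ^+ n) ^+ (2 ^ n)%N @[n --> \oo] --> (0 : R).
  by rewrite -[X in _ --> X]subr0; apply: cvgB => //; exact: cvg_cst.
apply: (@squeeze_cvgr _ _ _ _ (fun=> 0) (fun n => (2 * z)^-1 ^+ n)).
- near=> n; have /andP[w0 w1] : 0 <= z ^+ n <= 1.
    by rewrite exprn_ge0 ?exprn_ile1 //; lra.
  rewrite exprn_ge0 ?subr_ge0 //=.
  have p : 0 < (2 * z) ^+ n by rewrite exprn_gt0 //; lra.
  rewrite exprVn -div1r ler_pdivlMr //.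
  have := @bernoulli_upper (z ^+ n) (2 ^ n)%N; rewrite w0 w1 natrX exprMn => /(_ isT).
  by [].
- exact: cvg_cst.
- apply: cvg_expr; rewrite ger0_norm ?invr_ge0; last by lra.
  by rewrite invf_lt1; lra.
Unshelve. all: by end_near. Qed.

End Window.

Section Uniqueness.
Variable R : realType.
Implicit Types (f phi psi : R -> R) (x y : R).

Local Notation mu := (@lebesgue_measure R).
Local Notation D := (`[0, 2 * pi]%classic : set (measurableTypeR R)).

Variable g : R -> R.
Hypothesis hg : intg g.

(** The continuous functions all of whose products with trigonometric
    polynomials are orthogonal to [g]; closed under multiplication by
    trigonometric polynomials. *)
Definition orth phi := continuous phi /\ forall k,
  integ (fun x => g x * (phi x * ck k x)) = 0 /\ integ (fun x => g x * (phi x * sk k x)) = 0.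

Lemma orth_ci phi k : continuous phi ->
  intg (fun x => g x * (phi x * ck k x)) /\ intg (fun x => g x * (phi x * sk k x)).
Proof.
move=> cp; split; apply: intgM => // x; apply: cvgM; first exact: cp.
- exact: cont_ck.
- exact: cp.
- exact: cont_sk.
Qed.

Lemma orth_lin a phi psi : orth phi -> orth psi -> orth (fun x => a * phi x + psi x).
Proof.
move=> [c1 h1] [c2 h2]; split=> [x|k].
  by apply: cvgD; [apply: cvgM; [exact: cvg_cst|exact: c1]|exact: c2].
have [i1 j1] := orth_ci k c1; have [i2 j2] := orth_ci k c2.
have [e1 e1'] := h1 k; have [e2 e2'] := h2 k; split.
  rewrite (@eq_integ _ _ (fun x => a * (g x * (phi x * ck k x)) + g x * (psi x * ck k x))).
    by rewrite integD // ?integZ // ?e1 ?e2 ?mulr0 ?addr0 //; exact: intgZ.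
  by move=> x _; ring.
rewrite (@eq_integ _ _ (fun x => a * (g x * (phi x * sk k x)) + g x * (psi x * sk k x))).
  by rewrite integD // ?integZ // ?e1' ?e2' ?mulr0 ?addr0 //; exact: intgZ.
by move=> x _; ring.
Qed.

Lemma orth_half (p q : R -> R) (h : R -> R) : intg p -> intg q ->
  integ p = 0 -> integ q = 0 -> (forall x, h x = 2^-1 * p x + 2^-1 * q x) -> integ h = 0.
Proof.
move=> ip iq p0 q0 e; rewrite (@eq_integ _ _ (fun x => 2^-1 * p x + 2^-1 * q x)) //.
by rewrite integD ?integZ // ?p0 ?q0 ?mulr0 ?addr0 //; exact: intgZ.
Qed.

Lemma orth_ck1 phi : orth phi -> orth (fun x => phi x * ck 1 x).
Proof.
move=> [c h]; split=> [x|k]; first by apply: cvgM; [exact: c|exact: cont_ck].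
have [i1 j1] := orth_ci (1 + k) c; have [i2 j2] := orth_ci (1 - k) c.
have [i3 j3] := orth_ci (k - 1) c; have [i4 j4] := orth_ci (k + 1) c.
split.
  apply: (orth_half i1 i2); [by case: (h (1 + k))|by case: (h (1 - k))|].
  by move=> x; rewrite -[phi x * _ * _]mulrA ck_mul; ring.
apply: (orth_half j3 j4); [by case: (h (k - 1))|by case: (h (k + 1))|].
by move=> x; rewrite -[phi x * _ * _]mulrA [ck 1 x * _]mulrC sk_ck_mul; ring.
Qed.

Lemma orth_sk1 phi : orth phi -> orth (fun x => phi x * sk 1 x).
Proof.
move=> [c h]; split=> [x|k]; first by apply: cvgM; [exact: c|exact: cont_sk].
have [i1 j1] := orth_ci (1 + k) c; have [i2 j2] := orth_ci (1 - k) c.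
have i1' := intgZ (- 1) i1.
split.
  apply: (orth_half j1 j2); [by case: (h (1 + k))|by case: (h (1 - k))|].
  by move=> x; rewrite -[phi x * _ * _]mulrA sk_ck_mul; ring.
apply: (orth_half i2 i1'); [by case: (h (1 - k))| |].
  by rewrite integZ //; case: (h (1 + k)) => -> _; rewrite mulr0.
by move=> x; rewrite -[phi x * _ * _]mulrA sk_mul; ring.
Qed.

Hypothesis hck : forall k, integ (fun x => g x * ck k x) = 0.
Hypothesis hsk : forall k, integ (fun x => g x * sk k x) = 0.

Lemma orth1 : orth (fun=> 1).
Proof.
split=> [|k]; first exact: cst_continuous.
by split; [rewrite -[RHS](hck k)|rewrite -[RHS](hsk k)]; apply: eq_integ => x _; rewrite mul1r.
Qed.

(** For [0 < y < 2 pi] this exceeds [1/2] exactly when [y < x]. *)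
Definition bump x y : R := 1 / 2 + (cos (y - x / 2) - cos (x / 2)) / 4.

Lemma orth_bump x phi : orth phi -> orth (fun y => phi y * bump x y).
Proof.
move=> h; have := orth_lin (cos (x / 2) / 4) (orth_ck1 h)
  (orth_lin (sin (x / 2) / 4) (orth_sk1 h) (orth_lin (1 / 2 - cos (x / 2) / 4 - 1) h h)).
congr orth; apply/funext => y; rewrite /bump cosB /ck /sk !mul1r; lra.
Qed.

Lemma orth_bumpX x n phi : orth phi -> orth (fun y => phi y * bump x y ^+ n).
Proof.
elim: n phi => [|n IH] phi h.
  by rewrite (_ : (fun y => _) = phi) //; apply/funext => y; rewrite expr0 mulr1.
rewrite (_ : (fun y => _) = (fun y => (phi y * bump x y) * bump x y ^+ n)).
  by apply: IH; exact: orth_bump.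
by apply/funext => y; rewrite exprS mulrA.
Qed.

Lemma orth_step x n : orth (fun y => step n (bump x y)).
Proof.
have h m phi : orth phi -> orth (fun y => phi y * (1 - bump x y ^+ n) ^+ m).
  elim: m phi => [|m IH] phi hp.
    by rewrite (_ : (fun y => _) = phi) //; apply/funext => y; rewrite expr0 mulr1.
  rewrite (_ : (fun y => _) =
      (fun y => (- 1 * (phi y * bump x y ^+ n) + phi y) * (1 - bump x y ^+ n) ^+ m)).
    by apply: IH; apply: orth_lin => //; exact: orth_bumpX.
  by apply/funext => y; rewrite exprS mulrA; congr (_ * _); ring.
rewrite (_ : (fun y => _) = (fun y => - 1 * (1 * (1 - bump x y ^+ n) ^+ (2 ^ n)%N) + 1)).
  by apply: orth_lin; [apply: h|]; exact: orth1.
by apply/funext => y; rewrite /step; ring.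
Qed.

Lemma bump01 x y : 0 <= bump x y <= 1.
Proof.
have := cos_le1 (y - x / 2); have := cos_geN1 (y - x / 2).
have := cos_le1 (x / 2); have := cos_geN1 (x / 2); rewrite /bump => *.
apply/andP; split; lra.
Qed.

Lemma bumpE x y : bump x y = 1 / 2 + sin (y / 2) * sin ((x - y) / 2) / 2.
Proof.
rewrite /bump.
have -> : y - x / 2 = y / 2 - (x - y) / 2 by lra.
have -> : cos (x / 2) = cos (y / 2 + (x - y) / 2) by congr cos; lra.
rewrite cosB cosD; lra.
Qed.

Lemma ae_neq (a : R) : {ae mu, forall y, y != a}.
Proof.
exists [set a]; split; [exact: measurable_set1|exact: lebesgue_measure_set1|].
by move=> y /= /negP; rewrite negbK => /eqP.
Qed.

(** Along the polynomials of [orth_step] the products with [g] integrate to [0] and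
    converge almost everywhere to [g] times the indicator of [[0, x]], under the
    domination by [|g|]. *)
Lemma integ_prefix_eq0 x : 0 < x -> x < 2 * pi ->
  \int[mu]_(y in `[0, x]) g y = 0.
Proof.
move=> x0 x2.
have mx : measurable (`[0, x] : set (measurableTypeR R)) by exact: measurable_itv.
have mg : measurable_fun D g by have /integrableP[/measurable_EFinP] := hg.
have xD : D `&` `[0, x]%classic = `[0, x]%classic.
  apply/seteqP; split=> y /=; first by case.
  by rewrite !in_itv /= => /andP[y0 yx]; rewrite y0 yx (le_trans yx (ltW x2)).
rewrite -xD Rintegral_mkcondr.
pose F n (y : R) := (g y * step n (bump x y))%:E.
have [] := @dominated_convergence _ _ R mu D (@measD R) F (EFin \o (g \_ `[0, x]))
    (EFin \o (fun y => `|g y|)).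
- move=> n; apply/measurable_EFinP; apply: measurable_funM => //.
  by apply: cont_meas; case: (orth_step x n).
- apply/measurable_EFinP; apply/(measurable_restrict _ mx (@measD R)).
  rewrite xD; apply: (measurable_funS (@measD R) _ mg); rewrite -xD; exact: subIsetl.
- have h1 := ae_neq 0; have h2 := ae_neq x; have h3 := ae_neq (2 * pi).
  have FF := ae_filter_ringOfSetsType mu.
  apply: filterS3 h1 h2 h3 => y y0 yx y2; rewrite /= in_itv /= => /andP[y0' y2'].
  apply: cvg_EFin; first by near=> n.
  have /andP[b0 b1] := bump01 x y.
  have yp : 0 < y by rewrite lt_neqAle eq_sym y0.
  have yq : y < 2 * pi by rewrite lt_neqAle y2.
  have sy : 0 < sin (y / 2) by apply: sin_gt0_pi; apply/andP; split; lra.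
  rewrite patchE mem_setE in_itv /= y0' /=.
  have [yx'|xy] := leP y x.
    have lt : y < x by rewrite lt_neqAle yx.
    have sxy : 0 < sin ((x - y) / 2) by apply: sin_gt0_pi; apply/andP; split; lra.
    rewrite -[X in _ --> X]mulr1; apply: cvgM; first exact: cvg_cst.
    apply: step_cvg1 => //; rewrite bumpE; have := mulr_gt0 sy sxy; lra.
  have sxy : 0 < sin ((y - x) / 2) by apply: sin_gt0_pi; apply/andP; split; lra.
  rewrite -[X in _ --> X](mulr0 (g y)); apply: cvgM; first exact: cvg_cst.
  apply: step_cvg0 => //; rewrite bumpE.
  have -> : (x - y) / 2 = - ((y - x) / 2) by lra.
  rewrite sinN; have := mulr_gt0 sy sxy; lra.
- exact: intg_norm hg.
- apply/aeW => y n _; rewrite /= lee_fin normrM ler_piMr //.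
  exact/step_norm/bump01.
move=> _ _; rewrite (_ : (fun n => _) = (fun=> 0%E)); last first.
  apply/funext => n; have [c h] := orth_step x n.
  have [i0 _] := orth_ci 0 c.
  have [/= e0 _] := h 0.
  have e1 : integ (fun y => g y * step n (bump x y)) = 0.
    by rewrite -[RHS]e0; apply: eq_integ => y _; rewrite /ck mul0r cos0 mulr1.
  have i1 : intg (fun y => g y * step n (bump x y)) by exact: intgM.
  have fn : (\int[mu]_(y in D) (F n y))%E \is a fin_num.
    exact: integrable_fin_num (@measD R) _ i1.
  by rewrite -(fineK fn) -[0%E]/(0%:E) -[in RHS]e1.
move=> /(cvg_lim (@ereal_hausdorff R)) e0.
have := etrans (esym e0) (lim_cst (@ereal_hausdorff R) _) => e.
exact: (congr1 fine (e _)).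
Unshelve. all: by end_near. Qed.

(** The indefinite integral vanishes, and by Lebesgue its derivative is [g] almost
    everywhere. *)
Lemma ae_eq0 : {ae mu, forall x, D x -> g x = 0}.
Proof.
pose f := g \_ D.
have intf : mu.-integrable setT (EFin \o f).
  by have := hg; rewrite /intg (integrable_mkcond _ (@measD R)) restrict_EFin.
have FF := ae_filter_ringOfSetsType mu.
have loc : locally_integrable [set: R] f by apply: open_integrable_locally => //; exact: openT.
have ii y : mu.-integrable [set` Interval (BLeft 0) (BRight y)] (EFin \o f).
  by apply: integrableS intf => //; exact: measurable_itv.
have := FTC1 ii loc.
have h1 := ae_neq 0; have h2 := ae_neq (2 * pi); move=> h3.
apply: filterS3 h1 h2 h3 => x x0 x2 h.
rewrite /= in_itv /= => /andP[x0' x2'].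
have xp : 0 < x by rewrite lt_neqAle eq_sym x0.
have xq : x < 2 * pi by rewrite lt_neqAle x2.
have [_] : derivable (fun y => \int[mu]_(t in `[0, y]) f t) x 1 /\
    (fun y => \int[mu]_(t in `[0, y]) f t)^`()%classic x = f x.
  by apply: h; rewrite /= lte_fin.
set F := (fun y => \int[mu]_(t in `[0, y]) f t); rewrite /f patchE mem_setE in_itv /= x0' x2' /= => <-.
rewrite derive1E -[RHS](derive_cst 0 x 1); apply: near_eq_derive.
near=> y; rewrite /F.
have yp : 0 < y by near: y; exact: lt_nbhsr.
have yq : y < 2 * pi by near: y; exact: lt_nbhsl.
rewrite -[RHS](integ_prefix_eq0 yp yq); apply: eq_Rintegral => z.
rewrite inE /= in_itv /= => /andP[z0 zy]; rewrite /f patchE mem_setE in_itv /= z0.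
by rewrite (le_trans zy (ltW yq)).
Unshelve. all: by end_near. Qed.

End Uniqueness.
Section PeriodicAe.
Variable R : realType.
Implicit Types (f g : R -> R) (x t : R).

Local Notation mu := (@lebesgue_measure R).
Local Notation D := (`[0, 2 * pi]%classic : set (measurableTypeR R)).

Lemma meas_shift t : measurable_fun [set: measurableTypeR R]
  ((fun x => x + t) : measurableTypeR R -> measurableTypeR R).
Proof. by apply: measurable_funD => //; exact: measurable_id. Qed.

Lemma lebesgue_shift t (A : set (measurableTypeR R)) : measurable A ->
  mu ((fun x => x + t) @^-1` A) = mu A.
Proof.
move=> mA; apply/esym; apply: (@lebesgue_measure_unique R
  (measure_function_pushforward__canonical__measure_function_Measure mu (meas_shift t))) => //.
move=> X [[a b] _ <-] /=; rewrite /pushforward.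
have -> : (fun x => x + t) @^-1` `]a, b] = `](a - t), (b - t)]%classic.
  by apply/seteqP; split=> x /=; rewrite !in_itv /= ltrBlDr lerBrDr.
rewrite !lebesgue_measure_itv /= !lte_fin ltrD2r; case: ifP => // _.
by rewrite -!EFinD; congr EFin; ring.
Qed.

(** Lebesgue measure is invariant under translations. *)
Lemma ae_shift t (P : R -> Prop) : {ae mu, forall x, P x} -> {ae mu, forall x, P (x + t)}.
Proof.
move=> [N [mN N0 hN]]; exists ((fun x => x + t) @^-1` N); split.
- by have := meas_shift t measurableT mN; rewrite setTI.
- by rewrite lebesgue_shift.
- by move=> x /= h; exact: hN.
Qed.

Lemma ae_periodic g : periodic g (2 * pi) -> {ae mu, forall x, D x -> g x = 0} ->
  {ae mu, forall x, g x = 0}.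
Proof.
move=> per h; have FF := ae_filter_ringOfSetsType mu.
have h1 : {ae mu, forall x, forall n, D (x + n%:R * (2 * pi)) -> g (x + n%:R * (2 * pi)) = 0}.
  by apply/ae_foralln => n; exact: (ae_shift (n%:R * (2 * pi)) h).
have h2 : {ae mu, forall x, forall n, D (x - n%:R * (2 * pi)) -> g (x - n%:R * (2 * pi)) = 0}.
  by apply/ae_foralln => n; exact: (ae_shift (- (n%:R * (2 * pi))) h).
apply: filterS2 h1 h2 => x k1 k2; have p := pi2_gt0 R.
have /andP[] := floor_itv (x / (2 * pi)).
rewrite ler_pdivlMr // ltr_pdivrMr // rmorphD /= mulrDl mul1r.
case: (Num.floor _) => n; rewrite -?pmulrn => a b.
  have := k2 n; rewrite -(per_int (- n%:Z) x per) rmorphN /= mulNr -pmulrn; apply.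
  by rewrite /= in_itv /=; apply/andP; split; lra.
move: a b; rewrite NegzE mulrNz -pmulrn !mulNr => a b.
rewrite -(per_nat n.+1 x per); apply: k1.
by rewrite /= in_itv /=; apply/andP; split; lra.
Qed.

(** The difference has vanishing coefficients, so it vanishes almost everywhere on one
    period by [ae_eq0], and on the line by [ae_periodic]. *)
Lemma fourier_inj g1 g2 : circle_fun g1 -> circle_fun g2 ->
  (forall k, fourier (distr_of g1) k = fourier (distr_of g2) k) ->
  {ae mu, forall x, g1 x = g2 x}.
Proof.
move=> [p1 i1] [p2 i2] e; have FF := ae_filter_ringOfSetsType mu.
have ig : intg (fun x => g1 x - g2 x) by exact: intgB.
have p0 : (2 * pi)^-1 != 0 :> R by rewrite invr_neq0 // gt_eqF // pi2_gt0.
have per : periodic (fun x => g1 x - g2 x) (2 * pi) by move=> x; rewrite p1 p2.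
have e' phi : continuous phi -> distr_of g1 phi = distr_of g2 phi ->
    integ (fun x => (g1 x - g2 x) * phi x) = 0.
  move=> cp ep; rewrite (@eq_integ _ _ (fun x => g1 x * phi x - g2 x * phi x)).
    rewrite integB; [|exact: intgM|exact: intgM].
    by rewrite [integ _]ep subrr.
  by move=> x _; ring.
have eck k : integ (fun x => (g1 x - g2 x) * ck k x) = 0.
  apply: e'; first exact: cont_ck.
  by have := congr1 (@complex.Re R) (e k); rewrite !fourierE /= => /(mulfI p0).
have esk k : integ (fun x => (g1 x - g2 x) * sk k x) = 0.
  apply: e'; first exact: cont_sk.
  by have := congr1 (@complex.Im R) (e k); rewrite !fourierE /= => /oppr_inj /(mulfI p0).
have := ae_periodic per (ae_eq0 ig eck esk).
by apply: filterS => x /eqP; rewrite subr_eq0 => /eqP.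
Qed.

End PeriodicAe.

(** * Sobolev norms of distributions *)

Section SobolevNorm.
Variable R : realType.
Implicit Types (T U : (R -> R) -> R) (r s B e : R) (g phi : R -> R) (c : int -> R[i]) (k : int).

Lemma Hnorm_ge0 r T : (0 <= Hnorm r T)%E.
Proof. exact: sqrte_ge0. Qed.

(** The supremum over finite sets of frequencies that defines the sum is the one that
    [sumle] bounds; the value at [0] is excluded on one side and vanishes on the other. *)
Lemma HnormP r T B : 0 <= B -> fourier T 0 = 0 ->
  (Hnorm r T <= B%:E)%E <-> hbd r (fourier T) B.
Proof.
move=> B0 T0; pose w k : R := (ab k `^ r * nc (fourier T k)) ^+ 2.
have w0 k : 0 <= w k by exact: sqr_ge0.
have -> : Hnorm r T = sqrte (\esum_(k in [set k : int | k != 0]) (w k)%:E).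
  by rewrite /Hnorm; congr sqrte; apply: eq_esum => k _; rewrite /w exprMn powRsq.
have -> : B%:E = sqrte ((B ^+ 2)%:E) by rewrite /= sqrtr_sqr ger0_norm.
rewrite lee_sqrt ?lee_fin ?sqr_ge0 //; split=> [h l ul|h].
  have -> : \sum_(k <- l) (ab k `^ r * nc (fourier T k)) ^+ 2 =
      \sum_(k <- [seq k <- l | k != 0]) w k.
    rewrite big_filter [RHS]big_mkcond; apply: eq_bigr => k _.
    by case: eqP => // ->; rewrite T0 Normc.normc0 mulr0 expr0n.
  have ul' : uniq [seq k <- l | k != 0] by exact: filter_uniq.
  rewrite -lee_fin; apply: le_trans h; apply: esum_ge.
  exists [set` [seq k <- l | k != 0]].
    split; first exact: finite_seq.
    by move=> k /=; rewrite mem_filter => /andP[].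
  by rewrite -fsbig_seq // -sumEFin.
apply: ge_ereal_sup => _ [X [fX _] <-].
by rewrite fsbig_finite // sumEFin lee_fin; apply: h; exact: finmap.fset_uniq.
Qed.

Lemma fine_Hnorm_le r T B : 0 <= B -> fourier T 0 = 0 -> hbd r (fourier T) B ->
  fine (Hnorm r T) <= B.
Proof.
move=> B0 T0 /(HnormP _ B0 T0) h; have := Hnorm_ge0 r T; move: h.
by case: (Hnorm r T) => [x|//|_ //]; rewrite lee_fin.
Qed.

Lemma Hdot_hbd r T : Hdot r T -> [/\ hermitian (fourier T), 0 <= fine (Hnorm r T) &
  hbd r (fourier T) (fine (Hnorm r T))].
Proof.
move=> [dT _ T0 fin]; have N0 := Hnorm_ge0 r T.
have F0 : 0 <= fine (Hnorm r T) by rewrite fine_ge0.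
split=> //; first exact: fourier_hermitian.
by apply/(HnormP _ F0 T0); rewrite fineK // ge0_fin_numE.
Qed.

Lemma cvge0P (I : Type) (G : set_system I) (FG : Filter G) (h : I -> \bar R) :
  (forall t, 0 <= h t)%E ->
  h @ G --> 0%E <-> forall e, 0 < e -> \forall t \near G, (h t <= e%:E)%E.
Proof.
move=> h0; split=> [/fine_cvgP[fin /cvgrPdist_le c] e e0|c].
  have := c e e0; apply: filterS2 fin => t ft.
  rewrite sub0r normrN ger0_norm ?fine_ge0 // => /=.
  by rewrite -lee_fin fineK.
apply/fine_cvgP; split.
  by apply: filterS (c 1 ltr01) => t ht; rewrite ge0_fin_numE // (le_lt_trans ht) ?ltry.
apply/cvgrPdist_le => e e0; apply: filterS (c e e0) => t ht.
rewrite sub0r normrN ger0_norm ?fine_ge0 //= -lee_fin fineK //.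
by rewrite ge0_fin_numE // (le_lt_trans ht) ?ltry.
Qed.

Lemma fourierB T U k : fourier (T \- U) k = fourier T k - fourier U k.
Proof. by rewrite !fourierE; apply: complex_ext; rewrite !ReImE /=; ring. Qed.

Lemma fourier_quotient (h : R) T U V k :
  fourier (fun phi => h^-1 * (T phi - U phi) - V phi) k =
  (h^-1)%:C%C * (fourier T k - fourier U k) - fourier V k.
Proof. by rewrite !fourierE; apply: complex_ext; rewrite !ReImE /=; ring. Qed.

Lemma CH_intro (I : set R) r (W : R -> (R -> R) -> R) : (forall t, I t -> Hdot r (W t)) ->
  (forall t0 e, I t0 -> 0 < e -> exists2 del, 0 < del & forall t, `|t - t0| < del ->
     I t /\ hbd r (fun k => fourier (W t) k - fourier (W t0) k) e) ->
  CH I r W.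
Proof.
move=> hW hc; split=> // t0 It0; apply/cvge0P => [t|e e0]; first exact: Hnorm_ge0.
have [del del0 hdel] := hc t0 e It0 e0.
apply/nbhs_ballP; exists del => //= t; rewrite /ball /= distrC => /hdel[It h].
have E : fourier (W t \- W t0) = (fun k => fourier (W t) k - fourier (W t0) k).
  by apply/funext => k; exact: fourierB.
apply/HnormP; [exact: ltW|by rewrite fourierB; case: (hW _ It) => _ _ -> _;
  case: (hW _ It0) => _ _ -> _; rewrite subrr|by rewrite E].
Qed.

Lemma CH_elim (I : set R) r (W : R -> (R -> R) -> R) t0 e : CH I r W -> open I -> I t0 ->
  0 < e -> exists2 del, 0 < del & forall t, `|t - t0| < del ->
    I t /\ hbd r (fun k => fourier (W t) k - fourier (W t0) k) e.
Proof.
move=> [hW hc] oI It0 e0.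
have FF : Filter (nbhs t0) by exact: nbhs_filter.
have h1 := (cvge0P FF (fun t => Hnorm_ge0 r (W t \- W t0))).1 (hc t0 It0) e e0.
have h2 : \forall t \near t0, I t by exact: open_nbhs_nbhs.
have h3 : nbhs t0 (fun t => I t /\ (Hnorm r (W t \- W t0)%R <= e%:E)%E) by exact: filterI.
have [del /= del0 hdel] := (@nbhs_ballP R R t0 _).1 h3; exists del => // t td.
have [It ht] := hdel t (ltac:(by rewrite /ball /= distrC)); split=> //.
have := (HnormP r (ltW e0) _).1 ht.
have E : fourier (W t \- W t0) = (fun k => fourier (W t) k - fourier (W t0) k).
  by apply/funext => k; exact: fourierB.
rewrite E; apply; case: (hW _ It) => _ _ -> _; case: (hW _ It0) => _ _ -> _.
by rewrite subrr.
Qed.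

Lemma C1H_intro (I : set R) r (U W : R -> (R -> R) -> R) : open I -> CH I r U -> CH I r W ->
  (forall t e, I t -> 0 < e -> exists2 del, 0 < del & forall h, h != 0 -> `|h| < del ->
     hbd r (fun k => (h^-1)%:C%C * (fourier (U (t + h)) k - fourier (U t) k) - fourier (W t) k) e) ->
  C1H I r U W.
Proof.
move=> oI hU hW hq; split=> // t It; apply/cvge0P => [h|e e0]; first exact: Hnorm_ge0.
have [del1 d10 hd1] := CH_elim hU oI It ltr01.
have [del2 d20 hd2] := hq t e It e0.
apply/nbhs_ballP; exists (Num.min del1 del2) => /= [|h]; first by rewrite lt_min d10.
rewrite /ball /= sub0r normrN lt_min => /andP[h1 h2] hn.
have [Ith _] := hd1 (t + h) (ltac:(by rewrite addrC addKr)).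
set Q := (fun phi => _); have E : fourier Q =
    (fun k => (h^-1)%:C%C * (fourier (U (t + h)) k - fourier (U t) k) - fourier (W t) k).
  by apply/funext => k; exact: fourier_quotient.
apply/HnormP; [exact: ltW| |by rewrite E; exact: hd2].
case: hU => [hU _]; case: hW => [hW _]; rewrite E.
case: (hU _ Ith) => _ _ -> _; case: (hU _ It) => _ _ -> _; case: (hW _ It) => _ _ -> _.
by rewrite subrr mulr0 subrr.
Qed.

Lemma C1H_elim (I : set R) r (U W : R -> (R -> R) -> R) t e : C1H I r U W -> open I -> I t ->
  0 < e -> exists2 del, 0 < del & forall h, h != 0 -> `|h| < del -> I (t + h) /\
     hbd r (fun k => (h^-1)%:C%C * (fourier (U (t + h)) k - fourier (U t) k) - fourier (W t) k) e.
Proof.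
move=> [hU hW hq] oI It e0; have [del1 d10 hd1] := CH_elim hU oI It ltr01.
have FF : Filter (0^' : set_system R) by exact: dnbhs_filter.
have := (cvge0P FF (fun h => Hnorm_ge0 r _)).1 (hq t It) e e0.
move=> /nbhs_ballP[del2 /= d20 hd2]; exists (Num.min del1 del2) => [|h hn].
  by rewrite lt_min d10.
rewrite lt_min => /andP[h1 h2].
have [Ith _] := hd1 (t + h) (ltac:(by rewrite addrC addKr)); split=> //.
have := hd2 h (ltac:(by rewrite /ball /= sub0r normrN)) hn.
set Q := (fun phi => _) => hQ; have E : fourier Q =
    (fun k => (h^-1)%:C%C * (fourier (U (t + h)) k - fourier (U t) k) - fourier (W t) k).
  by apply/funext => k; exact: fourier_quotient.
rewrite -E; apply/HnormP => //; first exact: ltW.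
case: hU => [hU _]; case: hW => [hW _]; rewrite E.
case: (hU _ Ith) => _ _ -> _; case: (hU _ It) => _ _ -> _; case: (hW _ It) => _ _ -> _.
by rewrite subrr mulr0 subrr.
Qed.

End SobolevNorm.

(** * Distributions with prescribed coefficients *)

Section Distributions.
Variable R : realType.
Implicit Types (T : (R -> R) -> R) (g phi psi : R -> R) (c : int -> R[i]) (s B e : R) (k : int).

Lemma derive1_lin (a : R) phi psi : testfun phi -> testfun psi ->
  ((fun x => a * phi x + psi x)^`())%classic =
  (fun x => a * (phi^`())%classic x + (psi^`())%classic x).
Proof.
move=> /testfun_deriv[_ d1] /testfun_deriv[_ d2]; apply/funext => x; rewrite derive1E.
by have [_ ->] := drv_add (drv_scale a (d1 x)) (d2 x).
Qed.

(** The distribution [- dT/dx]. *)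
Definition ddx_neg T phi : R := T (phi^`())%classic.

Lemma is_distr_deriv T : is_distr T -> is_distr (ddx_neg T).
Proof.
move=> [lin [N [c bT]]]; split=> [a phi psi tp tq|].
  by rewrite /ddx_neg derive1_lin //; apply: lin; apply: (testfun_deriv _).1.
exists N.+1, c => phi M tp hM; apply: bT; first by have [] := testfun_deriv tp.
by move=> j x jN; rewrite -derive1Sn; exact: hM.
Qed.

Lemma fourier_deriv T k : is_distr T -> fourier (ddx_neg T) k = mi R k * fourier T k.
Proof.
move=> /(fourier_ddx k) /(congr1 -%R); rewrite opprK => <-.
by rewrite !fourierE /ddx /ddx_neg; apply: complex_ext; rewrite !ReImE /=; ring.
Qed.

Lemma Hdot_synth s c B : 1 / 2 < s -> 0 <= B -> hermitian c -> hbd s c B ->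
  circle_fun (synth c) /\ Hdot s (distr_of (synth c)).
Proof.
move=> s1 B0 hc cB; have cA := hbd_l1 s1 B0 hc.1 cB.
have cf := circle_synth cA; split=> //.
have E : fourier (distr_of (synth c)) = c by apply/funext => k; exact: fourier_synth cA.
split; [exact: distr_of_is_distr|by move=> _; exists (synth c)|by rewrite E hc.1|].
by apply: le_lt_trans (ltry B); apply/HnormP; rewrite ?E // hc.1.
Qed.

(** For [1 <= s] the derivative must be an integrable function, which is the
    Riesz-Fischer theorem; otherwise only its norm matters. *)
Lemma Hdot_deriv s c B : 1 / 2 < s -> 0 <= B -> hermitian c -> hbd s c B ->
  Hdot (s - 1) (ddx_neg (distr_of (synth c))).
Proof.
move=> s1 B0 hc cB; have cA := hbd_l1 s1 B0 hc.1 cB.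
have cf := circle_synth cA; have dT := distr_of_is_distr cf.
have E : fourier (ddx_neg (distr_of (synth c))) = (fun k => mi R k * c k).
  by apply/funext => k; rewrite fourier_deriv // (fourier_synth _ hc cA).
have dB := hbd_mi cB; have d0 : mi R 0 * c 0 = 0 by rewrite hc.1 mulr0.
split; [exact: is_distr_deriv| |by rewrite E|].
- move=> s0; have hd : hermitian (fun k => mi R k * c k).
    split=> // k; rewrite hc.2; apply: complex_ext; rewrite !ReImE /= rmorphN /=; ring.
  have dA : sumle (fun k => nc (mi R k * c k) ^+ 2) (B ^+ 2).
    apply: sumle_mono dB => k; rewrite exprMn.
    have [->|k0] := eqVneq k 0; first by rewrite d0 Normc.normc0 expr0n mulr0.
    by rewrite ler_peMl ?sqr_ge0 // powRsq // powR_ge1 ?ab_ge1 //; lra.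
  have [g [cg hg]] := riesz_fischer hd dA; exists g => // phi tp.
  apply/esym; apply: hg => [|e e0]; first exact: testfun_cont.
  have ctd := testfun_cont (testfun_deriv tp).1.
  have [N0 h] := integ_synth cA ctd e0; exists N0 => N /h.
  by rewrite integ_trigP_deriv.
- by apply: le_lt_trans (ltry B); apply/HnormP; rewrite ?E.
Qed.

End Distributions.

Section BilinearCoefficients.
Variables (R : realType) (lambda : R) (S : int -> int -> int -> R[i]) (C s Cs : R).
Hypothesis adm : admissible lambda S C s Cs.

Lemma Qc_hermitian c B : 0 <= B -> hermitian c -> hbd s c B -> hermitian (Qc S c).
Proof.
move=> B0 hc cB; split=> [|k].
  apply: complex_eq_eps => e e0; rewrite subr0; apply: le_trans (ltW e0).
  apply: sumZC_le => r _; rewrite big1 // => n _.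
  by rewrite oppr0 (adm_zero adm) ?mul0r // Normc.normc0.
apply: complex_eq_eps => e e0; have e2 : 0 < e / 2 by lra.
have [N h] := Qc_approx adm B0 e2.
have h1 := h N (leqnn N) c hc.1 cB (- k); have h2 := h N (leqnn N) c hc.1 cB k.
have -> : Qc S c (- k) - (Qc S c k)^*%C = (Qc S c (- k) - bq S N c c (- - k)) -
    (Qc S c k - bq S N c c (- k))^*%C.
  by rewrite rmorphB /= opprK (bq_hermitian adm N _ hc hc) conjcK; ring.
by apply: le_trans (ncB _ _) _; rewrite ncJ; lra.
Qed.

End BilinearCoefficients.

(** * Solutions and their coefficients *)

Section Solutions.
Variables (R : realType) (lambda : R) (S : int -> int -> int -> R[i]) (C s Cs : R).
Hypothesis adm : admissible lambda S C s Cs.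
Local Notation K := (Kc lambda C s Cs).
Local Notation mu := (@lebesgue_measure R).

Lemma tstarP (x t : R) : 0 <= x -> (`|t|%:E < tstar x)%E = (x * `|t| < 1).
Proof.
rewrite le_eqVlt /tstar => /predU1P[<-|x0]; first by rewrite eqxx mul0r ltr01 ltry.
by rewrite gt_eqF // lte_fin mulrC -ltr_pdivlMr // div1r.
Qed.

Lemma lifespan_open (F : R) : 0 <= F -> open [set t : R | K * F * `|t| < 1].
Proof.
move=> F0; rewrite openE => t /= /(room adm F0)[F' [T [FF' tT KT]]].
apply/nbhs_ballP; exists (T - `|t|) => /= [|t']; first by rewrite subr_gt0.
rewrite /ball /= => tt'; apply: le_lt_trans KT; have K0 := Kc_ge0 adm.
have t'T : `|t'| <= T.
  by have := ler_normB t' t; have := ler_normD (t' - t) t; rewrite subrK distrC => *; lra.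
by apply: ler_pM => //; [exact: mulr_ge0|apply: ler_wpM2l => //; exact: ltW].
Qed.

Lemma ae_distr_of (g1 g2 phi : R -> R) : circle_fun g1 -> circle_fun g2 -> continuous phi ->
  {ae mu, forall x, g1 x = g2 x} -> distr_of g1 phi = distr_of g2 phi.
Proof.
move=> [_ i1] [_ i2] cp h; rewrite /distr_of /Rintegral; congr fine.
have m g : intg g -> measurable_fun `[0, 2 * pi] (fun x => (g x * phi x)%:E).
  by move=> ig; have /integrableP[] := intgM ig cp.
apply: ae_eq_integral; [exact: measD|exact: m|exact: m|].
have FF := ae_filter_ringOfSetsType mu.
by apply: filterS h => x e _; rewrite e.
Qed.

Lemma cderiv_quotient (a : R -> R[i]) t d :
  (forall e, 0 < e -> exists2 del, 0 < del & forall h, h != 0 -> `|h| < del ->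
     nc ((h^-1)%:C%C * (a (t + h) - a t) - d) <= e) -> cderiv a t d.
Proof.
move=> H; suff h e : 0 < e -> exists2 del, 0 < del &
    forall h, `|h| < del -> nc (a (t + h) - a t - h%:C%C * d) <= e * `|h|.
  split; apply/is_deriveE => e /h[del d0 hd]; exists del => // x /hd; apply: le_trans.
    by apply: le_trans (Re_le_nc _); rewrite !ReImE /= mul0r subr0.
  by apply: le_trans (Im_le_nc _); rewrite !ReImE /= mul0r addr0.
move=> e0; have [del d0 hd] := H e e0; exists del => // x xd.
have [->|x0] := eqVneq x 0.
  by rewrite addr0 subrr mul0r subrr Normc.normc0 normr0 mulr0.
have -> : a (t + x) - a t - x%:C%C * d =
    x%:C%C * ((x^-1)%:C%C * (a (t + x) - a t) - d).
  rewrite mulrBr mulrA -rmorphM /= divff // mul1r //.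
rewrite Normc.normcM mulrC; have -> : nc x%:C%C = `|x|.
  by rewrite /= expr0n addr0 sqrtr_sqr.
by rewrite ler_wpM2r // hd.
Qed.

Section Coefficients.
Variables (f : R -> R) (I : set R) (v : R -> R -> R).
Hypothesis hf : circle_fun f.
Hypothesis oI : open I.
Hypothesis sol : is_solution S s f I v.

Let w t := fourier (distr_of (v t)).

(** Testing the equation against [cos (k x)] and [sin (k x)]: a single coefficient is
    controlled by the norm of [H^(s-1)]. *)
Lemma solution_ode t : I t -> hermitian (w t) /\ forall k, cderiv (w^~ k) t (rhs S (w t) k).
Proof.
move=> It; have [cv hCH [ut hC1 eqn] _] := sol.
have [hC _] := hCH; split=> [|k]; first by have [] := Hdot_hbd (hC t It).
have hut j : fourier (ut t) j = rhs S (w t) j.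
  have [A [dA eA] hA] := eqn t It; rewrite /rhs -[Qc S _ _]eA -fourier_deriv //.
  have e phi : testfun phi -> ut t phi = ddx_neg A phi.
    by move=> /hA; rewrite /ddx /ddx_neg => h; lra.
  by rewrite !fourierE !e //; [exact: testfun_sk|exact: testfun_ck].
have z0 t' : I t' -> w t' 0 = 0 by move=> It'; have [] := hC t' It'.
apply: cderiv_quotient => e e0.
have p0 : 0 < ab k `^ (s - 1) \/ k = 0.
  by have [->|k0] := eqVneq k 0; [right|left; rewrite powR_gt0 // ab_gt0].
case: p0 => [p0|k0].
  have [del d0 hd] := C1H_elim hC1 oI It (mulr_gt0 e0 p0); exists del => // h h0 hdel.
  have [_ hb] := hd h h0 hdel; have := sumle_term k hb.
  rewrite ler_sqr ?nnegrE ?mulr_ge0 ?powR_ge0 ?nc_ge0 ?(ltW e0) //.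
  by rewrite mulrC ler_pM2r // hut.
have [del d0 hd] := C1H_elim hC1 oI It e0; exists del => // h h0 hdel.
have [Ith _] := hd h h0 hdel.
rewrite k0 !z0 // /rhs (_ : mi R 0 = 0); last by apply: complex_ext; rewrite /= ?oppr0.
by rewrite mul0r subrr mulr0 subrr Normc.normc0 ltW.
Qed.

(** The norm is continuous in time, hence bounded on a compact interval. *)
Lemma solution_bound T : 0 <= T -> (forall t, `|t| <= T -> I t) ->
  exists2 B, 0 <= B & forall t, `|t| <= T -> hbd s (w t) B.
Proof.
move=> T0 TI; have [_ hCH _ _] := sol; have [hC _] := hCH.
pose n t := fine (Hnorm s (distr_of (v t))).
have hn t : I t -> 0 <= n t /\ hbd s (w t) (n t).
  by move=> It; have [] := Hdot_hbd (hC t It).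
have z0 t : I t -> w t 0 = 0 by move=> It; have [] := hC t It.
have close t t' e : I t -> I t' -> 0 <= e -> hbd s (fun k => w t k - w t' k) e ->
    n t <= n t' + e.
  move=> It It' e0 h; have [n0 b0] := hn t' It'.
  apply: fine_Hnorm_le; [exact: addr_ge0|exact: z0|].
  have := hbdD n0 e0 b0 h; rewrite (_ : (fun k => _) = w t) //.
  by apply/funext => k; rewrite addrC subrK.
clearbody n; have cn : {within `[- T, T], continuous n}.
  apply: continuous_in_subspaceT => t0; rewrite inE /= in_itv /= -ler_norml => /TI It0.
  apply/cvgrPdist_le => e e0; have [del d0 hd] := CH_elim hCH oI It0 e0.
  apply/nbhs_ballP; exists del => //= t; rewrite /ball /= distrC => /hd[It h].
  have h' : hbd s (fun k => w t0 k - w t k) e.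
    have := hbdN h; rewrite (_ : (fun k => - _) = (fun k => w t0 k - w t k)) //.
    by apply/funext => k; rewrite opprB.
  have h1 := close t t0 e It It0 (ltW e0) h; have h2 := close t0 t e It0 It (ltW e0) h'.
  by rewrite ler_norml lerBlDl h2 andbT lerNl opprB lerBlDl.
have TT : - T <= T by lra.
have [c cT hc] := EVT_max TT cn.
have Ic : I c by apply: TI; rewrite ler_norml; move: cT; rewrite in_itv.
exists (n c) => [|t tT]; first by have [] := hn c Ic.
have [n0 b0] := hn t (TI t tT); apply: hbd_le n0 _ b0.
by apply: hc; rewrite in_itv /= -ler_norml.
Qed.

Lemma solution_init : I 0 -> forall k, w 0 k = fourier (distr_of f) k.
Proof.
move=> I0 k; have [cv _ _ e0] := sol.
rewrite /w !fourierE.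
by rewrite !(@ae_distr_of (v 0) f) //; [exact: cv|exact: cont_sk|exact: cv|exact: cont_ck].
Qed.

End Coefficients.

(** The coefficients provided by [seq_exists] are turned into functions; the regularity
    in time is [strong_cont], [rhs_cont] and [quotient_cont], read through the Fourier
    transform. *)
Lemma synth_solution (f : R -> R) (F : R) (c : R -> int -> R[i]) :
  let I := [set t : R | K * F * `|t| < 1] in
  circle_fun f -> 0 <= F -> c 0 = fourier (distr_of f) ->
  (forall t, I t -> hermitian (c t) /\ forall k, cderiv (c^~ k) t (rhs S (c t) k)) ->
  (forall F' t, F < F' -> K * F' * `|t| < 1 -> hbd s (c t) (growth lambda C s Cs F' t)) ->
  is_solution S s f I (fun t => synth (c t)).
Proof.
move=> I hf F0 c0 sol bd.
have s1 := adm_s1 adm; have oI : open I := lifespan_open F0.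
have bc t : I t -> exists2 B, 0 <= B & hbd s (c t) B.
  move=> /(room adm F0)[F' [T [FF' tT KT]]]; have F'0 : 0 <= F' by lra.
  have [KF' _] := growth_le adm F'0 (ltW tT) KT.
  by exists (growth lambda C s Cs F' t); [exact: (growth_ge0 F'0)|exact: bd].
have hs t : I t -> circle_fun (synth (c t)) /\ Hdot s (distr_of (synth (c t))).
  by move=> It; have [B B0 b] := bc t It; apply: Hdot_synth B0 _ b => //; case: (sol t It).
have fc t : I t -> fourier (distr_of (synth (c t))) = c t.
  move=> It; have [B B0 b] := bc t It; have [hc _] := sol t It.
  by apply/funext => k; apply: fourier_synth hc (hbd_l1 s1 B0 hc.1 b).
have hq t : I t -> exists2 B, 0 <= B & hermitian (Qc S (c t)) /\ hbd s (Qc S (c t)) B.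
  move=> It; have [B B0 b] := bc t It; have [hc _] := sol t It.
  exists (algC C s * B * B).
    by apply: mulr_ge0 => //; apply: mulr_ge0 => //; exact: (algC_ge0 adm).
  by split; [exact: (Qc_hermitian adm B0)|exact: (Qc_hbd adm B0 hc.1 b)].
pose A t := distr_of (synth (Qc S (c t))).
have hA t : I t -> is_distr (A t) /\ fourier (A t) = Qc S (c t).
  move=> It; have [B B0 [hh hb]] := hq t It; have l1 := hbd_l1 s1 B0 hh.1 hb.
  split; first by apply: distr_of_is_distr; exact: circle_synth l1.
  by apply/funext => k; exact: fourier_synth hh l1.
have fA t : I t -> fourier (ddx_neg (A t)) = rhs S (c t).
  by move=> /hA[dA eA]; apply/funext => k; rewrite fourier_deriv // eA.
have hCH : CH I s (fun t => distr_of (synth (c t))).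
  apply: CH_intro => [t /hs[]//|t0 e It0 e0].
  have [del d0 hd] := strong_cont adm F0 sol bd It0 e0; exists del => // t /hd[It h].
  by rewrite -(fc t It) -(fc t0 It0) in h; split; [exact: It|exact: h].
split=> //.
- by move=> t /hs[].
- exists (fun t => ddx_neg (A t)); last first.
    move=> t It; have [dA eA] := hA t It; exists (A t).
      split; first exact: dA.
      by move=> k; rewrite eA /= (fc t It).
    by move=> phi _; rewrite /ddx_neg /ddx subrr.
  have hU : CH I (s - 1) (fun t => distr_of (synth (c t))).
    apply: CH_intro => [t It|t0 e It0 e0].
      have [[dT gT T0 fin] _] := ((hs t It).2, tt); have [B B0 b] := bc t It.
      split; [exact: dT|by move=> _; apply: gT; lra|exact: T0|].
      apply: le_lt_trans (ltry B); apply/HnormP => //; rewrite fc //.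
      apply: sumle_mono b => k; have [->|k0] := eqVneq k 0.
        by have [[-> _] _] := sol t It; rewrite Normc.normc0 !mulr0.
      rewrite ler_sqr ?nnegrE ?mulr_ge0 ?powR_ge0 ?nc_ge0 // ler_wpM2r ?nc_ge0 //.
      by rewrite ler_powR ?ab_ge1 //; lra.
    have [del d0 hd] := strong_cont adm F0 sol bd It0 e0; exists del => // t /hd[It h].
    split=> //; rewrite !fc //; apply: sumle_mono h => k.
    have [->|k0] := eqVneq k 0.
      have [[-> _] _] := sol t It; have [[-> _] _] := sol t0 It0.
      by rewrite subrr Normc.normc0 !mulr0.
    rewrite ler_sqr ?nnegrE ?mulr_ge0 ?powR_ge0 ?nc_ge0 // ler_wpM2r ?nc_ge0 //.
    by rewrite ler_powR ?ab_ge1 //; lra.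
  apply: (C1H_intro oI hU).
    apply: CH_intro => [t It|t0 e It0 e0].
      by have [B B0 [hh hb]] := hq t It; exact: Hdot_deriv B0 hh hb.
    have [del d0 hd] := rhs_cont adm F0 sol bd It0 e0; exists del => // t /hd[It h].
    by rewrite -(fA t It) -(fA t0 It0) in h; split; [exact: It|exact: h].
  move=> t e It e0; have [del1 d10 hd1] := strong_cont adm F0 sol bd It ltr01.
  have [del2 d20 hd2] := quotient_cont adm F0 sol bd It e0.
  exists (Num.min del1 del2) => [|h h0]; first by rewrite lt_min d10.
  rewrite lt_min => /andP[h1 h2].
  have [Ith _] := hd1 (t + h) (ltac:(by rewrite addrC addKr)).
  have h3 := hd2 h h0 h2; rewrite -(fA t It) -(fc _ Ith) -(fc t It) in h3.
  exact: h3.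
- have I0 : I 0 by rewrite /I /= normr0 mulr0.
  apply: fourier_inj => //; first exact: (hs 0 I0).1.
  by move=> k; rewrite fc // c0.
Qed.

End Solutions.

Theorem theorem2 (R : realType) (lambda : R) (hlambda : 0 < lambda)
  (S : int -> int -> int -> R[i])
  (S_i : forall k m n : int, k * m * n = 0 -> S k m n = 0)
  (S_ii : forall k m n : int, S k m n = ((S (- k) (- m) (- n))^*)%C)
  (S_iii : forall k m n : int, S k m n = S k n m)
  (S_iv : forall k m n : int, S k m n = S m n k)
  (S_v : forall (eta : R) (k m n k' m' n' : int), 0 < eta ->
     k'%:~R = eta * k%:~R -> m'%:~R = eta * m%:~R -> n'%:~R = eta * n%:~R ->
     S k' m' n' = (eta `^ (- lambda))%:C%C * S k m n)
  (C : R)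
  (S_vi : forall k m n : int, k * m * n != 0 ->
     Normc.normc (S k m n) <=
       C / Num.min (`|k%:~R| `^ lambda)
             (Num.min (`|m%:~R| `^ lambda) (`|n%:~R| `^ lambda)))
  (Cslambda : R) (s : R)
  (hs : Num.max (3 / 2 - lambda) (1 / 2) < s)
  (hCslambda : is_Cslambda s lambda Cslambda)
  (f : R -> R) (hf : circle_fun f) (hfs : Hdot s (distr_of f)) :
  let K := C * Cslambda * Mconst (s + lambda - 1) in
  let I := [set t : R |
    (`|t|%:E < tstar (K * fine (Hnorm s (distr_of f))))%E] in
  exists u : R -> R -> R,
    is_solution S s f I u /\
    forall v : R -> R -> R, is_solution S s f I v ->
      forall t, I t -> {ae @lebesgue_measure R, forall x, u t x = v t x}.
Proof.
move=> K I.
have /andP[s2 s1] : (3 / 2 - lambda < s) && (1 / 2 < s) by rewrite -gt_max.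
have adm : admissible lambda S C s Cslambda.
  by apply: Admissible => //; lra.
pose F := fine (Hnorm s (distr_of f)).
have [hc0 F0 bF] : [/\ hermitian (fourier (distr_of f)), 0 <= F & hbd s (fourier (distr_of f)) F].
  exact: Hdot_hbd hfs.
have K0 : 0 <= K by exact: (Kc_ge0 adm).
have EI : I = [set t : R | Kc lambda C s Cslambda * F * `|t| < 1].
  by apply/seteqP; split=> t; rewrite /I /= tstarP // mulr_ge0.
have [c [c0 sol bd]] := seq_exists adm F0 hc0 bF.
have uS := synth_solution adm hf F0 c0 sol bd.
exists (fun t => synth (c t)); rewrite EI; split=> // v vS t /= It.
have oI := lifespan_open adm F0.
have sub (t' : R) : `|t'| <= `|t| -> Kc lambda C s Cslambda * F * `|t'| < 1.
  by move=> h; case: (growth_le (T := `|t|) adm F0 h It).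
(* [seq_unique] compares two solutions with a common bound on [-|t|, |t|] *)
have [B B0 hB] := solution_bound oI vS (normr_ge0 t) sub.
have [B' B'0 hB'] := solution_bound oI uS (normr_ge0 t) sub.
have I0 : Kc lambda C s Cslambda * F * `|0 : R| < 1 by apply: sub; rewrite normr0.
have M0 : 0 <= Num.max B B' by rewrite le_max B0.
have hM (t' : R) : `|t'| <= `|t| -> hbd s (fourier (distr_of (synth (c t')))) (Num.max B B') /\
    hbd s (fourier (distr_of (v t'))) (Num.max B B').
  move=> h; split; [apply: (hbd_le B'0) (hB' t' h)|apply: (hbd_le B0) (hB t' h)].
    by rewrite le_max lexx orbT.
  by rewrite le_max lexx.
have e := seq_unique adm (normr_ge0 t) M0
  (fun (t' : R) h => solution_ode oI uS (sub t' h))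
  (fun (t' : R) h => solution_ode oI vS (sub t' h))
  (fun k => etrans (solution_init hf uS I0 k) (esym (solution_init hf vS I0 k))) hM.
have [cu _ _ _] := uS; have [cv _ _ _] := vS.
by apply: fourier_inj; [exact: cu|exact: cv|move=> k; exact: e].
Qed.
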